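(* Assume (l1)–(l6). Then there exist real numbers $\lambda_*\le\lambda_-$ such that: (i) $\lambda>\lambda_-$ if and only if $(\Omega^b_\lambda)^-=\Omega$ and $(\mathfrak a^-_\lambda,\mathfrak r^-_\lambda)$ is an attractor–repeller pair of copies of the base for $\tau^-_\lambda$. For $\lambda>\lambda_-$: $\lim_{t\to\infty}(v^-_\lambda(t,\omega,x)-\mathfrak a^-_\lambda(\omega\cdot t))=0$ iff $x>\mathfrak r^-_\lambda(\omega)$, and $\lim_{t\to-\infty}(v^-_\lambda(t,\omega,x)-\mathfrak r^-_\lambda(\omega\cdot t))=0$ iff $x<\mathfrak a^-_\lambda(\omega)$. The maps $(\lambda_-,\infty)\to C(\Omega,\mathbb R)$, $\lambda\mapsto-\mathfrak r^-_\lambda$ and $\lambda\mapsto\mathfrak a^-_\lambda$, are continuous and strictly increasing, with $\lim_{\lambda\to\infty}\mathfrak r^-_\lambda=-\infty$ and $\lim_{\lambda\to\infty}\mathfrak a^-_\lambda=\infty$ uniformly on $\Omega$. (ii) $(\Omega^b_{\lambda_-})^-=\Omega$; $\mathfrak r^-_{\lambda_-}=\lim_{\lambda\to\lambda_-^+}\mathfrak r^-_\lambda$ and $\mathfrak a^-_{\lambda_-}=\lim_{\lambda\to\lambda_-^+}\mathfrak a^-_\lambda$ pointwise on $\Omega$; and $\inf_{\omega\in\Omega}(\mathfrak a^-_{\lambda_-}(\omega)-\mathfrak r^-_{\lambda_-}(\omega))=0$. (iii) $\mathfrak a^-_{\lambda_1}>\mathfrak a^-_{\lambda_-}\ge\mathfrak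 r^-_{\lambda_-}>\mathfrak r^-_{\lambda_2}$ whenever $\lambda_1>\lambda_-$ and $\lambda_2>\lambda_-$. (iv) $\lambda<\lambda_*$ if and only if $(\Omega^b_\lambda)^-=\emptyset$. (v) If $\lambda_*<\lambda_-$ and $\lambda\in[\lambda_*,\lambda_-)$, then $(\Omega^b_\lambda)^-$ is a proper subset of $\Omega$. (vi) If $(\Omega,\sigma)$ is minimal, then $\lambda_*=\lambda_-$. (vii) For $\omega\in\Omega$ let $\lambda_-^\omega$ be the value $\lambda_-$ associated (by this same theorem) to the restriction of the family to the orbit closure $\Omega_\omega:=\overline{\{\omega\cdot t: t\in\mathbb R\}}$. Then $\lambda_*=\inf_{\omega\in\Omega}\lambda^\omega_-$ and $\lambda_-=\sup_{\omega\in\Omega}\lambda^\omega_-$.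
   Context: $(\Omega,\sigma)$ is a continuous global flow on a compact metric space $\Omega$, $\omega\cdot t:=\sigma(t,\omega)$; $\mathfrak M_{\rm erg}(\Omega,\sigma)$ is the set of $\sigma$-ergodic invariant Borel probability measures; $C^{0,1}(\Omega\times\mathbb R,\mathbb R)$ is the set of continuous maps with continuous derivative in the second variable; $C(\Omega,\mathbb R)$ has the sup norm. Consider the concave-linear family $$x'=\mathfrak c(\omega\cdot t)+\mathfrak d(\omega\cdot t)\,x+\mathfrak g^-(\omega\cdot t,x)+\lambda,\quad\omega\in\Omega,\ \lambda\in\mathbb R,$$ under the hypotheses: (l1) $\mathfrak c,\mathfrak d\in C(\Omega,\mathbb R)$, $\mathfrak g^-\in C^{0,1}(\Omega\times\mathbb R,\mathbb R)$; (l2) $\int_\Omega\mathfrak d\,dm>0$ for all $m\in\mathfrak M_{\rm erg}(\Omega,\sigma)$; (l3) $\lim_{x\to\infty}(\mathfrak d(\omega)x+\mathfrak g^-(\omega,x))=-\infty$ uniformly on $\Omega$; (l4) $\mathfrak g^-\le0$ on $\Omega\times\mathbb R$, $\mathfrak g^-(\omega,x)=0$ for $x\le0$, and $m(\{\omega:\mathfrak g^-(\omega,x)<0\ \forall x>0\})=1$ for all $m\in\mathfrak M_{\rm erg}$; (l5) $m(\{\omega: x\mapsto\mathfrak g^-(\omega,x)\text{ concave}\})=1$ for all $m\in\mathfrak M_{\rm erg}$; (l6) $m(\{\omega: x\mapsto\mathfrak g^-_x(\omega,x)\text{ strictly decreasing on }\mathcal J\})>0$ for every compact interval $\mathcal J\subset[0,\infty)$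 and every $m\in\mathfrak M_{\rm erg}$. $\tau^-_\lambda(t,\omega,x)=(\omega\cdot t,v^-_\lambda(t,\omega,x))$ is the (local) skewproduct flow of the family for fixed $\lambda$, with $v^-_\lambda(0,\omega,x)=x$. $\mathcal B^-_\lambda$ is the set of $(\omega,x)$ whose $\tau^-_\lambda$-orbit is globally defined and bounded, $(\Omega^b_\lambda)^-$ its projection to $\Omega$, and for $\omega\in(\Omega^b_\lambda)^-$, $\mathfrak r^-_\lambda(\omega):=\min\{x:(\omega,x)\in\mathcal B^-_\lambda\}$, $\mathfrak a^-_\lambda(\omega):=\max\{x:(\omega,x)\in\mathcal B^-_\lambda\}$ (so $\mathcal B^-_\lambda=\{(\omega,x):\omega\in(\Omega^b_\lambda)^-,\ \mathfrak r^-_\lambda(\omega)\le x\le\mathfrak a^-_\lambda(\omega)\}$). A $\tau$-copy of the base is the graph of a continuous map $\mathfrak b:\Omega\to\mathbb R$ with $v(t,\omega,\mathfrak b(\omega))=\mathfrak b(\omega\cdot t)$; it is attractive hyperbolic if there are $\rho>0,k\ge1,\gamma>0$ with $|v(t,\omega,x)-\mathfrak b(\omega\cdot t)|\le ke^{-\gamma t}|x-\mathfrak b(\omega)|$ for all $t\ge0$ whenever $|x-\mathfrak b(\omega)|<\rho$ (solutions defined for $t\ge0$), and repulsive hyperbolic if the same holds for $t\le0$ with $e^{\gamma t}$. An attractor–repeller pair $(\mathfrak a,\mathfrak r)$ means $\{\mathfrak a\}$ is an attractive and $\{\mathfrak r\}$ a repulsive hyperbolic copy of the base. $(\Omega,\sigma)$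 is minimal if every orbit is dense. *)

(* Defs.v *)
From HB Require Import structures.
From mathcomp Require Import all_boot all_order all_algebra.
From mathcomp Require Import all_classical all_reals all_analysis.
Set Implicit Arguments. Unset Strict Implicit. Unset Printing Implicit Defensive.
Import Order.TTheory GRing.Theory Num.Theory.
Import numFieldNormedType.Exports.
Local Open Scope classical_set_scope.
Local Open Scope ring_scope.

Definition Borel {R : realType} (T : pseudoPMetricType R) :=
  g_sigma_algebraType (@open T).

Section defs.
Context {R : realType} {T : pseudoPMetricType R}.

Definition is_flow (s : R -> T -> T) : Prop :=
  continuous (fun p : R * T => s p.1 p.2) /\ (forall w, s 0 w = w) /\
  (forall t u w, s (t + u) w = s t (s u w)).

Definition invariant_measure (s : R -> T -> T) (m : probability (Borel T) R) :=
  forall t (A : set (Borel T)), measurable A -> m (s t @^-1` A) = m A.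

Definition ergodic_measure s (m : probability (Borel T) R) :=
  invariant_measure s m /\
  forall A : set (Borel T), measurable A -> (forall t, s t @^-1` A = A) ->
    m A = 0%E \/ m A = 1%E.

Definition integral_of (m : probability (Borel T) R) (f : T -> R) : \bar R :=
  \int[m]_x (f x)%:E.

Definition is_sol (s : R -> T -> T) (F : T -> R -> R) (w : T) (x : R)
  (I : set R) (u : R -> R) : Prop :=
  u 0 = x /\ forall t, I t -> is_derive t 1 u (F (s t w) (u t)).

Definition cvg_pinfty (f : R -> R) (l : R) : Prop := f x @[x --> +oo] --> l.
Definition cvg_ninfty (f : R -> R) (l : R) : Prop := f x @[x --> -oo] --> l.
End defs.

Section defs2.
Context {R : realType} {T : pseudoPMetricType R}.
Variable s : R -> T -> T.

Definition fam (c d : T -> R) (g : T -> R -> R) (lam : R) : T -> R -> R :=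
  fun w x => c w + d w * x + g w x + lam.

Definition C01 (g : T -> R -> R) : Prop :=
  continuous (fun p : T * R => g p.1 p.2) /\
  (forall w x, derivable (g w) x 1) /\
  continuous (fun p : T * R => derive1 (g p.1) p.2).

Definition concave_fun (f : R -> R) : Prop :=
  forall x y t, 0 <= t -> t <= 1 -> t * f x + (1 - t) * f y <= f (t * x + (1 - t) * y).

Definition strictly_decreasing_on (J : set R) (f : R -> R) : Prop :=
  forall x y, J x -> J y -> x < y -> f y < f x.

Definition inB (F : T -> R -> R) (w : T) (x : R) : Prop :=
  exists u, is_sol s F w x setT u /\ exists M, forall t, `|u t| <= M.

Definition OmegaB (F : T -> R -> R) : set T := [set w | exists x, inB F w x].
Definition amax (F : T -> R -> R) (w : T) : R := sup [set x | inB F w x].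
Definition rmin (F : T -> R -> R) (w : T) : R := inf [set x | inB F w x].

Definition copy_on (S : set T) (F : T -> R -> R) (b : T -> R) : Prop :=
  {within S, continuous b} /\
  forall w, S w -> is_sol s F w (b w) setT (fun t => b (s t w)).

Definition attractive_hyp_on (S : set T) (F : T -> R -> R) (b : T -> R) : Prop :=
  exists rho k gam, 0 < rho /\ 1 <= k /\ 0 < gam /\
  forall w, S w -> forall x, `|x - b w| < rho ->
    exists u, is_sol s F w x [set t | 0 <= t] u /\
      forall t, 0 <= t -> `|u t - b (s t w)| <= k * expR (- (gam * t)) * `|x - b w|.

Definition repulsive_hyp_on (S : set T) (F : T -> R -> R) (b : T -> R) : Prop :=
  exists rho k gam, 0 < rho /\ 1 <= k /\ 0 < gam /\
  forall w, S w -> forall x, `|x - b w| < rho ->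
    exists u, is_sol s F w x [set t | t <= 0] u /\
      forall t, t <= 0 -> `|u t - b (s t w)| <= k * expR (gam * t) * `|x - b w|.

Definition attractor_repeller_on (S : set T) (F : T -> R -> R) (a r : T -> R) : Prop :=
  copy_on S F a /\ attractive_hyp_on S F a /\
  copy_on S F r /\ repulsive_hyp_on S F r.

Definition orbit_closure (w : T) : set T := closure (range (fun t => s t w)).

Definition minimal_flow : Prop := forall w, orbit_closure w = setT.
End defs2.

(* Main.v *)
Require Import Defs.
From HB Require Import structures.
From mathcomp Require Import all_boot all_order all_algebra.
From mathcomp Require Import all_classical all_reals all_analysis.
From mathcomp Require Import ring lra.
Set Implicit Arguments.
Unset Strict Implicit.
Unset Printing Implicit Defensive.
Import Order.TTheory GRing.Theory Num.Theory.
Import numFieldNormedType.Exports.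
Local Open Scope classical_set_scope.
Local Open Scope ring_scope.

(** The family is compared with globally Lipschitz fields [G] that agree with it below a level [M].
    Concavity holds almost everywhere for every ergodic measure, so the concavity defect of [G] has
    nonpositive ergodic integrals. Extreme points of the invariant functionals dominated by the
    maximal time average turn this into a uniform statement: up to a bounded coboundary (a
    corrector) the defect is arbitrarily small on all of [Omega]. In the same way (l2) makes the
    linear part uniformly expanding, which bounds all bounded solutions from below.

    If the bounded set is everywhere nonempty at some [l0 < l], the maximal bounded solution at [l]
    stays a definite distance above the one at [l0]. The ratio of consecutive gaps of three ordered
    (sub)solutions then decays exponentially up to the corrector, which gives uniqueness,
    continuity and exponential attraction of the maximal bounded solution. The minimal one is the
    maximal one of the time-reversed, reflected system. Conversely, two uniformly separated bounded
    solutions must meet strict concavity along every orbit, by (l4), (l6) and compactness, so a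
    convex combination of them is a bounded subsolution for a slightly smaller parameter. Hence
    hyperbolicity on a compact invariant set is the open condition that the parameter exceeds the
    least one for which bounded orbits exist over that set. *)

(** * Extreme dominated functionals *)

Section extreme_functionals.
Context {R : realType} {E : lmodType R} (V : set E) (p : E -> R).

Definition sublinear_on (q : E -> R) :=
  (forall f g, V f -> V g -> q (f + g) <= q f + q g) /\
  (forall k f, V f -> 0 <= k -> q (k *: f) <= k * q f).

Definition linear_on (L : E -> R) :=
  (forall f g, V f -> V g -> L (f + g) = L f + L g) /\
  (forall k f, V f -> L (k *: f) = k * L f).

Definition dominated (L q : E -> R) := forall f, V f -> L f <= q f.

Definition face_of (q : E -> R) := forall L1 L2 al, linear_on L1 -> linear_on L2 ->
  dominated L1 p -> dominated L2 p -> 0 < al -> al < 1 ->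
  dominated (fun f => al * L1 f + (1 - al) * L2 f) q -> dominated L1 q.

Hypothesis VD : forall f g, V f -> V g -> V (f + g).
Hypothesis VZ : forall k f, V f -> V (k *: f).

Let VN f : V f -> V (- f).
Proof. by move=> Vf; rewrite -scaleN1r; exact: VZ. Qed.

Lemma sublinear_ge q f : sublinear_on q -> V f -> - q (- f) <= q f.
Proof.
move=> [qD qZ] Vf; have V0 : V 0 by rewrite -(scale0r f); exact: VZ.
have : q 0 <= q 0 + q 0 by have := qD _ _ V0 V0; rewrite addr0.
have := qD _ _ Vf (VN Vf); rewrite subrr; lra.
Qed.

Definition tilt (q : E -> R) (f1 f : E) : R :=
  inf [set q (f + t *: f1) - t * q f1 | t in [set t | 0 <= t]].

Section tilt.
Variables (q : E -> R) (f1 : E).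
Hypotheses (ql : sublinear_on q) (Vf1 : V f1).

Let lb f : V f -> lbound [set q (f + t *: f1) - t * q f1 | t in [set t | 0 <= t]] (- q (- f)).
Proof.
move=> Vf _ [t /= t0 <-]; have [qD qZ] := ql.
have tf1 : t * q f1 <= q (t *: f1).
  move: t0; rewrite le_eqVlt => /predU1P[<-|t0].
    have V0 : V 0 by rewrite -(scale0r f); exact: VZ.
    by have := qD _ _ V0 V0; rewrite addr0 mul0r scale0r; lra.
  have := qZ t^-1 _ (VZ t Vf1); rewrite scalerA mulVf ?gt_eqF// scale1r invr_ge0 ltW//.
  by move=> /(_ isT); rewrite ler_pdivlMl.
have := qD _ _ (VD Vf (VZ t Vf1)) (VN Vf).
by rewrite addrAC subrr add0r; lra.
Qed.

Lemma tilt_le f t : V f -> 0 <= t -> tilt q f1 f <= q (f + t *: f1) - t * q f1.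
Proof.
move=> Vf t0; apply: ge_inf; last by exists t.
by exists (- q (- f)); exact: lb.
Qed.

Lemma tilt_ge f r : V f -> (forall t, 0 <= t -> r <= q (f + t *: f1) - t * q f1) ->
  r <= tilt q f1 f.
Proof.
move=> Vf H; apply: lb_le_inf; first by exists (q (f + 0 *: f1) - 0 * q f1); exists 0 => /=.
by move=> _ [t t0 <-]; exact: H.
Qed.

Lemma tilt_dominated : dominated (tilt q f1) q.
Proof.
move=> f Vf; have := tilt_le Vf (lexx 0).
by rewrite scale0r addr0 mul0r subr0.
Qed.

Lemma tilt_sublinear : sublinear_on (tilt q f1).
Proof.
have [qD qZ] := ql; split=> [f g Vf Vg|k f Vf k0].
  rewrite -lerBlDr; apply: tilt_ge => // t t0; rewrite lerBlDr -lerBlDl.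
  apply: tilt_ge => // s s0.
  have := tilt_le (VD Vf Vg) (addr_ge0 t0 s0).
  have := qD _ _ (VD Vf (VZ t Vf1)) (VD Vg (VZ s Vf1)).
  by rewrite addrACA scalerDl; lra.
move: k0; rewrite le_eqVlt => /predU1P[<-|k0].
  rewrite scale0r mul0r; have V0 : V 0 by rewrite -(scale0r f); exact: VZ.
  apply: le_trans (tilt_dominated V0) _.
  by have := qZ 0 _ Vf (lexx _); rewrite scale0r mul0r.
rewrite -ler_pdivrMl//; apply: tilt_ge => // t t0.
rewrite ler_pdivrMl//.
have := tilt_le (VZ k Vf) (mulr_ge0 (ltW k0) t0).
have := qZ k _ (VD Vf (VZ t Vf1)) (ltW k0).
by rewrite scalerDr scalerA; lra.
Qed.

Lemma tilt_opp : tilt q f1 (- f1) <= - q f1.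
Proof.
have [qD qZ] := ql; have := tilt_le (VN Vf1) ler01.
rewrite scale1r addNr mul1r.
by have := qZ 0 _ Vf1 (lexx _); rewrite scale0r mul0r; lra.
Qed.

Lemma tilt_face : face_of q -> face_of (tilt q f1).
Proof.
move=> qF L1 L2 al l1 l2 d1 d2 a0 a1 dL f Vf.
have dq : dominated (fun f => al * L1 f + (1 - al) * L2 f) q.
  by move=> h Vh; exact: le_trans (dL h Vh) (tilt_dominated Vh).
have D1 : dominated L1 q by exact: qF dq.
have D2 : dominated L2 q.
  apply: (qF L2 L1 (1 - al)) => //; [lra|lra|].
  by move=> h Vh; have := dq h Vh; lra.
have e1 : q f1 <= L1 f1.
  have := le_trans (dL _ (VN Vf1)) tilt_opp; have := D2 _ Vf1; have := D1 _ Vf1.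
  rewrite -(scaleN1r f1) l1.2// l2.2// => h1 h2 h3.
  have h : 0 <= (1 - al) * (q f1 - L2 f1) by rewrite mulr_ge0 ?subr_ge0// ltW.
  have : al * (q f1 - L1 f1) <= 0 by lra.
  by rewrite pmulr_rle0// subr_le0.
apply: tilt_ge => // t t0; have := D1 _ (VD Vf (VZ t Vf1)).
rewrite l1.1 ?l1.2//; last exact: VZ.
have : 0 <= t * (L1 f1 - q f1) by rewrite mulr_ge0 ?subr_ge0.
lra.
Qed.
End tilt.

Hypothesis pl : sublinear_on p.

Lemma extreme_dominated f0 : V f0 -> exists L, [/\ linear_on L, dominated L p, p f0 <= L f0 &
  forall L1 L2 al, linear_on L1 -> linear_on L2 -> dominated L1 p -> dominated L2 p ->
    0 < al -> al < 1 -> (forall f, V f -> L f = al * L1 f + (1 - al) * L2 f) ->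
    forall f, V f -> L1 f <= L f].
Proof.
move=> Vf0.
pose Q q := [/\ sublinear_on q, dominated q p, q (- f0) <= - p f0 & face_of q].
have Q0 : Q (tilt p f0).
  split; [exact: tilt_sublinear|exact: tilt_dominated|exact: tilt_opp|].
  by apply: tilt_face => // L1 L2 al _ _.
pose rl (a b : {q | Q q}) := `[< dominated (sval b) (sval a) >].
have [] := @ZL_preorder {q | Q q} (exist _ _ Q0) rl.
- by move=> a; apply/asboolP => f.
- move=> a b c /asboolP ab /asboolP bc; apply/asboolP => f Vf.
  exact: le_trans (bc _ Vf) (ab _ Vf).
- move=> A tA; have [[a0 Aa0]|/forallNP A0] := pselect (exists a, A a); last first.
    by exists (exist _ _ Q0) => s As; case: (A0 s).
  pose m f := inf [set sval a f | a in A].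
  have lbA f : V f -> has_lbound [set sval a f | a in A].
    move=> Vf; exists (- p (- f)) => _ [a Aa <-]; have [sa da _ _] := svalP a.
    apply: le_trans (sublinear_ge sa Vf); rewrite lerN2; exact: da (VN Vf).
  have mle f a : V f -> A a -> m f <= sval a f.
    by move=> Vf Aa; apply: ge_inf; [exact: lbA|exists a].
  have mge f r : (forall a, A a -> r <= sval a f) -> r <= m f.
    move=> H; apply: lb_le_inf; first by exists (sval a0 f), a0.
    by move=> _ [a Aa <-]; exact: H.
  have Qm : Q m.
    split.
    + split=> [f g Vf Vg|k f Vf k0].
        rewrite -lerBlDr; apply: (mge) => a Aa; rewrite lerBlDr -lerBlDl.
        apply: (mge) => b Ab; rewrite lerBlDr.
        have [/asboolP ab|/asboolP ba] := tA _ _ Aa Ab.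
          apply: le_trans (mle _ _ (VD Vf Vg) Ab) _.
          have := ab _ Vf; have [[bD _] _ _ _] := svalP b.
          by have := bD _ _ Vf Vg; lra.
        apply: le_trans (mle _ _ (VD Vf Vg) Aa) _.
        have := ba _ Vg; have [[bD _] _ _ _] := svalP a.
        by have := bD _ _ Vf Vg; lra.
      move: k0; rewrite le_eqVlt => /predU1P[<-|k0].
        rewrite mul0r; apply: le_trans (mle _ _ (VZ _ Vf) Aa0) _.
        have [[_ aZ] _ _ _] := svalP a0.
        by have := aZ _ _ Vf (lexx 0); rewrite mul0r.
      rewrite -ler_pdivrMl//; apply: (mge) => a Aa; rewrite ler_pdivrMl//.
      apply: le_trans (mle _ _ (VZ _ Vf) Aa) _.
      by have [[_ aZ] _ _ _] := svalP a; exact: aZ (ltW k0).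
    + move=> f Vf; apply: le_trans (mle _ _ Vf Aa0) _.
      by have [_ + _ _] := svalP a0; exact.
    + apply: le_trans (mle _ _ (VN Vf0) Aa0) _.
      by have [_ _ + _] := svalP a0.
    + move=> L1 L2 al l1 l2 d1 d2 al0 al1 dL f Vf; apply: (mge) => a Aa.
      have [_ _ _ aF] := svalP a; apply: (aF L1 L2 al) => // h Vh.
      exact: le_trans (dL h Vh) (mle _ _ Vh Aa).
  exists (exist _ _ Qm) => s As; apply/asboolP => f Vf; exact: mle.
move=> [q [[qD qZ] qp qf0 qF]] qmax.
have qs : sublinear_on q by split.
have qN f : V f -> q (- f) <= - q f.
  move=> Vf; have Qt : Q (tilt q f).
    split; [exact: tilt_sublinear|move=> h Vh| |exact: tilt_face].
      exact: le_trans (tilt_dominated qs Vf Vh) (qp _ Vh).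
    exact: le_trans (tilt_dominated qs Vf (VN Vf0)) qf0.
  have /asboolP h := qmax (exist _ _ Qt) (introT (asboolP _) (tilt_dominated qs Vf)).
  exact: le_trans (h _ (VN Vf)) (tilt_opp qs Vf).
have qL : linear_on q.
  have lD f g : V f -> V g -> q (f + g) = q f + q g.
    move=> Vf Vg; apply/eqP; rewrite eq_le qD//=.
    have := sublinear_ge qs (VD Vf Vg); rewrite opprD.
    have := qD _ _ (VN Vf) (VN Vg); have := qN _ Vf; have := qN _ Vg; lra.
  have lN f : V f -> q (- f) = - q f.
    move=> Vf; apply/eqP; rewrite eq_le qN//=.
    by have := sublinear_ge qs Vf; lra.
  have lZ k f : V f -> 0 <= k -> q (k *: f) = k * q f.
    move=> Vf k0; apply/eqP; rewrite eq_le qZ//=.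
    have := sublinear_ge qs (VZ k Vf); rewrite -scalerN.
    have := qZ _ _ (VN Vf) k0; rewrite lN//; lra.
  split=> // k f Vf; have [k0|k0] := leP 0 k; first exact: lZ.
  have := lZ (- k) _ Vf; rewrite scaleNr lN; last exact: VZ.
  by move=> H; have := H _; rewrite oppr_ge0 ltW// => /(_ isT); lra.
exists q; split => //.
  by have := sublinear_ge qs (VN Vf0); rewrite opprK; have := qN _ Vf0; lra.
move=> L1 L2 al l1 l2 d1 d2 a0 a1 Le f Vf; apply: (qF L1 L2 al) => // h Vh.
by rewrite Le.
Qed.
End extreme_functionals.

Lemma le_addgt0 {R : realType} (x y : R) : (forall e : R, 0 < e -> x <= y + e) -> x <= y.
Proof. by move=> H; apply/ler_addgt0Pr. Qed.

Section continuous_real_functions.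
Context {R : realType} {T : topologicalType}.
Implicit Types f g : T -> R.

Lemma continuous_addf f g : continuous f -> continuous g ->
  continuous (fun x => f x + g x).
Proof. by move=> cf cg x; apply: cvgD; [exact: cf|exact: cg]. Qed.

Lemma continuous_subf f g : continuous f -> continuous g ->
  continuous (fun x => f x - g x).
Proof. by move=> cf cg x; apply: cvgB; [exact: cf|exact: cg]. Qed.

Lemma continuous_mulf f g : continuous f -> continuous g ->
  continuous (fun x => f x * g x).
Proof. by move=> cf cg x; apply: cvgM; [exact: cf|exact: cg]. Qed.

Lemma continuous_cstf (k : R) : continuous (fun _ : T => k).
Proof. by move=> x; exact: cvg_cst. Qed.

Lemma continuous_minf f g : continuous f -> continuous g ->
  continuous (fun x => Num.min (f x) (g x)).
Proof. by move=> cf cg x; apply: continuous_min; [exact: cf|exact: cg]. Qed.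

Lemma continuous_maxf f g : continuous f -> continuous g ->
  continuous (fun x => Num.max (f x) (g x)).
Proof. by move=> cf cg x; apply: continuous_max; [exact: cf|exact: cg]. Qed.

Lemma continuous_bounded_above f (K : set T) : compact K -> continuous f ->
  exists C : R, forall x, K x -> f x <= C.
Proof.
move=> cK cf; have [->|/set0P K0] := eqVneq K set0; first by exists 0.
have [c _ H] := compact_EVT_max K0 cK (@continuous_subspaceT _ _ K f cf).
by exists (f c) => x Kx; apply: H; rewrite inE.
Qed.

Lemma continuous_bounded f : compact [set: T] -> continuous f ->
  exists C : R, 0 < C /\ forall x, `|f x| <= C.
Proof.
move=> cT cf; have [C HC] := continuous_bounded_above cT cf.
have [C' HC'] : exists C : R, forall x, [set: T] x -> - f x <= C.
  by apply: continuous_bounded_above => // x; apply: cvgN; exact: cf.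
exists (Num.max 1 (Num.max C C')); split=> [|x]; first by rewrite lt_max ltr01.
rewrite ler_norml lerNl !le_max; apply/andP; split.
  by rewrite HC' ?orbT.
by rewrite HC ?orbT.
Qed.
End continuous_real_functions.

Section distance_to_complement.
Context {R : realType} {T : pseudoPMetricType R} (U : set T).

Let radii x := [set r : R | 0 < r /\ (1 <= r \/ exists2 a, ~ U a & ball x r a)].

Definition codist x : R := inf (radii x).

Let has_inf_radii x : has_inf (radii x).
Proof.
split; first by exists 1; split; [exact: ltr01|left].
by exists 0 => r [/ltW].
Qed.

Lemma codist_ge0 x : 0 <= codist x.
Proof. by apply: lb_le_inf; [case: (has_inf_radii x)|move=> r [/ltW]]. Qed.

Lemma codist_eq0 x : ~ U x -> codist x = 0.
Proof.
move=> Ux; apply/eqP; rewrite eq_le codist_ge0 andbT; apply: le_addgt0 => e e0.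
rewrite add0r; apply: ge_inf; first by case: (has_inf_radii x).
by split => //; right; exists x => //; exact: ballxx.
Qed.

Lemma codist_gt0 x : open U -> U x -> 0 < codist x.
Proof.
move=> oU Ux; have /nbhs_ballP[e e0 eU] : nbhs x U by exact: open_nbhs_nbhs.
apply: (@lt_le_trans _ _ (Num.min e 1)); first by rewrite lt_min e0 ltr01.
apply: lb_le_inf; first by case: (has_inf_radii x).
move=> r [r0 [r1|[a nUa xra]]]; first by rewrite ge_min r1 orbT.
rewrite ge_min; have [//|re] := leP e r.
by exfalso; apply: nUa; apply: eU; exact: le_ball (ltW re) _ xra.
Qed.

Lemma codist_lip x y e : 0 < e -> ball x e y -> codist x <= codist y + e.
Proof.
move=> e0 xy; rewrite -lerBlDr; apply: lb_le_inf; first by case: (has_inf_radii y).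
move=> r [r0 H]; rewrite lerBlDr; apply: ge_inf; first by case: (has_inf_radii x).
split; first exact: addr_gt0.
case: H => [r1|[a nUa yra]]; [left; lra|right; exists a => //].
by rewrite addrC; exact: ball_triangle xy yra.
Qed.

Lemma codist_continuous : continuous codist.
Proof.
move=> x; apply/cvgrPdist_le => e e0; near=> y.
have xy : ball x e y by near: y; exact: nbhsx_ballx.
rewrite ler_distl; apply/andP; split; have := codist_lip e0 xy.
  by have := codist_lip e0 (ball_sym xy); lra.
by have := codist_lip e0 (ball_sym xy); lra.
Unshelve. all: by end_near. Qed.
End distance_to_complement.

(** * Measures from positive functionals *)

Section daniell.
Context {R : realType} {T : pseudoPMetricType R}.
Variable L : (T -> R) -> R.

Definition positive_functional :=
  [/\ (forall f g : T -> R, continuous f -> continuous g ->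
        L (fun x => f x + g x) = L f + L g),
      (forall (k : R) (f : T -> R), continuous f -> L (fun x => k * f x) = k * L f),
      (forall f : T -> R, continuous f -> (forall x, 0 <= f x) -> 0 <= L f) &
      L (fun _ => 1) = 1].

(* [A] is covered by the increasing sequence of nonnegative continuous functions
   [F]; [c] bounds the integral of its supremum. *)
Definition fun_cover (A : set T) (F : nat -> T -> R) (c : R) :=
  [/\ (forall n, continuous (F n)), (forall n x, 0 <= F n x),
      (forall n x, F n x <= F n.+1 x), (forall n, L (F n) <= c) &
      (forall x, A x -> exists n, 1 <= F n x)].

Definition outer (A : set T) : R := inf [set c | exists F, fun_cover A F c].

Hypothesis PL : positive_functional.
Hypothesis cT : compact [set: T].

Let LD (f g : T -> R) : continuous f -> continuous g -> L (fun x => f x + g x) = L f + L g.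
Proof. by case: PL => + _ _ _; exact. Qed.
Let LZ (k : R) (f : T -> R) : continuous f -> L (fun x => k * f x) = k * L f.
Proof. by case: PL => _ + _ _; exact. Qed.
Let Lge0 (f : T -> R) : continuous f -> (forall x, 0 <= f x) -> 0 <= L f.
Proof. by case: PL => _ _ + _; exact. Qed.
Let L1 : L (fun _ => 1) = 1. Proof. by case: PL. Qed.

Lemma functional_cst k : L (fun _ => k) = k.
Proof.
have := LZ k (@continuous_cstf R T 1); by rewrite L1 mulr1.
Qed.

Lemma functional_sub (f g : T -> R) : continuous f -> continuous g ->
  L (fun x => f x - g x) = L f - L g.
Proof.
move=> cf cg; have cg' : continuous (fun x => -1 * g x).
  by apply: continuous_mulf => //; exact: continuous_cstf.
by rewrite -[- L g]mulN1r -LZ// -LD//; congr L; apply/funext => x; rewrite mulN1r.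
Qed.

Lemma functional_le (f g : T -> R) : continuous f -> continuous g -> (forall x, f x <= g x) ->
  L f <= L g.
Proof.
move=> cf cg fg; rewrite -subr_ge0 -functional_sub//.
by apply: Lge0 => [|x]; [exact: continuous_subf|rewrite subr_ge0].
Qed.

Lemma functional_sum n (F : nat -> T -> R) : (forall k, continuous (F k)) ->
  continuous (fun x => \sum_(k < n) F k x) /\
  L (fun x => \sum_(k < n) F k x) = \sum_(k < n) L (F k).
Proof.
move=> cF; elim: n => [|n [IHc IHL]].
  split; first by under eq_fun do rewrite big_ord0; exact: continuous_cstf.
  by under eq_fun do rewrite big_ord0; rewrite functional_cst big_ord0.
split.
  by under eq_fun do rewrite big_ord_recr/=; exact: continuous_addf.
by under eq_fun do rewrite big_ord_recr/=; rewrite LD// IHL big_ord_recr.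
Qed.

Let cover_ge0 A F c : fun_cover A F c -> 0 <= c.
Proof. by move=> [cF F0 _ /(_ 0%N) Lc _]; apply: le_trans Lc; exact: Lge0. Qed.

Let coverT A : fun_cover A (fun _ _ => 1) 1.
Proof.
split; rewrite ?L1//; first by move=> n; exact: continuous_cstf.
by move=> x _; exists 0%N.
Qed.

Let has_inf_cover A : has_inf [set c | exists F, fun_cover A F c].
Proof.
split; first by exists 1; exists (fun _ _ => 1); exact: coverT.
by exists 0 => c [F]; exact: cover_ge0.
Qed.

Lemma outer_ge0 A : 0 <= outer A.
Proof. by apply: lb_le_inf; [case: (has_inf_cover A)|move=> c [F]; exact: cover_ge0]. Qed.

Lemma outer_le A F c : fun_cover A F c -> outer A <= c.
Proof. by move=> H; apply: ge_inf; [case: (has_inf_cover A)|exists F]. Qed.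

Lemma outer_adherent A e : 0 < e -> exists F c, fun_cover A F c /\ c < outer A + e.
Proof.
by move=> e0; have [c [F HF] ce] := inf_adherent e0 (has_inf_cover A); exists F, c.
Qed.

Lemma outer_sub A B : A `<=` B -> outer A <= outer B.
Proof.
move=> AB; apply: le_addgt0 => e e0.
have [F [c [[F1 F2 F3 F4 F5] ce]]] := outer_adherent B e0.
by apply: le_trans (ltW ce); apply: (@outer_le _ F); split => // x /AB; exact: F5.
Qed.

Lemma outer_le_fun A (f : T -> R) : continuous f -> (forall x, 0 <= f x) ->
  (forall x, A x -> 1 <= f x) -> outer A <= L f.
Proof. by move=> cf f0 Af; apply: (@outer_le _ (fun=> f)); split => // x /Af; exists 0%N. Qed.

Lemma cover_mono A F c n m x : fun_cover A F c -> (n <= m)%N -> F n x <= F m x.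
Proof.
move=> [_ _ Fi _ _] nm; elim: m nm => [|m IH].
  by rewrite leqn0 => /eqP->.
by rewrite leq_eqVlt => /predU1P[->//|/IH]; move/le_trans; exact.
Qed.

Lemma outer_sigma_subadditive (A : nat -> set T) :
  ((outer (\bigcup_n A n))%:E <= \sum_(n <oo) (outer (A n))%:E)%E.
Proof.
have s0 : (0 <= \sum_(n <oo) (outer (A n))%:E)%E.
  by apply: nneseries_ge0 => n _ _; rewrite lee_fin outer_ge0.
case Es : (\sum_(n <oo) (outer (A n))%:E)%E => [r| |]; last 2 first.
- exact: leey.
- by move: s0; rewrite Es.
have part n : \sum_(k < n) outer (A k) <= r.
  rewrite -lee_fin -Es -sumEFin; rewrite -(big_mkord xpredT (fun k => (outer (A k))%:E)).
  by apply: nneseries_lim_ge => k _; rewrite lee_fin outer_ge0.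
rewrite lee_fin; apply: le_addgt0 => e e0.
have en n : 0 < e / 2 ^+ n.+1 by rewrite divr_gt0// exprn_gt0.
pose P n (Fc : (nat -> T -> R) * R) := fun_cover (A n) Fc.1 Fc.2 /\ Fc.2 < outer (A n) + e / 2 ^+ n.+1.
have /choice[Fc HFc] : forall n, exists Fc, P n Fc.
  by move=> n; have [F [c H]] := outer_adherent (A n) (en n); exists (F, c).
pose G N x := \sum_(n < N) (Fc n).1 N x.
have cG n m : continuous ((Fc n).1 m) by case: (HFc n) => [[]].
have G0 n m x : 0 <= (Fc n).1 m x by case: (HFc n) => [[]].
apply: (@outer_le _ G); split.
- by move=> N; have [] := functional_sum N (fun n => cG n N).
- by move=> N x; apply: sumr_ge0.
- move=> N x; rewrite /G big_ord_recr/= -[leLHS]addr0; apply: lerD => //.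
  by apply: ler_sum => k _; case: (HFc k) => [[_ _ + _ _] _]; exact.
- move=> N; rewrite /G; have [_ ->] := functional_sum N (fun n => cG n N).
  apply: (@le_trans _ _ (\sum_(n < N) (outer (A n) + e / 2 ^+ n.+1))).
    apply: ler_sum => k _; case: (HFc k) => [[_ _ _ Lc _] /ltW].
    exact: le_trans.
  rewrite big_split/=; apply: lerD; first exact: part.
  suff -> : \sum_(n < N) e / 2 ^+ n.+1 = e * (1 - (2 ^+ N)^-1).
    by rewrite ler_piMr ?ltW// gerBl invr_ge0 exprn_ge0.
  elim: N => [|N IH]; first by rewrite big_ord0 expr0 invr1 subrr mulr0.
  rewrite big_ord_recr/= IH exprS.
  have : 2 ^+ N != 0 :> R by rewrite expf_neq0.
  by move=> h; field.
- move=> x [n _ Anx]; case: (HFc n) => cov _; have [m Hm] : exists m, 1 <= (Fc n).1 m x.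
    by case: cov => _ _ _ _; exact.
  exists (maxn n.+1 m); rewrite /G (bigD1 (Ordinal (leq_maxl n.+1 m)))//=.
  apply: (le_trans Hm); rewrite -[leLHS]addr0; apply: lerD; last exact: sumr_ge0.
  by apply: (cover_mono _ cov); exact: leq_maxr.
Qed.

Let outerE (A : set T) : \bar R := (outer A)%:E.

Let outerE0 : outerE set0 = 0%E.
Proof.
congr EFin; apply/eqP; rewrite eq_le outer_ge0 andbT.
have := @outer_le_fun set0 _ (@continuous_cstf R T 0); rewrite functional_cst.
exact.
Qed.

HB.instance Definition _ := @isOuterMeasure.Build R T outerE outerE0
  (fun A => outer_ge0 A) (fun A B AB => outer_sub AB) outer_sigma_subadditive.

Lemma outer_open_caratheodory (U : set T) : open U -> caratheodory_measurable outerE U.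
Proof.
move=> oU; apply: le_caratheodory_measurable => X.
rewrite /outerE -EFinD lee_fin; apply: le_addgt0 => e e0.
have e2 : 0 < e / 2 by rewrite divr_gt0.
have [F [c [cov ce]]] := outer_adherent X e2.
have [F1 F2 F3 F4 F5] := cov.
pose g (k : nat) x := Num.min 1 (k%:R * codist U x).
have cg k : continuous (g k).
  apply: continuous_minf; first exact: continuous_cstf.
  by apply: continuous_mulf; [exact: continuous_cstf|exact: codist_continuous].
have g0 k x : 0 <= g k x by rewrite le_min ler01 mulr_ge0// codist_ge0.
have g1 k x : g k x <= 1 by rewrite ge_min lexx.
have gi k x : g k x <= g k.+1 x.
  by rewrite le_min g1/= ge_min ler_wpM2r ?orbT ?codist_ge0// ler_nat.
have cFg n k : continuous (fun x => F n x * g k x) by exact: continuous_mulf.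
have bd n : L (fun x => F n x * g n x) <= c.
  apply: le_trans (F4 n); apply: functional_le => // x.
  by rewrite ler_piMr.
pose s := sup [set L (fun x => F n x * g n x) | n in [set: nat]].
have hs : has_sup [set L (fun x => F n x * g n x) | n in [set: nat]].
  by split; [exists (L (fun x => F 0%N x * g 0%N x)), 0%N|exists c => _ [n _ <-]].
have [_ [K _ <-] Ks] := sup_adherent e2 hs.
have {}Ks : s - e / 2 < L (fun x => F K x * g K x) by exact: Ks.
have sle n : L (fun x => F n x * g n x) <= s by apply: ub_le_sup; [case: hs|exists n].
clearbody s.
have h1 : outer (X `&` U) <= s.
  apply: (@outer_le _ (fun n x => F n x * g n x)); split => //.
  - by move=> n x; exact: mulr_ge0.
  - by move=> n x; exact: ler_pM.
  - move=> x [Xx Ux]; have [n Fn] := F5 x Xx.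
    have dx := codist_gt0 oU Ux.
    pose k := (Num.truncn (codist U x)^-1).+1.
    have kd : 1 <= k%:R * codist U x.
      rewrite -ler_pdivrMr// mul1r ltW//; exact: truncnS_gt.
    exists (maxn n k); have Fm := cover_mono x cov (leq_maxl n k).
    suff -> : g (maxn n k) x = 1 by rewrite mulr1; exact: le_trans Fm.
    apply/min_idPl; apply: le_trans kd _; apply: ler_wpM2r; first exact: codist_ge0.
    by rewrite ler_nat leq_maxr.
have h2 : outer (X `&` ~` U) <= c - s + e / 2.
  apply: (@outer_le _ (fun n x => F n x * (1 - g K x))); split.
  - by move=> n; apply: continuous_mulf => //; apply: continuous_subf => //; exact: continuous_cstf.
  - by move=> n x; rewrite mulr_ge0// subr_ge0.
  - by move=> n x; rewrite ler_wpM2r// subr_ge0.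
  - move=> n.
    have E m : L (fun x => F m x * (1 - g K x)) = L (F m) - L (fun x => F m x * g K x).
      by rewrite -functional_sub//; congr L; apply/funext => x; rewrite mulrBr mulr1.
    apply: (@le_trans _ _ (L (fun x => F (maxn n K) x * (1 - g K x)))).
      apply: functional_le.
      + by apply: continuous_mulf => //; apply: continuous_subf => //; exact: continuous_cstf.
      + by apply: continuous_mulf => //; apply: continuous_subf => //; exact: continuous_cstf.
      + by move=> x; rewrite ler_wpM2r ?subr_ge0//; apply: (cover_mono _ cov); exact: leq_maxl.
    rewrite E; have := F4 (maxn n K).
    suff : L (fun x => F K x * g K x) <= L (fun x => F (maxn n K) x * g K x) by move: Ks; lra.
    apply: functional_le => // x; rewrite ler_wpM2r//.
    by apply: (cover_mono _ cov); exact: leq_maxr.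
  - move=> x [Xx Ux]; have [n Fn] := F5 x Xx; exists n.
    have -> : g K x = 0 by rewrite /g codist_eq0// mulr0; apply/min_idPr; exact: ler01.
    by rewrite subr0 mulr1.
by move: h1 h2 ce; lra.
Qed.

Lemma outerT : outer setT = 1.
Proof.
apply/eqP; rewrite eq_le; apply/andP; split; first exact: outer_le (coverT _).
apply: lb_le_inf; first by case: (has_inf_cover setT).
move=> c [F cov]; apply: le_addgt0 => e e0; have [F1 F2 F3 F4 F5] := cov.
have [N HN] : exists N, forall x, 1 - e <= F N x.
  have := cT; rewrite compact_cover.
  move=> /(_ nat setT (fun n => [set x | 1 - e < F n x])) [].
  - by move=> n _; apply: (@open_comp _ _ (F n) [set y | 1 - e < y]) => //; exact: open_gt.
  - by move=> x _; have [n Fn] := F5 x I; exists n => //=; lra.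
  move=> D _ HD; exists (\max_(n <- finmap.enum_fset D) n) => x.
  have [n /= nD xn] := HD x I.
  apply: le_trans (ltW xn) _; apply: (cover_mono _ cov).
  exact: (@leq_bigmax_seq _ (finmap.enum_fset D) xpredT id n nD isT).
have : L (fun _ => 1 - e) <= L (F N).
  by apply: functional_le => //; exact: continuous_cstf.
by rewrite functional_cst; have := F4 N; lra.
Qed.

Definition daniell (A : set (Borel T)) : \bar R := (outer A)%:E.

Lemma borel_caratheodory (A : set (Borel T)) : measurable A ->
  caratheodory_measurable outerE A.
Proof.
move=> mA; have : @measurable _ (caratheodory_type outerE) A.
  apply: mA; split; last by move=> U /outer_open_caratheodory.
  by apply: sigma_algebra_measurable.
by [].
Qed.

Let daniell0 : daniell set0 = 0%E. Proof. exact: outerE0. Qed.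
Let daniell_ge0 A : (0 <= daniell A)%E. Proof. exact: outer_ge0. Qed.
Let daniell_sigma_additive : semi_sigma_additive daniell.
Proof.
move=> F mF tF mUF.
apply: (@caratheodory_measure_sigma_additive R T outerE F) => //.
by move=> i; exact: borel_caratheodory.
by apply: borel_caratheodory.
Qed.

HB.instance Definition _ :=
  isMeasure.Build _ (Borel T) R daniell daniell0 daniell_ge0 daniell_sigma_additive.

Let daniellT : daniell setT = 1%E. Proof. by rewrite /daniell outerT. Qed.

HB.instance Definition _ := Measure_isProbability.Build _ (Borel T) R daniell daniellT.

Definition daniell_probability : probability (Borel T) R := daniell.

Lemma daniell_probabilityE A : daniell_probability A = (outer A)%:E.
Proof. by []. Qed.
End daniell.

Section borel_integration.
Context {R : realType} {T : pseudoPMetricType R}.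

Lemma continuous_borel_measurable (f : T -> R) : continuous f ->
  measurable_fun setT (f : Borel T -> R).
Proof.
move=> /continuousP cf; apply: (measurability _ (measurable_realfun.RGenOpens.measurableE R)).
move=> _ [_ [a [b ->] <-]]; rewrite setTI; apply: sub_sigma_algebra.
exact/cf/interval_open.
Qed.

Lemma continuous_borel_measurable_map (f : T -> T) : continuous f ->
  measurable_fun setT (f : Borel T -> Borel T).
Proof.
move=> /continuousP cf; apply: (@measurability _ _ (Borel T) (Borel T) _ _ (@open T)) => //.
by move=> _ [U oU <-]; rewrite setTI; apply: sub_sigma_algebra; exact: cf.
Qed.

Lemma closed_borel (A : set T) : closed A -> measurable (A : set (Borel T)).
Proof.
move=> cA; rewrite -(setCK A); apply: (@measurableC _ (Borel T)).
by apply: sub_sigma_algebra; exact: closed_openC.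
Qed.

Lemma open_borel (A : set T) : open A -> measurable (A : set (Borel T)).
Proof. by move=> oA; apply: sub_sigma_algebra. Qed.

Hypothesis cT : compact [set: T].
Variable m : probability (Borel T) R.

Lemma continuous_integrable (A : set (Borel T)) (f : T -> R) : measurable A ->
  continuous f -> m.-integrable A (EFin \o f).
Proof.
move=> mA cf; apply: measurable_bounded_integrable => //.
- by apply: (le_lt_trans (probability_le1 m mA)); exact: ltry.
- by apply: measurable_funS (continuous_borel_measurable cf).
- have [C [C0 HC]] := continuous_bounded cT cf.
  by exists C; split; [exact: num_real|move=> M CM x Ax /=; exact: le_trans (ltW CM)].
Qed.

Let J (A : set (Borel T)) (f : T -> R) := Rintegral m A f.

Lemma RintegralD_continuous A (f g : T -> R) : measurable A -> continuous f ->
  continuous g -> J A (fun x => f x + g x) = J A f + J A g.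
Proof. by move=> mA cf cg; apply: RintegralD => //; exact: continuous_integrable. Qed.

Lemma RintegralZ_continuous A k (f : T -> R) : measurable A -> continuous f ->
  J A (fun x => k * f x) = k * J A f.
Proof. by move=> mA cf; apply: RintegralZl => //; exact: continuous_integrable. Qed.

Lemma le_Rintegral_continuous A (f g : T -> R) : measurable A -> continuous f ->
  continuous g -> (forall x, f x <= g x) -> J A f <= J A g.
Proof. by move=> mA cf cg fg; apply: le_Rintegral => //; exact: continuous_integrable. Qed.

Lemma Rintegral_cst_borel A k : measurable A -> J A (fun _ => k) = k * fine (m A).
Proof. by move=> mA; rewrite /J Rintegral_cst. Qed.

Lemma Rintegral_positive_functional : positive_functional (J setT).
Proof.
split=> [f g cf cg|k f cf|f cf f0|].
- exact: RintegralD_continuous.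
- exact: RintegralZ_continuous.
- exact: Rintegral_ge0.
- by rewrite Rintegral_cst_borel// probability_setT mulr1.
Qed.

Lemma RintegralT_setC A (f : T -> R) : measurable A -> continuous f ->
  J setT f = J A f + J (~` A) f.
Proof.
move=> mA cf; rewrite /J -(setUv A) Rintegral_setU//.
- exact: measurableC.
- by rewrite setUv; exact: continuous_integrable.
- by apply/disj_setPS => x [].
Qed.

Lemma integral_ofE (f : T -> R) : continuous f -> integral_of m f = (J setT f)%:E.
Proof.
move=> cf; rewrite /integral_of /J /Rintegral fineK//.
by apply: integrable_fin_num => //; exact: continuous_integrable.
Qed.

Lemma Rintegral_le_measure (A B : set (Borel T)) (f : T -> R) :
  measurable A -> measurable B -> continuous f ->
  (forall x, f x <= 1) -> (forall x, 0 < f x -> B x) ->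
  J A f <= fine (m (A `&` B)).
Proof.
move=> mA mB cf f1 fB.
have -> : fine (m (A `&` B)) = J A \1_B.
  by rewrite /J /Rintegral integral_indic// setIC.
have iB : m.-integrable A (EFin \o (\1_B : Borel T -> R)).
  apply: measurable_bounded_integrable => //.
  - by apply: (le_lt_trans (probability_le1 m mA)); exact: ltry.
  - exists 1; split; [exact: num_real|move=> M M1 x Ax /=].
    rewrite indicE; case: (x \in B); rewrite ?normr1 ?normr0; lra.
apply: le_Rintegral => //; first exact: continuous_integrable.
move=> x _; have [fx|fx] := ltP 0 (f x).
  by rewrite mem_set//; exact: fB.
by apply: (le_trans fx); rewrite ler0n.
Qed.

Lemma measure_le_Rintegral (A B : set (Borel T)) (f : T -> R) :
  measurable A -> measurable B -> continuous f ->
  (forall x, 0 <= f x) -> (forall x, B x -> 1 <= f x) ->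
  fine (m (A `&` B)) <= J A f.
Proof.
move=> mA mB cf f0 fB.
have -> : fine (m (A `&` B)) = J A \1_B.
  by rewrite /J /Rintegral integral_indic// setIC.
have iB : m.-integrable A (EFin \o (\1_B : Borel T -> R)).
  apply: measurable_bounded_integrable => //.
  - by apply: (le_lt_trans (probability_le1 m mA)); exact: ltry.
  - exists 1; split; [exact: num_real|move=> M M1 x Ax /=].
    rewrite indicE; case: (x \in B); rewrite ?normr1 ?normr0; lra.
apply: le_Rintegral => //; first exact: continuous_integrable.
move=> x _; case: (boolP (x \in B)) => [/set_mem /fB //|_].
exact: f0.
Qed.
End borel_integration.

Section functional_comparison.
Context {R : realType} {T : pseudoPMetricType R}.
Variables I L : (T -> R) -> R.
Hypotheses (PI : positive_functional I) (PL : positive_functional L).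
Hypothesis cT : compact [set: T].
Hypothesis IL : forall f g : T -> R, continuous f -> continuous g ->
  (forall x, 0 <= f x <= 1) -> (forall x, 0 <= g x <= 1) ->
  (forall x, 0 < f x -> g x = 1) -> I f <= L g.

Let clamp (y : R) := Num.max 0 (Num.min 1 y).

Let sum_clamp n y : 0 <= y -> \sum_(k < n) clamp (y - k%:R) = Num.min n%:R y.
Proof.
move=> y0; elim: n => [|n IH].
  by rewrite big_ord0; apply/esym/min_idPl.
rewrite big_ord_recr/= IH /clamp -natr1.
have [h|h] := leP y n%:R.
  by rewrite (@min_r _ _ 1 (y - n%:R)) ?max_l ?min_r; lra.
have [h'|h'] := leP 1 (y - n%:R).
  by rewrite max_r ?min_l; lra.
by rewrite max_r ?min_r; lra.
Qed.

Let le01 (f : T -> R) : continuous f -> (forall x, 0 <= f x <= 1) -> I f <= L f.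
Proof.
move=> cf f01; apply: le_addgt0 => e e0.
pose n := (Num.truncn e^-1).+1.
have n0 : 0 < n%:R :> R by rewrite ltr0n.
have ne : n%:R^-1 <= e.
  by rewrite -[leRHS]invrK lef_pV2 ?posrE ?invr_gt0// ltW// truncnS_gt.
pose F k x := clamp (n%:R * f x - k%:R).
have cF k : continuous (F k).
  apply: continuous_maxf; first exact: continuous_cstf.
  apply: continuous_minf; first exact: continuous_cstf.
  apply: continuous_subf; last exact: continuous_cstf.
  by apply: continuous_mulf => //; exact: continuous_cstf.
have F01 k x : 0 <= F k x <= 1.
  by rewrite /F /clamp le_max lexx/= ge_max ler01 ge_min lexx.
have FE : (fun x => \sum_(k < n) F k x) = (fun x => n%:R * f x).
  apply/funext => x; have /andP[f0 f1] := f01 x.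
  rewrite sum_clamp; last by rewrite mulr_ge0// ltW.
  by apply/min_idPr; rewrite ler_piMr// ltW.
have step k : I (F k.+1) <= L (F k).
  apply: IL => // x; rewrite {1}/F /clamp lt_max ltxx lt_min ltr01/= => h.
  rewrite /F /clamp min_l ?max_r//.
  by move: h; rewrite -natr1; lra.
have IS := (functional_sum PI n cF).2; have LS := (functional_sum PL n cF).2.
have EI : n%:R * I f = \sum_(k < n) I (F k).
  by rewrite -IS FE; case: PI => _ -> .
have EL : n%:R * L f = \sum_(k < n) L (F k).
  by rewrite -LS FE; case: PL => _ -> .
have : n%:R * I f <= 1 + n%:R * L f.
  rewrite EI EL [in leLHS]big_ord_recl [in leRHS]big_ord_recr/=.
  rewrite lerD//.
    rewrite -(functional_cst PI 1); apply: functional_le => //.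
      exact: continuous_cstf.
    by move=> x; case/andP: (F01 0%N x).
  rewrite -[leLHS]addr0 lerD//.
    by apply: ler_sum => k _; exact: step.
  by case: PL => _ _ + _; apply => // x; case/andP: (F01 n.-1 x).
move=> h; have : I f <= n%:R^-1 + L f.
  by rewrite -(ler_pM2l n0) mulrDr divff ?gt_eqF.
lra.
Qed.

Lemma functional_eq (f : T -> R) : continuous f -> I f = L f.
Proof.
have eq01 (h : T -> R) : continuous h -> (forall x, 0 <= h x <= 1) -> I h = L h.
  move=> ch h01; apply/eqP; rewrite eq_le le01//=.
  have c1h : continuous (fun x => 1 - h x).
    by apply: continuous_subf => //; exact: continuous_cstf.
  have := le01 c1h; rewrite !functional_sub//; try exact: continuous_cstf.
  rewrite !functional_cst// => H; suff : 1 - I h <= 1 - L h by lra.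
  by apply: H => x; have /andP[] := h01 x; lra.
move=> cf; have [C [C0 HC]] := continuous_bounded cT cf.
pose h x := (f x + C) * (C *+ 2)^-1.
have ch : continuous h.
  apply: continuous_mulf; last exact: continuous_cstf.
  by apply: continuous_addf => //; exact: continuous_cstf.
have fE : f = (fun x => C *+ 2 * h x - C).
  apply/funext => x; rewrite /h mulrC divfK ?mulrn_eq0 ?gt_eqF//.
  by rewrite addrK.
have c2 : continuous (fun x => C *+ 2 * h x).
  by apply: continuous_mulf => //; exact: continuous_cstf.
rewrite fE !functional_sub//; try exact: continuous_cstf.
rewrite !functional_cst//; case: (PI) => _ -> // _ _; case: (PL) => _ -> // _ _.
rewrite eq01// => x; have := HC x; rewrite ler_norml => /andP[h1 h2].
have C2 : 0 < C *+ 2 by lra.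
by rewrite /h; apply/andP; split; [apply: divr_ge0|rewrite ler_pdivrMr//]; lra.
Qed.
End functional_comparison.

Lemma daniell_integral {R : realType} {T : pseudoPMetricType R} (L : (T -> R) -> R)
    (PL : positive_functional L) (cT : compact [set: T]) (f : T -> R) :
  continuous f -> Rintegral (daniell_probability PL cT) setT f = L f.
Proof.
move=> cf; apply: (functional_eq _ PL cT _ cf).
  exact: Rintegral_positive_functional.
move=> h g ch cg h01 g01 hg.
have oB : open [set x | 0 < h x].
  by apply: (@open_comp _ _ h [set y | 0 < y]) => // ; exact: open_gt.
have := @Rintegral_le_measure _ _ cT (daniell_probability PL cT) setT [set x | 0 < h x] h
  measurableT (open_borel oB) ch.
rewrite setTI daniell_probabilityE => H; apply: le_trans (H _ _) _ => //.
  by move=> x; case/andP: (h01 x).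
by apply: outer_le_fun => // x; [case/andP: (g01 x)|move=> /hg ->].
Qed.
Definition avg {R : realType} {T : Type} (s : R -> T -> T) (f : T -> R)
  (ts : seq R) (w : T) : R := (\sum_(t <- ts) f (s t w)) / (size ts)%:R.

Lemma continuous_comp2 {X A B C : topologicalType} (h : A -> B -> C) (f : X -> A)
    (g : X -> B) :
  continuous (fun p : A * B => h p.1 p.2) -> continuous f -> continuous g ->
  continuous (fun x => h (f x) (g x)).
Proof.
move=> ch cf cg x.
apply: (@cvg_comp _ _ _ (fun x => (f x, g x)) (fun p : A * B => h p.1 p.2) _
  (nbhs (f x, g x))); last exact: (ch (f x, g x)).
by apply: (@cvg_pair _ _ _ _ (nbhs (f x)) (nbhs (g x))); [exact: cf|exact: cg].
Qed.

Lemma flow_continuous {R : realType} {T : pseudoPMetricType R} (s : R -> T -> T) t :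
  is_flow s -> continuous (s t).
Proof.
move=> [cs _]; apply: (@continuous_comp2 T R T T s (fun=> t) id) => // w.
  exact: cvg_cst.
exact: cvg_id.
Qed.

(** * Ergodic optimization *)

Section averages.
Context {R : realType} {T : pseudoPMetricType R} (s : R -> T -> T).
Hypothesis fl : is_flow s.

Lemma avg_continuous (f : T -> R) ts : continuous f -> continuous (avg s f ts).
Proof.
move=> cf; apply: continuous_mulf; last exact: continuous_cstf.
elim: ts => [|t ts IH].
  by under eq_fun do rewrite big_nil; exact: continuous_cstf.
under eq_fun do rewrite big_cons; apply: continuous_addf => // w.
by apply: continuous_comp; [exact: flow_continuous|exact: cf].
Qed.

Lemma avgD (f g : T -> R) ts w : avg s (fun x => f x + g x) ts w = avg s f ts w + avg s g ts w.
Proof. by rewrite /avg big_split/= mulrDl. Qed.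

Lemma avgZ k (f : T -> R) ts w : avg s (fun x => k * f x) ts w = k * avg s f ts w.
Proof. by rewrite /avg -mulr_sumr mulrA. Qed.

Lemma size_neq0 (ts : seq R) : ts != [::] -> (size ts)%:R != 0 :> R.
Proof. by case: ts => // t ts _; rewrite pnatr_eq0. Qed.

Lemma avg_cst k ts w : ts != [::] -> avg s (fun _ => k) ts w = k.
Proof.
move=> ts0; by rewrite /avg big_const_seq count_predT iter_addr_0 -[k *+ _]mulr_natr mulfK// size_neq0.
Qed.

Lemma le_avg (f g : T -> R) ts w : (forall t, f (s t w) <= g (s t w)) ->
  avg s f ts w <= avg s g ts w.
Proof. by move=> fg; rewrite ler_wpM2r ?invr_ge0//; apply: ler_sum => t _. Qed.

Lemma avg_allpairs (f : T -> R) ts us w :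
  avg s f [seq t + u | t <- ts, u <- us] w = avg s (avg s f ts) us w.
Proof.
rewrite /avg big_allpairs_dep/= size_allpairs natrM invfM mulrA -mulr_suml.
congr (_ / _ / _); rewrite exchange_big/=; apply: eq_bigr => u _.
by apply: eq_bigr => t _; rewrite fl.2.2.
Qed.

Lemma avg_allpairsC (f : T -> R) ts us w :
  avg s f [seq t + u | t <- ts, u <- us] w = avg s (avg s f us) ts w.
Proof.
rewrite /avg big_allpairs_dep/= size_allpairs natrM invfM mulrA mulrAC -mulr_suml.
congr (_ / _ / _); apply: eq_bigr => t _.
by apply: eq_bigr => u _; rewrite addrC fl.2.2.
Qed.
End averages.

Section ergodic_maximizing.
Context {R : realType} {T : pseudoPMetricType R} (s : R -> T -> T) (S : set T).
Hypotheses (fl : is_flow s) (cT : compact [set: T]) (cS : closed S)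
  (S0 : S !=set0) (Sinv : forall t w, S w -> S (s t w)).

Let E : lmodType R := (T -> R^o : Type).
Let V : set E := [set f | continuous (f : T -> R)].

Definition max_average (f : T -> R) : R :=
  inf [set c | exists ts, ts != [::] /\ forall w, S w -> avg s f ts w <= c].
Local Notation p := max_average.

Let lbp (f : T -> R) : continuous f ->
  has_inf [set c | exists ts, ts != [::] /\ forall w, S w -> avg s f ts w <= c].
Proof.
move=> cf; have [C [C0 HC]] := continuous_bounded cT cf; split.
  exists C, [:: 0]; split => // w _; rewrite /avg big_seq1 divr1.
  by have := HC (s 0 w); rewrite ler_norml => /andP[].
exists (- C) => c [ts [ts0 H]]; have [w Sw] := S0; apply: le_trans (H _ Sw).
rewrite -(avg_cst s (- C) w ts0); apply: le_avg => t.
by have := HC (s t w); rewrite ler_norml => /andP[].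
Qed.

Lemma max_average_le (f : T -> R) ts c : continuous f -> ts != [::] ->
  (forall w, S w -> avg s f ts w <= c) -> p f <= c.
Proof. by move=> cf ts0 H; apply: ge_inf; [case: (lbp cf)|exists ts]. Qed.

Lemma max_average_adherent (f : T -> R) e : continuous f -> 0 < e ->
  exists ts, ts != [::] /\ forall w, S w -> avg s f ts w <= p f + e.
Proof.
move=> cf e0; have [c [ts [ts0 H]] /ltW ce] := inf_adherent e0 (lbp cf).
by exists ts; split => // w Sw; exact: le_trans (H _ Sw) ce.
Qed.

Lemma max_average_sublinear : sublinear_on V p.
Proof.
split=> [f g Vf Vg|k f Vf k0].
  apply: le_addgt0 => e e0; have e2 : 0 < e / 2 by rewrite divr_gt0.
  have [ts [ts0 H1]] := max_average_adherent Vf e2.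
  have [us [us0 H2]] := max_average_adherent Vg e2.
  apply: (@max_average_le _ [seq t + u | t <- ts, u <- us]).
  - exact: continuous_addf.
  - by rewrite -size_eq0 size_allpairs muln_eq0 !size_eq0 negb_or ts0.
  move=> w Sw; have -> : p f + p g + e = (p f + e / 2) + (p g + e / 2) by lra.
  rewrite (avgD s f g) lerD//.
    rewrite avg_allpairs// -(avg_cst s (p f + e / 2) w us0).
    by apply: le_avg => t; apply: H1; exact: Sinv.
  rewrite avg_allpairsC// -(avg_cst s (p g + e / 2) w ts0).
  by apply: le_avg => t; apply: H2; exact: Sinv.
apply: le_addgt0 => e e0.
have k1 : 0 < k + 1 by lra.
have [ts [ts0 H]] := max_average_adherent Vf (divr_gt0 e0 k1).
apply: (@max_average_le _ ts) => // [|w Sw].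
  by apply: continuous_mulf => //; exact: continuous_cstf.
rewrite (avgZ s k f); apply: (@le_trans _ _ (k * (p f + e / (k + 1)))).
  by rewrite ler_wpM2l// H.
rewrite mulrDr lerD2l mulrCA; apply: ler_piMr; first exact: ltW.
by rewrite ler_pdivrMr//; lra.
Qed.

Section extreme.
Variable L : E -> R.
Hypotheses (LL : linear_on V L) (Lp : dominated V L p).
Hypothesis Lext : forall L1 L2 al, linear_on V L1 -> linear_on V L2 ->
  dominated V L1 p -> dominated V L2 p -> 0 < al -> al < 1 ->
  (forall f, V f -> L f = al * L1 f + (1 - al) * L2 f) -> forall f, V f -> L1 f <= L f.

Let Lnp (f : T -> R) : continuous f -> (forall w, S w -> f w <= 0) -> L f <= 0.
Proof.
move=> cf f0; apply: le_trans (Lp cf) _; apply: (@max_average_le _ [:: 0]) => // w Sw.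
by rewrite /avg big_seq1 divr1; apply: f0; exact: Sinv.
Qed.

Let LN (f : T -> R) : continuous f -> L (fun x => - f x) = - L f.
Proof.
move=> cf; have := LL.2 (-1) f cf; rewrite mulN1r => <-; congr L.
by apply/funext => x; exact: esym (mulN1r (f x)).
Qed.

Let PL : positive_functional (L : (T -> R) -> R).
Proof.
split.
- by move=> f g cf cg; exact: LL.1.
- by move=> k f cf; exact: LL.2.
- move=> f cf f0; have : L (fun x => - f x) <= 0.
    by apply: Lnp => [x|w _]; [apply: cvgN; exact: cf|rewrite oppr_le0].
  by rewrite LN// oppr_le0.
- have c1 : continuous (fun _ : T => 1 : R) by exact: continuous_cstf.
  have bd k : L (fun _ => k) <= k.
    apply: le_trans (Lp (@continuous_cstf R T k)) _.
    apply: (@max_average_le _ [:: 0]) => //; first exact: continuous_cstf.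
    by move=> w _; rewrite avg_cst.
  apply/eqP; rewrite eq_le bd/=.
  have := bd (-1); have -> : L (fun=> -1) = - L (fun=> 1) by exact: (LN c1).
  by rewrite lerN2.
Qed.

Let m := daniell_probability PL cT.

Let Lcomp (f : T -> R) t : continuous f -> L (f \o s t) = L f.
Proof.
move=> cf; have cft u : continuous (f \o s u).
  by move=> w; apply: continuous_comp; [exact: flow_continuous|exact: cf].
suff H u (g : T -> R) : continuous g -> L (g \o s u) - L g <= 0.
  apply/eqP; rewrite eq_le -subr_le0 H//=.
  have := H (- t) (f \o s t) (cft t).
  suff -> : (f \o s t) \o s (- t) = f by rewrite subr_le0.
  by apply/funext => w /=; rewrite -fl.2.2 subrr fl.2.1.
move=> cg; have [C [C0 HC]] := continuous_bounded cT cg.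
have cgu v : continuous (g \o s v).
  by move=> w; apply: continuous_comp; [exact: flow_continuous|exact: cg].
rewrite -(functional_sub PL)//; apply: le_trans (Lp _) _; first exact: continuous_subf.
apply: le_addgt0 => e e0; pose n := (Num.truncn (C *+ 2 / e)).+1.
have n0 : 0 < n%:R :> R by rewrite ltr0n.
apply: (@max_average_le _ [seq u *+ k | k <- iota 0 n]) => //; first exact: continuous_subf.
move=> w _; rewrite /avg size_map size_iota big_map.
have -> : iota 0 n = index_iota 0 n by rewrite /index_iota subn0.
rewrite (telescope_sumr_eq (fun k => g (s (u *+ k) w)))//; last first.
  by move=> k _; rewrite /= -fl.2.2 mulrS.
rewrite ler_pdivrMr// add0r mulr0n fl.2.1.
have := HC (s (u *+ n) w); have := HC w; rewrite !ler_norml => /andP[h1 _] /andP[_ h2].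
have : C *+ 2 <= e * n%:R by rewrite mulrC -ler_pdivrMr// ltW// truncnS_gt.
by lra.
Qed.

Let m_invariant : invariant_measure s m.
Proof.
have H t (A : set T) : outer L (s t @^-1` A) <= outer L A.
  apply: le_addgt0 => e e0.
  have [F [c [[F1 F2 F3 F4 F5] /ltW ce]]] := outer_adherent PL A e0.
  apply: le_trans ce; apply: (@outer_le _ _ _ PL _ (fun n => F n \o s t)); split => //.
  - by move=> n w; apply: continuous_comp; [exact: flow_continuous|exact: F1].
  - by move=> n x; exact: F2.
  - by move=> n x; exact: F3.
  - by move=> n; rewrite Lcomp.
  - by move=> x /F5[n Fn]; exists n.
move=> t A mA; rewrite /m !daniell_probabilityE; congr EFin; apply/eqP.
rewrite eq_le H/=; apply: le_trans (H (- t) _); apply: (outer_sub PL) => w Aw.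
by rewrite /= -fl.2.2 subrr fl.2.1.
Qed.

Let mS : m S = 1%E.
Proof.
suff : m (~` S) = 0%E.
  have mS : measurable (S : set (Borel T)) by exact: closed_borel.
  move=> h; have := probability_setC m mS.
  rewrite h -(fineK (fin_num_measure m _ mS)) -EFinB => -[] h1; congr EFin; lra.
rewrite /m daniell_probabilityE; congr EFin; apply/eqP.
rewrite eq_le (outer_ge0 PL) andbT.
have oS : open (~` S) by exact: closed_openC.
have cd n : continuous (fun x => n%:R * codist (~` S) x).
  by apply: continuous_mulf; [exact: continuous_cstf|exact: codist_continuous].
apply: (@outer_le _ _ _ PL _ (fun n x => n%:R * codist (~` S) x)); split => //.
- by move=> n x; rewrite mulr_ge0// codist_ge0.
- by move=> n x; rewrite ler_wpM2r ?codist_ge0// ler_nat.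
- by move=> n; apply: Lnp => // w Sw; rewrite codist_eq0 ?mulr0// => /(_ Sw).
- move=> x Sx; have dx := codist_gt0 oS Sx; exists (Num.truncn (codist (~` S) x)^-1).+1.
  by rewrite -ler_pdivrMr// mul1r ltW// truncnS_gt.
Qed.

Let J := Rintegral m.

Let J_dominated (A : set (Borel T)) (f : T -> R) : measurable A ->
  (forall t, s t @^-1` A = A) -> continuous f -> J A f <= p f * fine (m A).
Proof.
move=> mA Ainv cf.
have shift t : J A (f \o s t) = J A f.
  have ms : measurable_fun setT (s t : Borel T -> Borel T).
    by apply: continuous_borel_measurable_map; exact: flow_continuous.
  have cfs : continuous (f \o s t).
    by move=> w; apply: continuous_comp; [exact: flow_continuous|exact: cf].
  rewrite /J /Rintegral; congr fine.
  have := @integral_pushforward _ _ (Borel T) (Borel T) R (s t) ms m A (EFin \o f).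
  rewrite Ainv => H; rewrite -H//.
  - apply: eq_measure_integral => B mB _; exact: m_invariant.
  - by apply/measurable_realfun.measurable_EFinP; exact: continuous_borel_measurable.
  - exact: (continuous_integrable cT).
have mA0 : 0 <= fine (m A) by apply: fine_ge0.
apply: le_addgt0 => e e0.
have [ts [ts0 H]] := max_average_adherent cf e0.
have cav := avg_continuous (ts := ts) fl cf.
pose h x := Num.max 0 (avg s f ts x - (p f + e)).
have ch : continuous h.
  apply: continuous_maxf; first exact: continuous_cstf.
  by apply: continuous_subf => //; exact: continuous_cstf.
have h0 x : 0 <= h x by rewrite le_max lexx.
have Jh : J A h <= 0.
  apply: (@le_trans _ _ (J setT h)).
    have mC : measurable (~` A) by exact: measurableC.
    rewrite /J (RintegralT_setC cT m mA ch) -/J.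
    by rewrite lerDl; apply: Rintegral_ge0 => x _; exact: h0.
  rewrite /J daniell_integral//; apply: Lnp => // w Sw.
  by rewrite /h max_l// subr_le0; exact: H.
have Jav : J A (avg s f ts) = J A f.
  rewrite /avg; have cfs t : continuous (f \o s t).
    by move=> w; apply: continuous_comp; [exact: flow_continuous|exact: cf].
  have sum us : continuous (fun w => \sum_(t <- us) f (s t w)) /\
      J A (fun w => \sum_(t <- us) f (s t w)) = (size us)%:R * J A f.
    elim: us => [|t us [IHc IH]].
      split; first by under eq_fun do rewrite big_nil; exact: continuous_cstf.
      under eq_fun do rewrite big_nil.
      by rewrite /J (Rintegral_cst_borel m)//= !mul0r.
    split; under eq_fun do rewrite big_cons.
      by apply: continuous_addf => //; exact: cfs.
    rewrite /J (@RintegralD_continuous _ _ cT m A (f \o s t))//.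
    by rewrite -/J shift IH /= -natr1; lra.
  under eq_fun do rewrite mulrC.
  rewrite /J (RintegralZ_continuous cT m)//; last by case: (sum ts).
  rewrite -/J (sum ts).2 mulrA mulVf ?mul1r//; exact: size_neq0.
rewrite -Jav; have : J A (avg s f ts) <= J A (fun x => (p f + e) + h x).
  apply: (le_Rintegral_continuous cT) => //.
    by apply: continuous_addf => //; exact: continuous_cstf.
  move=> x; rewrite -lerBlDl /h le_max lexx orbT //.
rewrite /J (RintegralD_continuous cT m)//; last exact: continuous_cstf.
rewrite (Rintegral_cst_borel m)//= -/J => hh; apply: (le_trans hh).
have : fine (m A) <= 1.
  by rewrite -lee_fin fineK ?fin_num_measure//; exact: probability_le1.
have : e * fine (m A) <= e * 1 -> p f * fine (m A) + e * fine (m A) <= p f * fine (m A) + e.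
  by lra.
move=> h1 h2; have := h1 (ler_wpM2l (ltW e0) h2); move: Jh; lra.
Qed.

Let m_ergodic : ergodic_measure s m.
Proof.
split=> [|A mA Ainv]; first exact: m_invariant.
have [mA0|mA0] := eqVneq (m A) 0%E; first by left.
right; apply/eqP; apply/negPn/negP => mA1.
have mAf : m A \is a fin_num by exact: fin_num_measure.
pose al := fine (m A).
have mAE : m A = al%:E by rewrite /al fineK.
have al0 : 0 < al.
  by rewrite lt_def -lee_fin -mAE measure_ge0 andbT -eqe -mAE.
have al1 : al < 1.
  rewrite lt_neqAle -lee_fin -mAE probability_le1// andbT; apply: contra mA1.
  by rewrite mAE => /eqP->.
have mC : measurable (~` A) by exact: measurableC.
have mCE : m (~` A) = (1 - al)%:E by rewrite probability_setC// mAE -EFinB.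
have Cinv t : s t @^-1` (~` A) = ~` A by rewrite preimage_setC; congr (~` _); exact: Ainv.
pose L1 (f : E) : R := al^-1 * J A f; pose L2 (f : E) : R := (1 - al)^-1 * J (~` A) f.
have al1' : 0 < 1 - al by lra.
have lin B k : measurable B -> linear_on V (fun f : E => k * J B f).
  move=> mB; split=> [f g cf cg|a f cf].
    by rewrite /J (RintegralD_continuous cT m)// mulrDr.
  by rewrite /J (RintegralZ_continuous cT m)// mulrCA.
have dom (B : set (Borel T)) : measurable B -> (forall t, s t @^-1` B = B) -> 0 < fine (m B) ->
    dominated V (fun f : E => (fine (m B))^-1 * J B f) p.
  move=> mB Binv B0 f cf; rewrite ler_pdivrMl// mulrC; exact: J_dominated.
have le1 f : V f -> L1 f <= L f.
  apply: (@Lext L1 L2 al) => //; try exact: lin.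
  - by rewrite /L1 /al; apply: dom => //.
  - have -> : L2 = (fun f : E => (fine (m (~` A)))^-1 * J (~` A) f) by rewrite mCE.
    by apply: dom => //; rewrite mCE.
  - move=> g cg; rewrite /L1 /L2 !mulrA divff ?gt_eqF// divff ?gt_eqF// !mul1r.
    have <- : Rintegral m setT g = L g by exact: daniell_integral.
    exact: (RintegralT_setC cT m mA cg).
have e0 : 0 < (1 - al) / 2 by rewrite divr_gt0.
have [F [c [cov ce]]] := outer_adherent PL A e0.
have [F1 F2 F3 F4 F5] := cov.
have oE : outer L A = al by apply/EFin_inj; rewrite -mAE /m daniell_probabilityE.
have cB n : measurable ([set x | 1 <= F n x] : set (Borel T)).
  apply: closed_borel; apply: (@closed_comp _ _ (F n) [set y | 1 <= y]).
    by move=> x _; exact: F1.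
  exact: closed_ge.
have bd n : fine (m (A `&` [set x | 1 <= F n x])) <= al * c.
  apply: (@le_trans _ _ (J A (F n))).
    by apply: measure_le_Rintegral.
  have := le1 _ (F1 n); rewrite /L1 ler_pdivrMl// => /le_trans; apply.
  by rewrite ler_wpM2l ?F4// ltW.
have : (m A <= (al * c)%:E)%E.
  have AE : \bigcup_n (A `&` [set x | 1 <= F n x]) = A.
    apply/seteqP; split=> [x [n _ []]//|x Ax]; have [n Fn] := F5 x Ax.
    by exists n.
  have := @nondecreasing_cvg_mu _ (Borel T) R m (fun n => A `&` [set x | 1 <= F n x]).
  rewrite AE => H; have {}H := H _ mA _.

  have cv : (m \o (fun n => A `&` [set x | 1 <= F n x])) x @[x --> \oo] --> m A.
    apply: H; first by move=> n; exact: measurableI.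
    apply/nondecreasing_seqP => n; apply/subsetPset => x [Ax /= h]; split => //.
    exact: le_trans h (F3 _ _).
  rewrite -(cvg_lim _ cv)//; apply: lime_le; first by apply/cvg_ex; exists (m A).
  apply: nearW => n /=.
  have mAn : measurable (A `&` [set x | 1 <= F n x]) by exact: measurableI.
  by rewrite -(fineK (fin_num_measure m _ mAn)) lee_fin; exact: bd.
rewrite mAE lee_fin -[X in X <= _]mulr1 ler_pM2l//; move: ce; rewrite oE; lra.
Qed.

Lemma extreme_ergodic : exists m : probability (Borel T) R,
  [/\ ergodic_measure s m, m S = 1%E &
      forall f : T -> R, continuous f -> integral_of m f = (L f)%:E].
Proof.
exists m; split => // f cf; rewrite integral_ofE//; congr EFin.
exact: daniell_integral.
Qed.
End extreme.

Theorem ergodic_maximizing (f : T -> R) : continuous f ->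
  exists m : probability (Borel T) R,
  [/\ ergodic_measure s m, m S = 1%E & (integral_of m f >= (p f)%:E)%E].
Proof.
move=> cf.
have VD (h g : E) : V h -> V g -> V (h + g) by exact: continuous_addf.
have VZ k (h : E) : V h -> V (k *: h).
  by move=> ch; apply: continuous_mulf => //; exact: continuous_cstf.
have [L [LL Lp Lf Lext]] := extreme_dominated VD VZ max_average_sublinear cf.
have [m [me mS mf]] := extreme_ergodic LL Lp Lext.
by exists m; split => //; rewrite mf// lee_fin.
Qed.
End ergodic_maximizing.

Lemma uniform_average {R : realType} {T : pseudoPMetricType R} (s : R -> T -> T)
    (f : T -> R) (eta : R) : is_flow s -> compact [set: T] -> continuous f ->
  (forall m : probability (Borel T) R, ergodic_measure s m ->
    (integral_of m f < eta%:E)%E) ->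
  exists ts, ts != [::] /\ forall w, avg s f ts w < eta.
Proof.
move=> fl cT cf H.
have [||m [me _ pm]] := @ergodic_maximizing _ _ s setT fl cT closedT _ _ f cf => //.
  by exists point.
have := le_lt_trans pm (H _ me); rewrite lte_fin => pe.
have e0 : 0 < (eta - max_average s setT f) / 2 by rewrite divr_gt0// subr_gt0.
have T0 : [set: T] !=set0 by exists point.
have [ts [ts0 h]] := max_average_adherent s cT T0 cf e0.
by exists ts; split => // w; apply: le_lt_trans (h w I) _; lra.
Qed.

(** * Differential inequalities and solutions *)

Section derivatives.
Context {R : realType}.
Implicit Types (f g z : R -> R) (t a b c k : R).

Lemma is_derive_addf f g t (df dg : R) : is_derive t 1 f df -> is_derive t 1 g dg ->
  is_derive t 1 (fun t => f t + g t) (df + dg).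
Proof. by move=> hf hg; exact: is_deriveD. Qed.

Lemma is_derive_subf f g t (df dg : R) : is_derive t 1 f df -> is_derive t 1 g dg ->
  is_derive t 1 (fun t => f t - g t) (df - dg).
Proof. by move=> hf hg; exact: is_deriveB. Qed.

Lemma is_derive_oppf f t (df : R) : is_derive t 1 f df ->
  is_derive t 1 (fun t => - f t) (- df).
Proof. by move=> hf; exact: is_deriveN. Qed.

Lemma is_derive_cstf (k t : R) : is_derive t 1 (fun _ : R => k) (0 : R).
Proof. exact: is_derive_cst. Qed.

Lemma is_derive_mulf f g t (df dg : R) : is_derive t 1 f df -> is_derive t 1 g dg ->
  is_derive t 1 (fun t => f t * g t) (df * g t + f t * dg).
Proof.
move=> hf hg; apply: (is_derive_eq (is_deriveM hf hg)).
by rewrite addrC; congr (_ + _); exact: mulrC.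
Qed.

Lemma is_derive_scalef k f t (df : R) : is_derive t 1 f df ->
  is_derive t 1 (fun t => k * f t) (k * df).
Proof.
move=> hf; apply: (is_derive_eq (is_derive_mulf (is_derive_cstf k t) hf)).
by rewrite mul0r add0r.
Qed.

Lemma is_derive_expf f t (df : R) : is_derive t 1 f df ->
  is_derive t 1 (fun t => expR (f t)) (expR (f t) * df).
Proof. by move=> hf; exact: (@is_derive1_comp _ expR f). Qed.

Lemma is_derive_invf f t (df : R) : f t != 0 -> is_derive t 1 f df ->
  is_derive t 1 (fun t => (f t)^-1) (- df / f t ^+ 2).
Proof.
move=> f0 hf; apply: (is_derive_eq (is_deriveV f0 hf)).
by rewrite mulNr mulrC -mulNr.
Qed.

Lemma is_derive_linf (k t : R) : is_derive t 1 (fun t => k * t) k.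
Proof. by apply: (is_derive_eq (is_derive_scalef k (is_derive_id t 1))); rewrite mulr1. Qed.

Lemma is_derive_shiftf f c t (df : R) : is_derive (t + c) 1 f df ->
  is_derive t 1 (fun t => f (t + c)) df.
Proof.
move=> hf; have h : is_derive t 1 (fun t => t + c) (1 + 0).
  exact: (is_derive_addf (is_derive_id t 1) (is_derive_cstf c t)).
apply: (is_derive_eq (@is_derive1_comp _ f (fun t => t + c) _ _ _ hf h)).
by rewrite addr0 mulr1.
Qed.

Lemma is_derive_revf f t (df : R) : is_derive (- t) 1 f df ->
  is_derive t 1 (fun t => f (- t)) (- df).
Proof.
move=> hf; have h : is_derive t 1 (fun t : R => - t) (- 1).
  by apply: is_derive_oppf; exact: is_derive_id.
apply: (is_derive_eq (@is_derive1_comp _ f (fun t => - t) _ _ _ hf h)).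
by rewrite mulrN1.
Qed.

Lemma is_derive_continuous f t (df : R) : is_derive t 1 f df -> {for t, continuous f}.
Proof. by case=> h _; apply: differentiable_continuous; exact/derivable1_diffP. Qed.

Lemma mean_value f df a b : a < b -> (forall t, a <= t <= b -> is_derive t 1 f (df t)) ->
  exists c, [/\ a < c, c < b & f b - f a = df c * (b - a)].
Proof.
move=> ab H; have [||c] := @MVT R f df a b ab.
- by move=> t; rewrite in_itv/= => /andP[h1 h2]; apply: H; rewrite !ltW.
- apply: derivable_within_continuous => t; rewrite in_itv/= => /H.
  by case.
by rewrite in_itv/= => /andP[h1 h2] h3; exists c.
Qed.

Lemma barrier f a b : a <= b ->
  (forall t, a <= t <= b -> exists2 d, is_derive t 1 f d & (0 < f t -> d <= 0)) ->
  f a <= 0 -> f b <= 0.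
Proof.
move=> ab H fa; rewrite leNgt; apply/negP => fb.
pose S := [set t | a <= t <= b /\ f t <= 0].
have hS : has_sup S.
  by split; [exists a; split => //=; rewrite lexx|exists b => t [/andP[]]].
pose c := sup S.
have ac : a <= c by apply: ub_le_sup; [case: hS|split => //=; rewrite lexx].
have cb : c <= b by apply: ge_sup; [case: hS|move=> t [/andP[]]].
have fc : f c <= 0.
  rewrite leNgt; apply/negP => fc.
  have [d /is_derive_continuous cf _] := H c (introT andP (conj ac cb)).
  have : \forall t \near c, 0 < f t.
    exact: (cvgr_gt (f c) cf _ fc).
  move=> /nbhs_ballP[e /= e0 He].
  have [t [/andP[at' tb] ft] ct] := sup_adherent e0 hS.
  have tc : t <= c by apply: ub_le_sup; [case: hS|split => //; rewrite at' tb].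
  have : 0 < f t.
    by apply: He; rewrite /ball/= ger0_norm ?subr_ge0//; move: ct; rewrite -/c; lra.
  lra.
have clb : c < b by rewrite lt_neqAle cb andbT; apply/eqP => cb'; move: fc; rewrite cb'; lra.
have [t|x [cx xb xE]] := @mean_value f (fun t => 'D_1 f t) c b clb.
  move=> /andP[h1 h2]; have [|d hd _] := H t; first by rewrite (le_trans ac).
  by apply: derivableP; case: hd.
have [|d hd hd0] := H x; first by rewrite (ltW xb) (le_trans ac (ltW cx)).
have fx : 0 < f x.
  rewrite ltNge; apply/negP => fx; suff : x <= c by lra.
  by apply: ub_le_sup; [case: hS|split => //; rewrite (ltW xb) (le_trans ac (ltW cx))].
have d0 := hd0 fx; have dE : 'D_1 f x = d by case: hd.
have : d * (b - c) <= 0 by rewrite mulr_le0_ge0// subr_ge0 ltW.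
by rewrite -dE -xE; lra.
Qed.

Lemma derive_le0_decr f a b : a <= b ->
  (forall t, a <= t <= b -> exists2 d, is_derive t 1 f d & d <= 0) -> f b <= f a.
Proof.
move=> ab H; rewrite -subr_le0; apply: (@barrier (fun t => f t - f a) a b) => //; last by rewrite subrr.
move=> t /H[d hd d0]; exists (d - 0) => [|_]; last lra.
by apply: is_derive_subf => //; exact: is_derive_cstf.
Qed.

Lemma gronwall_le0 z K a b : a <= b ->
  (forall t, a <= t <= b -> exists2 d, is_derive t 1 z d & (0 < z t -> d <= K * z t)) ->
  z a <= 0 -> z b <= 0.
Proof.
move=> ab H za.
suff : z b * expR (- K * b) <= 0 by rewrite pmulr_lle0// expR_gt0.
apply: (@barrier (fun t => z t * expR (- K * t)) a b) => //; last first.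
  by rewrite pmulr_lle0// expR_gt0.
move=> t /H[d hd dz]; exists (d * expR (- K * t) + z t * (expR (- K * t) * - K)).
  by apply: is_derive_mulf => //; apply: is_derive_expf; exact: is_derive_linf.
rewrite pmulr_lgt0 ?expR_gt0// => /dz dK.
have -> : d * expR (- K * t) + z t * (expR (- K * t) * - K) = (d - K * z t) * expR (- K * t) by ring.
by rewrite pmulr_lle0 ?expR_gt0//; lra.
Qed.

Lemma derive_le_le f g a b : a <= b ->
  (forall t, a <= t <= b -> exists d e, [/\ is_derive t 1 f d, is_derive t 1 g e & d <= e]) ->
  f b - f a <= g b - g a.
Proof.
move=> ab H; suff : f b - g b <= f a - g a by lra.
apply: (@derive_le0_decr (fun t => f t - g t)) => // t /H[d [e [hd he de]]].
by exists (d - e); [exact: is_derive_subf|lra].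
Qed.
End derivatives.

Section primitives.
Context {R : realType}.

Let half (f : R -> R) : continuous f ->
  exists P : R -> R, forall t : R, -1 < t -> is_derive t 1 P (f t).
Proof.
move=> cf.
exists (fun x => (\int[lebesgue_measure]_(t in [set` `[-1, x]]) (f t))%R) => t t1.
have tt : t < t + 1 by lra.
have [||h1 h2] := @continuous_FTC1_closed R f (-1) t (t + 1) tt _ t1.
- apply: continuous_compact_integrable; first exact: segment_compact.
  exact: continuous_subspaceT.
- exact: cf.
by apply: (is_derive_eq (derivableP h1)); rewrite -derive1E; exact: h2.
Qed.

Lemma primitive_exists (f : R -> R) : continuous f ->
  exists P : R -> R, P 0 = 0 /\ forall t : R, is_derive t 1 P (f t).
Proof.
move=> cf; have [P HP] := half cf.
have [|Q HQ] := half (f := fun t => f (- t)).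
  by move=> t; apply: continuous_comp; [exact: opp_continuous|exact: cf].
pose P' t := P t - P 0; pose Q' t := - (Q (- t) - Q 0).
have dP (t : R) : -1 < t -> is_derive t 1 P' (f t).
  move=> t1; apply: (is_derive_eq (is_derive_subf (HP _ t1) (is_derive_cstf _ _))).
  by rewrite subr0.
have dQ (t : R) : t < 1 -> is_derive t 1 Q' (f t).
  move=> t1; have h : -1 < - t by lra.
  have := is_derive_oppf (is_derive_subf (is_derive_revf (HQ _ h)) (is_derive_cstf (Q 0) t)).
  by move=> hd; apply: (is_derive_eq hd); rewrite subr0 !opprK.
have P0 : P' 0 = 0 by rewrite /P' subrr.
have Q0 : Q' 0 = 0 by rewrite /Q' oppr0 subrr oppr0.
have PQ (t : R) : -1 < t -> t < 1 -> P' t = Q' t.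
  move=> t1 t2; have diff (x : R) : -1 < x -> x < 1 -> is_derive x 1 (fun x => P' x - Q' x) 0.
    by move=> x1 x2; apply: (is_derive_eq (is_derive_subf (dP _ x1) (dQ _ x2))); rewrite subrr.
  have diff' (x : R) : -1 < x -> x < 1 -> is_derive x 1 (fun x => Q' x - P' x) 0.
    by move=> x1 x2; apply: (is_derive_eq (is_derive_subf (dQ _ x2) (dP _ x1))); rewrite subrr.
  have [t0|t0] := leP 0 t.
    have : P' t - Q' t <= P' 0 - Q' 0.
      apply: (@derive_le0_decr _ (fun x => P' x - Q' x)) => // x /andP[h1 h2].
      by exists 0 => //; apply: diff; lra.
    have : Q' t - P' t <= Q' 0 - P' 0.
      apply: (@derive_le0_decr _ (fun x => Q' x - P' x)) => // x /andP[h1 h2].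
      by exists 0 => //; apply: diff'; lra.
    by rewrite P0 Q0; lra.
  have : P' 0 - Q' 0 <= P' t - Q' t.
    apply: (@derive_le0_decr _ (fun x => P' x - Q' x)); first exact: ltW.
    by move=> x /andP[h1 h2]; exists 0 => //; apply: diff; lra.
  have : Q' 0 - P' 0 <= Q' t - P' t.
    apply: (@derive_le0_decr _ (fun x => Q' x - P' x)); first exact: ltW.
    by move=> x /andP[h1 h2]; exists 0 => //; apply: diff'; lra.
  by rewrite P0 Q0; lra.
pose F t := if 0 <= t then P' t else Q' t.
exists F; split=> [|t]; first by rewrite /F lexx.
have [t0|t0] := leP t 0.
  apply: near_eq_is_derive (dQ t _); last lra.
  near=> x; have x1 : x < 1 by near: x; apply: lt_nbhsl; lra.
  by rewrite /F; have [x0|//] := leP 0 x; rewrite PQ//; lra.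
apply: near_eq_is_derive (dP t _); last lra.
near=> x; have x0 : 0 < x by near: x; exact: lt_nbhsr.
by rewrite /F ltW.
Unshelve. all: by end_near. Qed.
End primitives.

Section picard.
Context {R : realType} (H : R -> R -> R) (K C : R).
Hypothesis K1 : 1 <= K.
Hypothesis HL : forall t x y, `|H t x - H t y| <= K * `|x - y|.
Hypothesis HC : forall t, `|H t 0| <= C.
Hypothesis Hcont : forall u : R -> R, continuous u -> continuous (fun t => H t (u t)).

Let prim (f : R -> R) : R -> R :=
  if pselect (continuous f) is left h then sval (cid (primitive_exists h)) else f.

Let primP (f : R -> R) : continuous f -> prim f 0 = 0 /\ forall t : R, is_derive t 1 (prim f) (f t).
Proof.
by move=> cf; rewrite /prim; case: pselect => // h; case: cid.
Qed.

Implicit Types t : R.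

Let weight (t : R) := expR (2 * K * `|t|).

Let K0 : 0 <= K. Proof. exact: le_trans ler01 K1. Qed.
Let K20 : 0 < 2 * K. Proof. by rewrite mulr_gt0// (lt_le_trans ltr01 K1). Qed.

Let weight_ge1 t : 1 <= weight t.
Proof. by rewrite /weight -expR0 ler_expR !mulr_ge0. Qed.

Let integral_bound (f df : R -> R) A : f 0 = 0 -> 0 <= A ->
  (forall t, is_derive t 1 f (df t)) -> (forall t, `|df t| <= A * weight t) ->
  forall t, `|f t| <= A / (2 * K) * weight t.
Proof.
move=> f0 A0 hf hdf.
have K2 := K20.
suff Hp (g dg : R -> R) : g 0 = 0 -> (forall t, is_derive t 1 g (dg t)) ->
    (forall t, `|dg t| <= A * weight t) -> forall t, 0 <= t -> `|g t| <= A / (2 * K) * weight t.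
  move=> t; have [t0|t0] := leP 0 t; first exact: (Hp f df).
  have -> : f t = f (- - t) by rewrite opprK.
  have -> : weight t = weight (- t) by rewrite /weight normrN.
  apply: (Hp (fun t => f (- t)) (fun t => - df (- t))).
  - by rewrite oppr0.
  - by move=> x; apply: is_derive_revf; exact: hf.
  - by move=> x; rewrite normrN; apply: le_trans (hdf _) _; rewrite /weight normrN.
  - lra.
move=> g0 hg hdg t t0.
have dw (x : R) : 0 <= x -> is_derive x 1 (fun x => A / (2 * K) * expR (2 * K * x)) (A * expR (2 * K * x)).
  move=> x0; apply: (is_derive_eq (is_derive_scalef _ (is_derive_expf (is_derive_linf (2 * K) x)))).
  have h' : K != 0 by rewrite gt_eqF// (lt_le_trans ltr01 K1).
  by field.
have wE x : 0 <= x -> weight x = expR (2 * K * x) by move=> x0; rewrite /weight ger0_norm.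
have AK : 0 <= A / (2 * K) by rewrite divr_ge0// ltW.
rewrite ler_norml wE//; apply/andP; split.
  have : (fun x => - g x) t - (fun x => - g x) 0 <=
      A / (2 * K) * expR (2 * K * t) - A / (2 * K) * expR (2 * K * 0).
    apply: (@derive_le_le _ (fun x => - g x) (fun x => A / (2 * K) * expR (2 * K * x))) => //.
    move=> x /andP[x0 _]; exists (- dg x), (A * expR (2 * K * x)).
    split; [exact: is_derive_oppf|exact: dw|].
    by have := hdg x; rewrite ler_norml wE// => /andP[]; lra.
  by rewrite mulr0 expR0 mulr1 /= g0; lra.
have : g t - g 0 <= A / (2 * K) * expR (2 * K * t) - A / (2 * K) * expR (2 * K * 0).
  apply: (@derive_le_le _ g (fun x => A / (2 * K) * expR (2 * K * x))) => //.
  move=> x /andP[x0 _]; exists (dg x), (A * expR (2 * K * x)).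
  split; [exact: hg|exact: dw|].
  by have := hdg x; rewrite ler_norml wE// => /andP[]; lra.
by rewrite mulr0 expR0 mulr1 /= g0; lra.
Qed.

Let geometric_limit (a : nat -> R) A : (forall n, `|a n.+1 - a n| <= A / 2 ^+ n) ->
  exists l, forall n, `|a n - l| <= 2 * A / 2 ^+ n.
Proof.
move=> Ha; pose lo n := a n - 2 * A / 2 ^+ n; pose hi n := a n + 2 * A / 2 ^+ n.
have half n : 2 * A / 2 ^+ n.+1 = A / 2 ^+ n.
  have h : 2 ^+ n != 0 :> R by rewrite expf_neq0.
  by rewrite exprS; field.
have dbl n : 2 * A / 2 ^+ n = A / 2 ^+ n + A / 2 ^+ n by lra.
have loS n : lo n <= lo n.+1.
  by rewrite /lo half dbl; have := Ha n; rewrite ler_norml => /andP[]; lra.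
have hiS n : hi n.+1 <= hi n.
  by rewrite /hi half dbl; have := Ha n; rewrite ler_norml => /andP[]; lra.
have A0 : 0 <= A by have := le_trans (normr_ge0 _) (Ha 0%N); rewrite expr0 divr1.
have lohi n : lo n <= hi n.
  have : 0 <= 2 * A / 2 ^+ n by rewrite divr_ge0 ?mulr_ge0 ?exprn_ge0.
  by rewrite /lo /hi; lra.
have lom n k : lo n <= lo (n + k)%N.
  by elim: k => [|k IH]; rewrite ?addn0// addnS; exact: le_trans (loS _).
have him n k : hi (n + k)%N <= hi n.
  by elim: k => [|k IH]; rewrite ?addn0// addnS; exact: le_trans (hiS _) _.
have lohi2 n m : lo n <= hi m.
  apply: le_trans (lom n m) _; apply: le_trans (lohi _) _; rewrite addnC; exact: him.
exists (sup (range lo)) => n.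
have h1 : lo n <= sup (range lo).
  by apply: ub_le_sup; [exists (hi 0%N) => _ [k _ <-]; exact: lohi2|exists n].
have h2 : sup (range lo) <= hi n.
  by apply: ge_sup; [exists (lo 0%N), 0%N|move=> _ [k _ <-]; exact: lohi2].
by rewrite ler_norml; move: h1 h2; rewrite /lo /hi; lra.
Qed.

Lemma weight_continuous_bound t0 : \forall t \near t0, weight t <= weight (`|t0| + 1).
Proof.
near=> t; rewrite /weight ler_expR ler_wpM2l//; first by rewrite mulr_ge0.
have : `|t0 - t| < 1 by near: t; exact: (@nbhsx_ballx _ _ t0 1 ltr01).
have := ler_normD (t - t0) t0; rewrite subrK distrC.
have := ler_norm (`|t0| + 1); lra.
Unshelve. all: by end_near. Qed.

Lemma picard_global x : exists u : R -> R, u 0 = x /\ forall t : R, is_derive t 1 u (H t (u t)).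
Proof.
pose step (v : R -> R) : R -> R := fun t => x + prim (fun t => H t (v t)) t.
have stepP (v : R -> R) : continuous v -> step v 0 = x /\ forall t : R, is_derive t 1 (step v) (H t (v t)).
  move=> cv; have [p0 p1] := primP (Hcont cv); split; first by rewrite /step p0 addr0.
  by move=> t; apply: (is_derive_eq (is_derive_addf (is_derive_cstf x t) (p1 t))); rewrite add0r.
have step_cont (v : R -> R) : continuous v -> continuous (step v).
  by move=> /stepP[_ h] t; exact: is_derive_continuous (h t).
pose u n := iter n step (fun _ => x).
have cu n : continuous (u n).
  elim: n => [|n IH]; first exact: continuous_cstf.
  exact: step_cont.
pose A := C + K * `|x|.
have A0 : 0 <= A.
  by rewrite addr_ge0// ?mulr_ge0//; exact: le_trans (HC 0).
have Hx t : `|H t x| <= A.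
  have := HL t x 0; rewrite subr0; have := HC t; have := ler_normD (H t x - H t 0) (H t 0).
  by rewrite subrK /A; lra.
have bd n : forall t, `|u n.+1 t - u n t| <= A / 2 ^+ n * weight t.
  have K2 := K20.
  elim: n => [|n IH].
    move=> t; rewrite expr0 divr1; apply: (@le_trans _ _ (A / (2 * K) * weight t)).
      have [s0 s1] := stepP _ (cu 0%N).
      apply: (@integral_bound (fun t => u 1%N t - u 0%N t) (fun t => H t x - 0)) => //.
      - by rewrite /= /u /= s0 subrr.
      - move=> r; rewrite subr0; apply: le_trans (Hx r) _.
        by rewrite ler_peMr.
    rewrite ler_wpM2r//; first exact: le_trans ler01 (weight_ge1 t).
    by rewrite ler_pdivrMr// ler_peMr//; have := K1; lra.
  have [s0 s1] := stepP _ (cu n); have [s0' s1'] := stepP _ (cu n.+1).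
  have -> : A / 2 ^+ n.+1 = (K * (A / 2 ^+ n)) / (2 * K).
    have h : 2 ^+ n != 0 :> R by rewrite expf_neq0.
    have h' : K != 0 by rewrite gt_eqF// (lt_le_trans ltr01 K1).
    by rewrite exprS; field; rewrite h h'.
  apply: (@integral_bound (fun t => u n.+2 t - u n.+1 t) (fun t => H t (u n.+1 t) - H t (u n t))).
  - by rewrite /= -/(u n) s0 /u /= s0' subrr.
  - by rewrite mulr_ge0// ?divr_ge0// ?exprn_ge0.
  - move=> r; apply: le_trans (HL _ _ _) _; rewrite -mulrA ler_wpM2l//.
have /choice[v Hv] : forall t, exists l, forall n, `|u n t - l| <= 2 * (A * weight t) / 2 ^+ n.
  by move=> t; apply: geometric_limit => n; rewrite mulrAC; exact: bd.
have small (B e : R) : 0 <= B -> 0 < e -> exists n, B / 2 ^+ n < e.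
  move=> B0 e0; pose n := (Num.truncn (B / e)).+1; exists n.
  rewrite ltr_pdivrMr ?exprn_gt0// mulrC -ltr_pdivrMr//.
  apply: lt_trans (truncnS_gt (B / e)) _.
  by rewrite -natrX ltr_nat ltn_expl.
have cv : continuous v.
  move=> t0; apply/cvgrPdist_lt => e e0.
  pose B := 2 * (A * weight (`|t0| + 1)).
  have B0 : 0 <= B by rewrite !mulr_ge0//; exact: le_trans ler01 (weight_ge1 _).
  have e3 : 0 < e / 3 by lra.
  have [n Bn] := small B _ B0 e3.
  have vb t : weight t <= weight (`|t0| + 1) -> `|u n t - v t| < e / 3.
    move=> wt; apply: le_lt_trans Bn; apply: le_trans (Hv t n) _.
    by rewrite ler_pM2r ?invr_gt0 ?exprn_gt0// ler_pM2l// ler_wpM2l.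
  have v0 : `|u n t0 - v t0| < e / 3.
    by apply: vb; rewrite /weight ler_expR ler_wpM2l ?mulr_ge0//; rewrite [leRHS]ger0_norm ?addr_ge0//; lra.
  near=> t.
  have h1 : `|u n t - v t| < e / 3 by apply: vb; near: t; exact: weight_continuous_bound.
  have h2 : `|u n t0 - u n t| < e / 3.
    by near: t; have /cvgrPdist_lt/(_ _ e3) := cu n t0.
  have -> : v t0 - v t = - (u n t0 - v t0) + (u n t0 - u n t) + (u n t - v t) by ring.
  have := ler_normD (- (u n t0 - v t0) + (u n t0 - u n t)) (u n t - v t).
  by have := ler_normD (- (u n t0 - v t0)) (u n t0 - u n t); rewrite normrN; lra.
have [s0 s1] := stepP _ cv.
suff vE : v = step v by exists v; split; [rewrite vE|move=> t; rewrite {1}vE; exact: s1].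
apply/funext => t; apply/eqP; rewrite -subr_eq0 -normr_eq0 eq_le normr_ge0 andbT.
apply: le_addgt0 => e e0; rewrite add0r.
pose B := 2 * (2 * A * weight t).
have B0 : 0 <= B by rewrite !mulr_ge0//; exact: le_trans ler01 (weight_ge1 _).
have [n Bn] := small B _ B0 e0.
have K2 := K20.
have p0 : 0 < (2 ^+ n)^-1 :> R by rewrite invr_gt0 exprn_gt0.
have h1 : `|u n.+1 t - step v t| <= (K * (2 * A / 2 ^+ n)) / (2 * K) * weight t.
  have [s0' s1'] := stepP _ (cu n).
  apply: (@integral_bound (fun t => u n.+1 t - step v t) (fun t => H t (u n t) - H t (v t))).
  - by rewrite /= -/(u n) s0' s0 subrr.
  - by rewrite !mulr_ge0//; exact: ltW.
  - move=> r; apply: le_trans (HL _ _ _) _; apply: le_trans (ler_wpM2l K0 (Hv r n)) _.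
    by rewrite le_eqVlt; apply/orP; left; apply/eqP; ring.
have h2 := Hv t n.+1.
have E1 : (K * (2 * A / 2 ^+ n)) / (2 * K) * weight t = A * weight t / 2 ^+ n.
  have h : 2 ^+ n != 0 :> R by rewrite expf_neq0.
  have h' : K != 0 by rewrite gt_eqF// (lt_le_trans ltr01 K1).
  by field; rewrite h h'.
have E2 : 2 * (A * weight t) / 2 ^+ n.+1 = A * weight t / 2 ^+ n.
  have h : 2 ^+ n != 0 :> R by rewrite expf_neq0.
  by rewrite exprS; field.
have E3 : B / 2 ^+ n = 4 * (A * weight t / 2 ^+ n) by rewrite /B; ring.
have h3 : 0 <= A * weight t / 2 ^+ n.
  by apply: mulr_ge0; [apply: mulr_ge0 => //; exact: le_trans ler01 (weight_ge1 _)|exact: ltW].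
rewrite E1 in h1; rewrite E2 in h2; rewrite E3 in Bn.
have := ler_normD (- (u n.+1 t - v t)) (u n.+1 t - step v t).
by rewrite normrN opprB addrA subrK; lra.
Unshelve. all: by end_near. Qed.
End picard.

Lemma tube {R : realType} {X Y : topologicalType} (K : set X) (h : X -> Y -> R) y0 :
  compact K -> continuous (fun q : X * Y => h q.1 q.2) ->
  forall e : R, 0 < e -> \forall y \near y0, forall x, K x -> `|h x y - h x y0| <= e.
Proof.
move=> /compact_near_coveringP cK ch e e0.
have ch2 : continuous (fun q : X * Y => h q.1 q.2 - h q.1 y0).
  apply: continuous_subf => //.
  apply: (@continuous_comp2 _ _ _ _ h fst (fun=> y0)) => // q; [exact: cvg_fst|exact: cvg_cst].
apply: (cK Y (nbhs y0) (fun y x => `|h x y - h x y0| <= e)) => x Kx.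
have /cvgrPdist_le/(_ _ e0) := ch2 (x, y0); rewrite /= subrr.
by apply: filterS => -[x' y] /=; rewrite sub0r normrN.
Qed.

Section system.
Context {R : realType} {T : pseudoPMetricType R} (s : R -> T -> T) (G : T -> R -> R) (K : R).
Implicit Types (t a b l x : R) (w : T) (u v : R -> R).

Definition subsol l w u :=
  forall t, exists2 d, is_derive t 1 u d & d <= G (s t w) (u t) + l.
Definition supersol l w u :=
  forall t, exists2 d, is_derive t 1 u d & G (s t w) (u t) + l <= d.
Definition solution l w u := forall t, is_derive t 1 u (G (s t w) (u t) + l).
Definition bounded_orbit u := exists M : R, forall t, `|u t| <= M.

Lemma solution_subsol l w u : solution l w u -> subsol l w u.
Proof. by move=> h t; exists (G (s t w) (u t) + l). Qed.

Lemma solution_supersol l w u : solution l w u -> supersol l w u.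
Proof. by move=> h t; exists (G (s t w) (u t) + l). Qed.

Lemma subsolW l l' w u : l <= l' -> subsol l w u -> subsol l' w u.
Proof. by move=> ll h t; have [d hd dl] := h t; exists d => //; lra. Qed.

Hypothesis fl : is_flow s.
Hypothesis LG : forall w x y, `|G w x - G w y| <= K * `|x - y|.
Hypothesis K1 : 1 <= K.

Lemma solution_shift l w u c : solution l w u -> solution l (s c w) (fun t => u (t + c)).
Proof. by move=> h t; apply: is_derive_shiftf; rewrite -fl.2.2; exact: h. Qed.

Lemma lipschitz_le w x y : x <= y -> G w y - G w x <= K * (y - x).
Proof. by move=> xy; have := LG w y x; rewrite !ler_norml ger0_norm ?subr_ge0// => /andP[]. Qed.

Lemma lipschitz_ge w x y : x <= y -> - (K * (y - x)) <= G w y - G w x.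
Proof. by move=> xy; have := LG w y x; rewrite !ler_norml ger0_norm ?subr_ge0// => /andP[]. Qed.

Lemma comparison_on l w u v a b : a <= b ->
  (forall t, a <= t <= b -> exists2 d, is_derive t 1 u d & d <= G (s t w) (u t) + l) ->
  (forall t, a <= t <= b -> exists2 d, is_derive t 1 v d & G (s t w) (v t) + l <= d) ->
  u a <= v a -> u b <= v b.
Proof.
move=> ab hu hv uv; rewrite -subr_le0.
apply: (@gronwall_le0 _ (fun t => u t - v t) K a b) => //; last by rewrite subr_le0.
move=> t tab; have [d hd dl] := hu t tab; have [d' hd' dl'] := hv t tab.
exists (d - d') => [|h]; first exact: is_derive_subf.
have := @lipschitz_le (s t w) (v t) (u t); lra.
Qed.

Lemma comparison_back_on l w u v a b : a <= b ->
  (forall t, a <= t <= b -> exists2 d, is_derive t 1 u d & d <= G (s t w) (u t) + l) ->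
  (forall t, a <= t <= b -> exists2 d, is_derive t 1 v d & G (s t w) (v t) + l <= d) ->
  v b <= u b -> v a <= u a.
Proof.
move=> ab hu hv uv; rewrite -subr_le0.
have -> : v a - u a = (fun t => v (- t) - u (- t)) (- a) by rewrite /= opprK.
apply: (@gronwall_le0 _ (fun t => v (- t) - u (- t)) K (- b) (- a)).
- lra.
- move=> t tab; have tab' : a <= - t <= b by lra.
  have [d hd dl] := hu _ tab'; have [d' hd' dl'] := hv _ tab'.
  exists (- d' - - d) => [|h].
    by apply: is_derive_subf; exact: is_derive_revf.
  have := @lipschitz_ge (s (- t) w) (u (- t)) (v (- t)); lra.
- by rewrite opprK subr_le0.
Qed.

Lemma comparison l w u v a b : a <= b -> subsol l w u -> supersol l w v ->
  u a <= v a -> u b <= v b.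
Proof. by move=> ab hu hv; apply: comparison_on ab _ _ => t _; [exact: hu|exact: hv]. Qed.

Lemma comparison_back l w u v a b : a <= b -> subsol l w u -> supersol l w v ->
  v b <= u b -> v a <= u a.
Proof. by move=> ab hu hv; apply: comparison_back_on ab _ _ => t _; [exact: hu|exact: hv]. Qed.

Lemma solution_unique l w u v a t : solution l w u -> solution l w v -> u a = v a -> u t = v t.
Proof.
move=> hu hv uv.
have su := solution_subsol hu; have Su := solution_supersol hu.
have sv := solution_subsol hv; have Sv := solution_supersol hv.
apply/eqP; rewrite eq_le; have [at'|/ltW ta] := leP a t.
  by rewrite (comparison at' su Sv) ?uv// (comparison at' sv Su) ?uv.
by rewrite (comparison_back ta sv Su) ?uv// (comparison_back ta su Sv) ?uv.
Qed.

Lemma solution_lt l w u v a t : solution l w u -> solution l w v -> u a < v a -> u t < v t.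
Proof.
move=> hu hv uv; rewrite ltNge; apply/negP => vu.
have su := solution_subsol hu; have Su := solution_supersol hu.
have sv := solution_subsol hv; have Sv := solution_supersol hv.
suff : v a <= u a by lra.
have [at'|/ltW ta] := leP a t; first exact: (comparison_back at' su Sv).
exact: (comparison ta sv Su).
Qed.

Lemma solution_le l w u v a t : solution l w u -> solution l w v -> u a <= v a -> u t <= v t.
Proof.
move=> hu hv; rewrite le_eqVlt => /predU1P[uv|uv].
  by rewrite (solution_unique t hu hv uv).
by rewrite ltW// (solution_lt t hu hv uv).
Qed.

Lemma gap_forward l0 l w (b u : R -> R) a t : l0 <= l -> a <= t -> subsol l0 w b -> supersol l w u ->
  b a <= u a ->
  (u a - b a - (l - l0) / K) * expR (- (K * (t - a))) <= u t - b t - (l - l0) / K.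
Proof.
move=> ll at' hb hu ba; pose k := (l - l0) / K.
have K0 : 0 < K by exact: lt_le_trans ltr01 K1.
have Kk : K * k = l - l0 by rewrite /k mulrCA divff ?mulr1// gt_eqF.
have ord r : a <= r -> b r <= u r.
  by move=> ar; exact: (comparison ar (subsolW ll hb) hu ba).
have : - ((u t - b t - k) * expR (K * t)) <= - ((u a - b a - k) * expR (K * a)).
  apply: (@derive_le0_decr _ (fun r => - ((u r - b r - k) * expR (K * r)))) => // r /andP[ar rt].
  have [d hd dl] := hb r; have [d' hd' dl'] := hu r.
  exists (- ((d' - d - 0) * expR (K * r) + (u r - b r - k) * (expR (K * r) * K))).
    exact: (is_derive_oppf (is_derive_mulf
      (is_derive_subf (is_derive_subf hd' hd) (is_derive_cstf k r))
      (is_derive_expf (is_derive_linf K r)))).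
  have -> : - ((d' - d - 0) * expR (K * r) + (u r - b r - k) * (expR (K * r) * K)) =
    - ((d' - d + K * (u r - b r) - K * k) * expR (K * r)) by ring.
  rewrite oppr_le0 mulr_ge0 ?expR_ge0// Kk.
  by have := lipschitz_ge (s r w) (ord r ar); lra.
rewrite lerN2 => h.
have E : expR (- (K * (t - a))) = expR (K * a) * expR (- (K * t)).
  by rewrite -expRD; congr expR; ring.
rewrite -/k E mulrA -(ler_pM2r (expR_gt0 (K * t))).
by rewrite -[leLHS]mulrA -expRD addNr expR0 mulr1.
Qed.

Lemma gap_strict l0 l w (b u : R -> R) a t : l0 < l -> a < t -> subsol l0 w b -> supersol l w u ->
  b a <= u a -> b t < u t.
Proof.
move=> ll at' hb hu ba; have := gap_forward (ltW ll) (ltW at') hb hu ba.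
have K0 : 0 < K by exact: lt_le_trans ltr01 K1.
have k0 : 0 < (l - l0) / K by rewrite divr_gt0// subr_gt0.
have E1 : expR (- (K * (t - a))) < 1 by rewrite -expR0 ltr_expR oppr_lt0 mulr_gt0// subr_gt0.
have E0 := expR_gt0 (- (K * (t - a))).
set k := (l - l0) / K in k0 *; set E := expR _ in E0 E1 *.
have : 0 <= (u a - b a) * E by rewrite mulr_ge0 ?subr_ge0// ltW.
have : k * E < k by rewrite gtr_pMr.
lra.
Qed.

Lemma gap_keep l0 l w (b u : R -> R) a t (de : R) : l0 <= l -> a <= t -> subsol l0 w b -> supersol l w u ->
  0 <= de -> de <= (l - l0) / K -> de <= u a - b a -> de <= u t - b t.
Proof.
move=> ll at' hb hu d0 dk da; have ba : b a <= u a by lra.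
have := gap_forward ll at' hb hu ba.
have K0 : 0 < K by exact: lt_le_trans ltr01 K1.
have E1 : expR (- (K * (t - a))) <= 1 by rewrite -expR0 ler_expR oppr_le0 mulr_ge0 ?subr_ge0// ltW.
have E0 := expR_gt0 (- (K * (t - a))).
set k := (l - l0) / K in dk *; set E := expR _ in E0 E1 *.
have : 0 <= (u a - b a - de) * E by rewrite mulr_ge0 ?subr_ge0// ltW.
have : 0 <= (k - de) * (1 - E) by rewrite mulr_ge0 ?subr_ge0.
lra.
Qed.

Lemma gap_global l0 l w (b u : R -> R) : l0 <= l -> subsol l0 w b -> supersol l w u ->
  (forall t, b t <= u t) -> forall t, (l - l0) / K <= u t - b t.
Proof.
move=> ll hb hu bu t; rewrite leNgt; apply/negP => lt.
have K0 : 0 < K by exact: lt_le_trans ltr01 K1.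
pose k := (l - l0) / K; pose sg := k - (u t - b t).
have sg0 : 0 < sg by rewrite subr_gt0.
have k0 : 0 <= k by rewrite divr_ge0 ?subr_ge0// ltW.
pose r := (k / sg + 1) / K.
have r0 : 0 <= r.
  apply: divr_ge0; last exact: ltW.
  by apply: addr_ge0 => //; apply: divr_ge0 => //; exact: ltW.
have tr : t - r <= t by lra.
have := gap_forward ll tr hb hu (bu (t - r)).
rewrite -/k; have -> : K * (t - (t - r)) = k / sg + 1.
  by rewrite /r opprB addrCA subrr addr0 mulrCA divff ?mulr1// gt_eqF.
rewrite expRN ler_pdivrMr ?expR_gt0// => h.
have E : k / sg + 1 + 1 <= expR (k / sg + 1) by rewrite addrC; exact: expR_ge1Dx.
have : sg * (k / sg + 1 + 1) <= sg * expR (k / sg + 1) by rewrite ler_pM2l.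
have -> : sg * (k / sg + 1 + 1) = k + 2 * sg by field; rewrite gt_eqF.
have := bu (t - r); rewrite /sg in h *; move: h; rewrite /sg.
have sg0' : 0 < k - (u t - b t) by exact: sg0.
by set E' := expR _; lra.
Qed.

Hypothesis cT : compact [set: T].
Hypothesis cG : continuous (fun p : T * R => G p.1 p.2).

Lemma vector_field_continuous l w u : continuous u -> continuous (fun t => G (s t w) (u t) + l).
Proof.
move=> cu; apply: continuous_addf; last exact: continuous_cstf.
apply: (@continuous_comp2 _ _ _ _ G (fun t => s t w) u) => //.
apply: (@continuous_comp2 _ _ _ _ s id (fun=> w)); first by case: fl.
  by move=> t; exact: cvg_id.
by move=> t; exact: cvg_cst.
Qed.

Lemma solution_exists l w x : exists u, u 0 = x /\ solution l w u.
Proof.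
have cG0 : continuous (fun w => G w 0).
  apply: (@continuous_comp2 _ _ _ _ G id (fun=> 0)) => // ?; [exact: cvg_id|exact: cvg_cst].
have [C [C0 HC]] := continuous_bounded cT cG0.
apply: (@picard_global R (fun t y => G (s t w) y + l) K (C + `|l|)) => //.
- by move=> t y z; rewrite opprD addrACA subrr addr0.
- by move=> t; apply: le_trans (ler_normD _ _) _; rewrite lerD2r.
- by move=> u; exact: vector_field_continuous.
Qed.

Definition phi l w x : R -> R := sval (cid (solution_exists l w x)).

Lemma phi0 l w x : phi l w x 0 = x. Proof. by rewrite /phi; case: cid => u []. Qed.
Lemma phi_solution l w x : solution l w (phi l w x). Proof. by rewrite /phi; case: cid => u []. Qed.

Lemma phi_unique l w u t : solution l w u -> phi l w (u 0) t = u t.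
Proof. by move=> hu; apply: (@solution_unique l w _ _ 0 t (phi_solution l w (u 0)) hu); rewrite phi0. Qed.

Let gronwall_abs (z : R -> R) N e : 0 <= N -> 0 <= e ->
  (forall t, 0 <= t <= N -> exists2 d, is_derive t 1 z d & `|d| <= K * `|z t| + e) ->
  `|z 0| <= e -> `|z N| <= e * expR ((K + 1) * N).
Proof.
move=> N0 e0; have K0 : 0 <= K by exact: le_trans ler01 K1.
suff H (y : R -> R) : (forall t, 0 <= t <= N -> exists2 d, is_derive t 1 y d & `|d| <= K * `|y t| + e) ->
    `|y 0| <= e -> y N <= e * expR ((K + 1) * N).
  move=> hz z0; rewrite ler_norml H// andbT lerNl.
  apply: (H (fun t => - z t)); last by rewrite normrN.
  move=> t /hz[d hd dl]; exists (- d); first exact: is_derive_oppf.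
  by rewrite !normrN.
move=> hy y0; rewrite -subr_le0.
apply: (@gronwall_le0 _ (fun t => y t - e * expR ((K + 1) * t)) K 0 N) => //; last first.
  by rewrite mulr0 expR0 mulr1 subr_le0; exact: le_trans (ler_norm _) y0.
move=> t /[dup] /andP[t0 _] /hy[d hd dl]; exists (d - e * (expR ((K + 1) * t) * (K + 1))).
  apply: is_derive_subf => //; apply: is_derive_scalef; apply: is_derive_expf.
  exact: is_derive_linf.
move=> h; have E1 : 1 <= expR ((K + 1) * t) by rewrite -expR0 ler_expR mulr_ge0// addr_ge0.
have eE : 0 <= e * (expR ((K + 1) * t) - 1) by rewrite mulr_ge0// subr_ge0.
have yt : 0 <= y t.
  have : 0 <= e * expR ((K + 1) * t) by rewrite mulr_ge0// expR_ge0.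
  lra.
have := le_trans (ler_norm d) dl; rewrite (ger0_norm yt).
have -> : e * (expR ((K + 1) * t) * (K + 1)) = K * (e * expR ((K + 1) * t)) + e * expR ((K + 1) * t) by ring.
lra.
Qed.

Lemma phi_continuous t : continuous (fun p : R * T * R => phi p.1.1 p.1.2 p.2 t).
Proof.
move=> [[l0 w0] x0]; apply/cvgrPdist_le => e e0 /=.
pose v := phi l0 w0 x0; have hv := phi_solution l0 w0 x0.
have cv : continuous v by move=> r; exact: is_derive_continuous (hv r).
pose N := `|t|; pose E := expR ((K + 1) * N).
have E0 : 0 < E by exact: expR_gt0.
pose e1 := e / E; have e10 : 0 < e1 by rewrite divr_gt0.
have e12 : 0 < e1 / 2 by rewrite divr_gt0.
have cGv : continuous (fun q : R * T => G (s q.1 q.2) (v q.1)).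
  apply: (@continuous_comp2 _ _ _ _ G (fun q : R * T => s q.1 q.2) (fun q => v q.1)) => //.
    by case: fl.
  by move=> q; apply: continuous_comp; [exact: cvg_fst|exact: cv].
have tub := @tube R R T `[- N, N]%classic (fun r w => G (s r w) (v r)) w0
  (@segment_compact R (- N) N) cGv _ e12.
have nl : \forall p \near (l0, w0, x0), `|l0 - p.1.1| <= e1 / 2.
  have : (fun p : R * T * R => p.1.1) @ (l0, w0, x0) --> l0.
    by apply: (@cvg_comp _ _ _ fst fst _ (nbhs (l0, w0))); [exact: cvg_fst|exact: cvg_fst].
  by move/cvgrPdist_le; apply.
have nw : \forall p \near (l0, w0, x0), forall r : R, `[- N, N]%classic r ->
    `|G (s r p.1.2) (v r) - G (s r w0) (v r)| <= e1 / 2.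
  have : (fun p : R * T * R => p.1.2) @ (l0, w0, x0) --> w0.
    by apply: (@cvg_comp _ _ _ fst snd _ (nbhs (l0, w0))); [exact: cvg_fst|exact: cvg_snd].
  by move=> cw; have := cw _ tub.
have nx : \forall p \near (l0, w0, x0), `|x0 - p.2| <= e1.
  have : (fun p : R * T * R => p.2) @ (l0, w0, x0) --> x0 by exact: cvg_snd.
  by move/cvgrPdist_le; apply.
near=> p; pose u := phi p.1.1 p.1.2 p.2; have hu := phi_solution p.1.1 p.1.2 p.2.
have pl : `|l0 - p.1.1| <= e1 / 2 by near: p.
have pw r : - N <= r <= N -> `|G (s r p.1.2) (v r) - G (s r w0) (v r)| <= e1 / 2.
  by move: r; near: p; apply: filterS nw => p h r rN; apply: h; rewrite /= in_itv.
have px : `|x0 - p.2| <= e1 by near: p.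
have dz r : - N <= r <= N ->
    is_derive r 1 (fun r => v r - u r) (G (s r w0) (v r) + l0 - (G (s r p.1.2) (u r) + p.1.1)) /\
    `|G (s r w0) (v r) + l0 - (G (s r p.1.2) (u r) + p.1.1)| <= K * `|v r - u r| + e1.
  move=> rN; split; first exact: is_derive_subf.
  have -> : G (s r w0) (v r) + l0 - (G (s r p.1.2) (u r) + p.1.1) =
     - (G (s r p.1.2) (v r) - G (s r w0) (v r)) + (G (s r p.1.2) (v r) - G (s r p.1.2) (u r))
     + (l0 - p.1.1) by ring.
  apply: le_trans (ler_normD _ _) _.
  have := ler_normD (- (G (s r p.1.2) (v r) - G (s r w0) (v r))) (G (s r p.1.2) (v r) - G (s r p.1.2) (u r)).
  by rewrite normrN; have := pw r rN; have := LG (s r p.1.2) (v r) (u r); lra.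
have z0 : `|v 0 - u 0| <= e1 by rewrite /v /u !phi0.
suff : `|v t - u t| <= e1 * E by rewrite /e1 divfK ?gt_eqF.
have N0 : 0 <= N by exact: normr_ge0.
have [t0|t0] := leP 0 t.
  rewrite /E /N (ger0_norm t0).
  apply: (@gronwall_abs (fun r => v r - u r)) => //; first exact: ltW.
  move=> r /andP[r0 rt]; have [|h1 h2] := dz r; first by rewrite /N (ger0_norm t0); lra.
  by eexists; [exact: h1|exact: h2].
have NE : N = - t by rewrite /N ltr0_norm.
rewrite /E NE; have -> : v t - u t = (fun r => v (- r) - u (- r)) (- t) by rewrite /= opprK.
apply: (@gronwall_abs (fun r => v (- r) - u (- r))); [lra|exact: ltW| |by rewrite oppr0].
move=> r /andP[r0 rt]; have [|h1 h2] := dz (- r); first by rewrite NE; lra.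
eexists; first exact: (is_derive_revf h1).
by rewrite normrN; exact: h2.
Unshelve. all: by end_near. Qed.
End system.

(** * Bounded solutions of nearly concave Lipschitz systems *)

Section reversal.
Context {R : realType} {T : pseudoPMetricType R}.
Implicit Types (s : R -> T -> T) (G : T -> R -> R) (l t x : R) (w : T) (u : R -> R).

Definition rev_flow s : R -> T -> T := fun t w => s (- t) w.
Definition rev_field G : T -> R -> R := fun w x => G w (- x).
Definition rev_fun u : R -> R := fun t => - u (- t).

Lemma rev_flowK s : rev_flow (rev_flow s) = s.
Proof. by apply/funext => t; apply/funext => w; rewrite /rev_flow opprK. Qed.

Lemma rev_fieldK G : rev_field (rev_field G) = G.
Proof. by apply/funext => w; apply/funext => x; rewrite /rev_field opprK. Qed.

Lemma is_derive_rev_fun u t (d : R) : is_derive (- t) 1 u d -> is_derive t 1 (rev_fun u) d.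
Proof.
by move=> h; apply: (is_derive_eq (is_derive_oppf (is_derive_revf h))); rewrite opprK.
Qed.

Lemma rev_flow_is_flow s : is_flow s -> is_flow (rev_flow s).
Proof.
move=> [cs [s0 sD]]; split; [|split].
- apply: (@continuous_comp2 _ _ _ _ s (fun p : R * T => - p.1) snd) => // p.
    by apply: cvgN; exact: cvg_fst.
  exact: cvg_snd.
- by move=> w; rewrite /rev_flow oppr0.
- by move=> t u w; rewrite /rev_flow opprD sD.
Qed.

Lemma subsol_rev s G l w u : subsol s G l w u ->
  subsol (rev_flow s) (rev_field G) l w (rev_fun u).
Proof.
move=> h t; have [d hd dl] := h (- t); exists d; first exact: is_derive_rev_fun.
by rewrite /rev_field /rev_fun opprK.
Qed.

Lemma solution_rev s G l w u : solution s G l w u ->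
  solution (rev_flow s) (rev_field G) l w (rev_fun u).
Proof.
by move=> h t; apply: is_derive_rev_fun; rewrite /rev_field /rev_fun opprK; exact: h.
Qed.

Lemma bounded_orbit_rev u : bounded_orbit u -> bounded_orbit (rev_fun u).
Proof. by move=> [M H]; exists M => t; rewrite normrN. Qed.

Lemma inBE s G l w x : inB s (fun w x => G w x + l) w x <->
  exists u, [/\ u 0 = x, solution s G l w u & bounded_orbit u].
Proof.
split=> [[u [[u0 hu] bu]]|[u [u0 hu bu]]]; exists u; split => //.
by move=> t; exact: hu.
Qed.

Lemma inB_rev s G l w x : inB s (fun w x => G w x + l) w x ->
  inB (rev_flow s) (fun w x => rev_field G w x + l) w (- x).
Proof.
move=> /inBE[u [u0 hu bu]]; apply/inBE; exists (rev_fun u); split.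
- by rewrite /rev_fun oppr0 u0.
- exact: solution_rev.
- exact: bounded_orbit_rev.
Qed.

Lemma inB_revE s G l w : [set x | inB (rev_flow s) (fun w x => rev_field G w x + l) w x] =
  -%R @` [set x | inB s (fun w x => G w x + l) w x].
Proof.
apply/seteqP; split=> [x /= h|_ [x h <-]]; last exact: inB_rev.
by exists (- x); rewrite ?opprK//; have := inB_rev h; rewrite rev_flowK rev_fieldK.
Qed.

Lemma amax_rev s G l w : amax (rev_flow s) (fun w x => rev_field G w x + l) w =
  - rmin s (fun w x => G w x + l) w.
Proof. by rewrite /amax inB_revE /rmin /inf opprK. Qed.

Lemma OmegaB_rev s G l : OmegaB (rev_flow s) (fun w x => rev_field G w x + l) =
  OmegaB s (fun w x => G w x + l).
Proof.
apply/seteqP; split=> w [x]; last by move=> h; exists (- x); exact: inB_rev.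
by move=> /inB_rev; rewrite rev_flowK rev_fieldK; exists (- x).
Qed.

Definition top_barrier s G Lam := forall l w, l <= Lam -> exists tau,
  [/\ supersol s G l w tau, bounded_orbit tau &
      forall u, subsol s G l w u -> bounded_orbit u -> forall t, u t <= tau t].

Record admissible s G (K : R) (e : T -> R) (Lam C : R) : Prop := Admissible {
  adm_flow : is_flow s;
  adm_compact : compact [set: T];
  adm_cont : continuous (fun p : T * R => G p.1 p.2);
  adm_K1 : 1 <= K;
  adm_lip : forall w x y, `|G w x - G w y| <= K * `|x - y|;
  (* [e w] bounds the failure of concavity of [G w] *)
  adm_e0 : forall w, 0 <= e w;
  adm_defect : forall w x y z, x <= y -> y <= z ->
    (G w z - G w y) * (y - x) <= (G w y - G w x) * (z - y) + e w * ((z - y) * (y - x));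
  adm_corrector : forall eta : R, 0 < eta -> exists (h k : T -> R) (B : R),
    [/\ forall w, `|h w| <= B,
        forall w t, is_derive t 1 (fun t => h (s t w)) (k (s t w)) &
        forall w, e w + k w <= eta];
  adm_bounded : forall l w u, l <= Lam -> subsol s G l w u -> bounded_orbit u ->
    forall t, `|u t| <= C;
  adm_top : top_barrier s G Lam;
  adm_bot : top_barrier (rev_flow s) (rev_field G) Lam }.

Lemma admissible_rev s G K e Lam C : admissible s G K e Lam C ->
  admissible (rev_flow s) (rev_field G) K e Lam C.
Proof.
move=> [fl cT cG K1 LG e0 HD HE HC ht hb]; split => //.
- exact: rev_flow_is_flow.
- apply: (@continuous_comp2 _ _ _ _ G fst (fun p : T * R => - p.2)) => // p.
    exact: cvg_fst.
  by apply: cvgN; exact: cvg_snd.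
- move=> w x y; rewrite /rev_field; apply: le_trans (LG _ _ _) _.
  by rewrite -opprD normrN.
- move=> w x y z xy yz; rewrite /rev_field.
  have := @HD w (- z) (- y) (- x); rewrite !lerN2 => /(_ yz xy).
  rewrite !opprK; lra.
- move=> eta /HE[h [k [B [h1 h2 h3]]]]; exists (fun w => - h w), k, B; split => //.
    by move=> w; rewrite normrN.
  move=> w t; have := is_derive_rev_fun (t := t) (h2 w (- t)).
  by rewrite /rev_fun.
- move=> l w u ll /subsol_rev; rewrite rev_flowK rev_fieldK => su /bounded_orbit_rev bu t.
  by have := HC l w _ ll su bu (- t); rewrite /rev_fun opprK normrN.
- by rewrite rev_flowK rev_fieldK.
Qed.
End reversal.

Section shift_average.
Context {R : realType} (P f : R -> R) (ts : seq R) (D : R).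
Hypothesis Pf : forall t : R, is_derive t 1 P (f t).
Hypothesis fD : forall t, `|f t| <= D.
Hypothesis ts0 : ts != [::].

Definition shift_average (t : R) := (\sum_(r <- ts) (P (t + r) - P t)) / (size ts)%:R.

Lemma shift_average_derive (t : R) : is_derive t 1 shift_average
  ((\sum_(r <- ts) f (t + r)) / (size ts)%:R - f t).
Proof.
have N0 : (size ts)%:R != 0 :> R by exact: size_neq0.
have h us : is_derive t 1 (fun t => \sum_(r <- us) (P (t + r) - P t))
    (\sum_(r <- us) (f (t + r) - f t)).
  elim: us => [|r us IH].
    by under eq_fun do rewrite big_nil; rewrite big_nil; exact: is_derive_cstf.
  under eq_fun do rewrite big_cons; rewrite big_cons.
  exact: (is_derive_addf (is_derive_subf (is_derive_shiftf (Pf (t + r))) (Pf t)) IH).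
apply: (is_derive_eq (is_derive_mulf (h ts) (is_derive_cstf (size ts)%:R^-1 t))).
rewrite mulr0 addr0 sumrB mulrBl; congr (_ - _).
by rewrite big_const_seq count_predT iter_addr_0 -[f t *+ _]mulr_natr mulfK.
Qed.

Lemma shift_average_bound (t : R) : `|shift_average t| <= D * \sum_(r <- ts) `|r|.
Proof.
have D0 : 0 <= D by exact: le_trans (fD 0).
have inc a b : a <= b -> `|P b - P a| <= D * (b - a).
  move=> ab; rewrite ler_norml; apply/andP; split.
    have : (fun t => - P t) b - (fun t => - P t) a <= D * b - D * a.
      apply: (@derive_le_le _ (fun t => - P t) (fun t => D * t)) => // x _.
      exists (- f x), D; split; [exact: is_derive_oppf|exact: is_derive_linf|].
      by have := fD x; rewrite ler_norml => /andP[]; lra.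
    by rewrite /=; lra.
  have : P b - P a <= D * b - D * a.
    apply: (@derive_le_le _ P (fun t => D * t)) => // x _.
    exists (f x), D; split; [exact: Pf|exact: is_derive_linf|].
    exact: le_trans (ler_norm _) (fD x).
  by lra.
have inc' r : `|P (t + r) - P t| <= D * `|r|.
  have [r0|r0] := leP 0 r.
    by have := @inc t (t + r); rewrite (ger0_norm r0) [t + r - t]addrAC subrr add0r; apply; lra.
  have := @inc (t + r) t; rewrite distrC (ltr0_norm r0) opprD addrA subrr add0r.
  by apply; lra.
have N0 : 0 < (size ts)%:R :> R by rewrite lt0r size_neq0//= ler0n.
rewrite /shift_average normrM normfV [X in _ / X]ger0_norm ?ler0n// ler_pdivrMr//.
apply: (@le_trans _ _ (D * \sum_(r <- ts) `|r|)).
  apply: le_trans (ler_norm_sum _ _ _) _; rewrite mulr_sumr.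
  by apply: ler_sum => r _; exact: inc'.
rewrite ler_peMr//; first by rewrite mulr_ge0// sumr_ge0.
by rewrite ler1n lt0n size_eq0.
Qed.
End shift_average.

Section attractor.
Context {R : realType} {T : pseudoPMetricType R} (s : R -> T -> T) (G : T -> R -> R).
Context (K : R) (e : T -> R) (Lam C : R).
Hypothesis adm : admissible s G K e Lam C.
Implicit Types (l t x : R) (w : T) (u v b : R -> R).

Let fl := adm_flow adm.
Let cT := adm_compact adm.
Let cG := adm_cont adm.
Let K1 := adm_K1 adm.
Let LG := adm_lip adm.
Let HC := adm_bounded adm.
Let K0 : 0 < K. Proof. exact: lt_le_trans ltr01 K1. Qed.

Local Notation sol := (solution s G).
Local Notation sub := (subsol s G).
Local Notation Gl l := (fun w x => G w x + l).
Local Notation ph := (phi fl LG K1 cT cG).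
Local Notation am l := (amax s (Gl l)).
Local Notation OB l := (OmegaB s (Gl l)).

Lemma phi_continuous_x l w t : continuous (fun x => ph l w x t).
Proof.
move=> x; apply: (@continuous_comp _ _ _ (fun x => (l, w, x)) (fun p : R * T * R => ph p.1.1 p.1.2 p.2 t)).
  apply: (@cvg_pair _ _ _ _ (nbhs (l, w)) (nbhs x)); [exact: cvg_cst|exact: cvg_id].
exact: phi_continuous.
Qed.

Lemma solution_through l w t0 y : exists v, sol l w v /\ v t0 = y.
Proof.
exists (fun t => ph l (s t0 w) y (t + - t0)); split; last by rewrite subrr phi0.
have := @solution_shift _ _ _ _ fl l (s t0 w) _ (- t0) (phi_solution fl LG K1 cT cG l (s t0 w) y).
by rewrite -fl.2.2 addNr fl.2.1.
Qed.

Lemma inB_phi l w x : l <= Lam -> (inB s (Gl l) w x <-> forall t, `|ph l w x t| <= C).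
Proof.
move=> ll; split=> [/inBE[u [u0 hu bu]] t|h].
  by rewrite -u0 (phi_unique fl LG K1 cT cG t hu); exact: (HC ll (solution_subsol hu) bu).
apply/inBE; exists (ph l w x); split; [exact: phi0|exact: phi_solution|by exists C].
Qed.

Lemma inB_shift l w u t : sol l w u -> bounded_orbit u -> inB s (Gl l) (s t w) (u t).
Proof.
move=> hu [M bu]; apply/inBE; exists (fun r => u (r + t)); split.
- by rewrite add0r.
- exact: solution_shift.
- by exists M.
Qed.

Lemma subsol_below_solution l w b : l <= Lam -> sub l w b -> bounded_orbit b ->
  exists u, [/\ sol l w u, bounded_orbit u & forall t, b t <= u t].
Proof.
move=> ll hb bb; have [tau [ht bt btau]] := adm_top adm w ll.
pose A := [set x | forall t, t <= 0 -> ph l w x t <= tau t].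
have phiP x : sol l w (ph l w x) by exact: phi_solution.
have below t0 v t : sol l w v -> v t0 <= b t0 -> t <= t0 -> v t <= b t.
  by move=> hv vb tt; apply: (comparison_back LG tt hb (solution_supersol hv)).
have Ab : A (b 0).
  move=> t t0; apply: le_trans (btau _ hb bb t).
  by apply: (below 0) => //; rewrite phi0.
have ubA : has_ubound A by exists (tau 0) => x /(_ 0 (lexx _)); rewrite phi0.
have cA : closed A.
  have -> : A = \bigcap_(t in [set t | t <= 0]) [set x | ph l w x t <= tau t].
    by apply/seteqP; split.
  apply: closed_bigI => t _.
  apply: (@closed_comp _ _ (fun x => ph l w x t) [set y | y <= tau t]); last exact: closed_le.
  by move=> x _; exact: phi_continuous_x.
have As : A (sup A).
  by apply: cA; apply: closure_sup => //; exists (b 0).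
pose u := ph l w (sup A); exists u.
have bu t : b t <= u t.
  rewrite leNgt; apply/negP => ubt.
  have b0 : b 0 <= u 0 by rewrite /u phi0; exact: ub_le_sup.
  have [t0|t0] := leP 0 t.
    by have := comparison LG t0 hb (solution_supersol (phiP (sup A))) b0; rewrite -/u; lra.
  have [v [hv vt]] := solution_through l w t (b t).
  have v0 : u 0 < v 0.
    apply: (@solution_lt _ _ _ _ _ LG l w _ _ t 0) => //; first exact: phiP.
    by rewrite vt.
  suff : v 0 <= sup A by move: v0; rewrite /u phi0; lra.
  apply: ub_le_sup => // r r0; rewrite (phi_unique fl LG K1 cT cG r hv).
  have [tr|/ltW rt] := leP t r.
    apply: (comparison LG tr (solution_subsol hv) ht).
    by rewrite vt; exact: btau.
  by apply: le_trans (btau _ hb bb r); apply: (below t) => //; rewrite vt.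
split => //; first exact: phiP.
have [M HM] := bb; have [M' HM'] := bt; exists (Num.max M M') => t.
have ut : u t <= tau t.
  have [t0|/ltW t0] := leP t 0; first exact: As.
  apply: (comparison LG t0 (solution_subsol (phiP _)) ht).
  by rewrite phi0; have := As 0 (lexx _); rewrite phi0.
have := HM t; have := HM' t; rewrite !ler_norml => /andP[h1 h2] /andP[h3 h4].
have := bu t; have m1 : M <= Num.max M M' by rewrite le_max lexx.
have m2 : M' <= Num.max M M' by rewrite le_max lexx orbT.
lra.
Qed.

Lemma inB_closed l w : l <= Lam -> closed [set x | inB s (Gl l) w x].
Proof.
move=> ll; have -> : [set x | inB s (Gl l) w x] =
    \bigcap_(t in [set: R]) [set x | `|ph l w x t| <= C].
  apply/seteqP; split=> [x /(inB_phi _ _ ll) h t _|x h]; first exact: h.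
  by apply/(inB_phi _ _ ll) => t; exact: h.
apply: closed_bigI => t _.
apply: (@closed_comp _ _ (fun x => `|ph l w x t|) [set y | y <= C]); last exact: closed_le.
by move=> x _; apply: cvg_norm; exact: phi_continuous_x.
Qed.

Lemma inB_le l w x : l <= Lam -> inB s (Gl l) w x -> `|x| <= C.
Proof. by move=> ll /(inB_phi _ _ ll)/(_ 0); rewrite phi0. Qed.

Let ubB l w : l <= Lam -> has_ubound [set x | inB s (Gl l) w x].
Proof. by move=> ll; exists C => x /(inB_le ll); rewrite ler_norml => /andP[]. Qed.

Lemma amax_in l w : l <= Lam -> OB l w -> inB s (Gl l) w (am l w).
Proof.
move=> ll ob; have cl := @inB_closed l w ll.
by apply: cl; apply: closure_sup; [exact: ob|exact: ubB].
Qed.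

Lemma amax_ge l w x : l <= Lam -> inB s (Gl l) w x -> x <= am l w.
Proof. by move=> ll h; apply: ub_le_sup => //; exact: ubB. Qed.

Lemma OmegaB_shift l w t : OB l w -> OB l (s t w).
Proof. by move=> [x /inBE[u [_ hu bu]]]; exists (u t); exact: inB_shift. Qed.

Lemma amax_solution l w : l <= Lam -> OB l w -> sol l w (fun t => am l (s t w)).
Proof.
move=> ll ob; have /inBE[u [u0 hu bu]] := amax_in ll ob.
suff -> : (fun t => am l (s t w)) = u by [].
apply/funext => t; apply/eqP; rewrite eq_le amax_ge ?andbT//; last exact: inB_shift.
have /inBE[v [v0 hv [M bv]]] := amax_in ll (OmegaB_shift t ob).
have hv' : sol l w (fun r => v (r + - t)).
  by have := solution_shift fl (- t) hv; rewrite -fl.2.2 addNr fl.2.1.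
have le0 : v (0 + - t) <= u 0.
  rewrite u0; apply: amax_ge => //; apply/inBE.
  by exists (fun r => v (r + - t)); split => //; exists M.
by have := solution_le LG t hv' hu le0; rewrite /= subrr v0.
Qed.

Lemma amax_bound l w : l <= Lam -> OB l w -> `|am l w| <= C.
Proof. by move=> ll ob; exact: inB_le (amax_in ll ob). Qed.

Lemma amax_bounded l w : l <= Lam -> OB l w -> bounded_orbit (fun t => am l (s t w)).
Proof. by move=> ll ob; exists C => t; apply: amax_bound => //; exact: OmegaB_shift. Qed.

Lemma subsol_le_amax l w b : l <= Lam -> sub l w b -> bounded_orbit b ->
  OB l w /\ forall t, b t <= am l (s t w).
Proof.
move=> ll hb bb; have [u [hu bu ub]] := subsol_below_solution ll hb bb.
split=> [|t]; first by exists (u 0); apply/inBE; exists u.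
by apply: le_trans (ub t) _; apply: amax_ge => //; exact: inB_shift.
Qed.

Lemma OmegaB_mono l l' : l <= l' -> l' <= Lam -> OB l `<=` OB l'.
Proof.
move=> ll l'L w [x /inBE[u [u0 hu bu]]].
by have [] := subsol_le_amax l'L (subsolW ll (solution_subsol hu)) bu.
Qed.

Lemma amax_gap l0 l w b : l0 < l -> l <= Lam -> sub l0 w b -> bounded_orbit b ->
  forall t, (l - l0) / K <= am l (s t w) - b t.
Proof.
move=> ll lL hb bb; have [ob bam] := subsol_le_amax lL (subsolW (ltW ll) hb) bb.
by apply: (gap_global LG K1 (ltW ll) hb) => //; apply: solution_supersol; exact: amax_solution.
Qed.

(* The concavity defect makes the ratio [(p3 - p2) / (p2 - p1)] decay at rate [mu / 2],
   up to the bounded factor coming from the corrector of [e]. *)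
Lemma ratio_decay l k1 k3 mu w p1 p2 p3 a c (h k : T -> R) :
  0 <= k1 -> 0 <= k3 -> a <= c ->
  (forall w t, is_derive t 1 (fun t => h (s t w)) (k (s t w))) ->
  (forall w, e w + k w <= mu / 2) ->
  sub (l - k1) w p1 -> sol l w p2 -> sub (l - k3) w p3 ->
  (forall t, a <= t <= c -> p1 t < p2 t) -> (forall t, a <= t <= c -> p2 t <= p3 t) ->
  (forall t, a <= t <= c ->
    mu * ((p3 t - p2 t) * (p2 t - p1 t)) <= k3 * (p2 t - p1 t) + k1 * (p3 t - p2 t)) ->
  (p3 c - p2 c) / (p2 c - p1 c) * expR (h (s c w)) * expR (mu / 2 * c) <=
  (p3 a - p2 a) / (p2 a - p1 a) * expR (h (s a w)) * expR (mu / 2 * a).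
Proof.
move=> k10 k30 ac hh hk hp1 hp2 hp3 lt12 le23 hmu.
apply: (@derive_le0_decr _ (fun t => (p3 t - p2 t) / (p2 t - p1 t) * expR (h (s t w)) * expR
  (mu / 2 * t))) => // t tac.
have [d1 hd1 dl1] := hp1 t; have [d3 hd3 dl3] := hp3 t; have hd2 := hp2 t.
set d2 := G (s t w) (p2 t) + l in hd2.
have z0 : 0 < p2 t - p1 t by rewrite subr_gt0 lt12.
have zn : p2 t - p1 t != 0 by rewrite gt_eqF.
eexists.
  exact: (is_derive_mulf (is_derive_mulf (is_derive_mulf (is_derive_subf hd3 hd2)
    (@is_derive_invf _ (fun t => p2 t - p1 t) _ _ zn (is_derive_subf hd2 hd1)))
    (is_derive_expf (hh w t))) (is_derive_expf (is_derive_linf (mu / 2) t))).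
set z := p2 t - p1 t in z0 zn *; set y := p3 t - p2 t.
set E := expR _; set E' := expR _; set kk := k _.
have E0 : 0 < E by exact: expR_gt0.
have E0' : 0 < E' by exact: expR_gt0.
have -> : (((d3 - d2) / z + y * (- (d2 - d1) / z ^+ 2)) * E + y / z * (E * kk)) * E' +
    y / z * E * (E' * (mu / 2)) =
  (((d3 - d2) * z - y * (d2 - d1)) + y * z * (kk + mu / 2)) * (E * E' / z ^+ 2) by field.
apply: mulr_le0_ge0; last by rewrite divr_ge0 ?mulr_ge0 ?exprn_ge0// ltW.
have y0 : 0 <= y by rewrite subr_ge0 le23.
have D := adm_defect adm (s t w) (ltW (lt12 t tac)) (le23 t tac).
have M := hmu t tac.
have hk' : y * z * (e (s t w) + kk) <= y * z * (mu / 2).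
  by rewrite ler_wpM2l ?mulr_ge0 ?(ltW z0)//; exact: hk.
have h3 : (d3 - d2) * z <= (G (s t w) (p3 t) - G (s t w) (p2 t) - k3) * z.
  by rewrite ler_wpM2r ?(ltW z0)// /d2; lra.
have h1 : y * (G (s t w) (p2 t) - G (s t w) (p1 t) + k1) <= y * (d2 - d1).
  by rewrite ler_wpM2l// /d2; lra.
rewrite -/y -/z in D M.
move: h3 h1 D M hk'; set g1 := G _ (p1 t); set g2 := G _ (p2 t); set g3 := G _ (p3 t).
set ee := e _; lra.
Qed.

Lemma decay l k1 k3 mu w p1 p2 p3 a c (h k : T -> R) B de Z :
  0 <= k1 -> 0 <= k3 -> a <= c -> (forall w, `|h w| <= B) ->
  (forall w t, is_derive t 1 (fun t => h (s t w)) (k (s t w))) ->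
  (forall w, e w + k w <= mu / 2) ->
  sub (l - k1) w p1 -> sol l w p2 -> sub (l - k3) w p3 ->
  (forall t, a <= t <= c -> p1 t < p2 t) -> (forall t, a <= t <= c -> p2 t <= p3 t) ->
  (forall t, a <= t <= c ->
    mu * ((p3 t - p2 t) * (p2 t - p1 t)) <= k3 * (p2 t - p1 t) + k1 * (p3 t - p2 t)) ->
  0 < de -> de <= p2 a - p1 a -> p2 c - p1 c <= Z ->
  p3 c - p2 c <= Z / de * expR (2 * B) * expR (- (mu / 2 * (c - a))) * (p3 a - p2 a).
Proof.
move=> k10 k30 ac hB hh hk hp1 hp2 hp3 lt12 le23 hmu de0 dea Zc.
have := ratio_decay k10 k30 ac hh hk hp1 hp2 hp3 lt12 le23 hmu.
have aac : a <= a <= c by rewrite lexx. have cac : a <= c <= c by rewrite lexx andbT.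
have zc0 : 0 < p2 c - p1 c by rewrite subr_gt0 lt12.
have ya0 : 0 <= p3 a - p2 a by rewrite subr_ge0 le23.
have yc0 : 0 <= p3 c - p2 c by rewrite subr_ge0 le23.
have := hB (s c w); have := hB (s a w); rewrite !ler_norml => /andP[_ ha] /andP[hc _].
set yc := p3 c - p2 c in yc0 *; set zc := p2 c - p1 c in zc0 Zc *.
set ya := p3 a - p2 a in ya0 *; set za := p2 a - p1 a in dea *.
have za0 : 0 < za by exact: lt_le_trans dea.
set hc' := h (s c w) in hc *; set ha' := h (s a w) in ha *.
move=> H.
have {H} : yc <= ya / za * zc * expR (ha' - hc' - mu / 2 * (c - a)).
  have -> : expR (ha' - hc' - mu / 2 * (c - a)) =
      expR ha' * expR (mu / 2 * a) / (expR hc' * expR (mu / 2 * c)).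
    by rewrite -!expRD -expRN -expRD; congr expR; ring.
  move: H; set E1 := expR ha'; set E2 := expR (mu / 2 * a); set E3 := expR hc'.
  set E4 := expR (mu / 2 * c) => H.
  rewrite mulrA ler_pdivlMr ?mulr_gt0 ?expR_gt0//.
  have := ler_wpM2l (ltW zc0) H.
  have -> : zc * (yc / zc * E3 * E4) = yc * (E3 * E4) by field; rewrite gt_eqF.
  by move=> /le_trans; apply; rewrite le_eqVlt; apply/orP; left; apply/eqP; ring.
move=> /le_trans; apply.
have -> : Z / de * expR (2 * B) * expR (- (mu / 2 * (c - a))) * ya =
  ya / de * Z * (expR (2 * B - mu / 2 * (c - a))) by rewrite expRD; ring.
apply: ler_pM; [|exact: expR_ge0| |by rewrite ler_expR; lra].
  by rewrite mulr_ge0 ?divr_ge0// ltW.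
apply: ler_pM => //; [by rewrite divr_ge0// ltW|exact: ltW|].
by rewrite ler_wpM2l// lef_pV2 ?posrE.
Qed.

Lemma exp_below (M ga de : R) : 0 <= M -> 0 < ga -> 0 < de ->
  exists t0, 0 <= t0 /\ forall t, t0 <= t -> M * expR (- (ga * t)) <= de.
Proof.
move=> M0 ga0 de0; exists (M / de / ga); split; first by rewrite !divr_ge0// ltW.
move=> t ht; rewrite expRN ler_pdivrMr ?expR_gt0//.
have h : M / de <= ga * t by rewrite [ga * t]mulrC -ler_pdivrMr.
have := expR_ge1Dx (ga * t) => h'.
have : de * (M / de) <= de * expR (ga * t) by rewrite ler_pM2l//; lra.
by rewrite mulrCA divff ?mulr1// gt_eqF.
Qed.

Lemma amax_unique l0 l w b u : l0 < l -> l <= Lam -> sub l0 w b -> bounded_orbit b ->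
  sol l w u -> bounded_orbit u -> (forall t, b t <= u t) -> u 0 = am l w.
Proof.
move=> ll lL hb bb hu bu bleu.
have ob : OB l w by exists (u 0); apply/inBE; exists u.
have l0L : l0 <= Lam by lra.
have gap := gap_global LG K1 (ltW ll) hb (solution_supersol hu) bleu.
have k0 : 0 < (l - l0) / K by rewrite divr_gt0// subr_gt0.
have C2 t : u t - b t <= 2 * C.
  have := HC lL (solution_subsol hu) bu t; have := HC l0L hb bb t.
  by rewrite !ler_norml => /andP[? ?] /andP[? ?]; lra.
have C0 : 0 < 2 * C by apply: lt_le_trans (C2 0); exact: lt_le_trans (gap 0).
pose mu := (l - l0) / (2 * C).
have mu0 : 0 < mu by rewrite divr_gt0// subr_gt0.
have mu20 : 0 < mu / 2 by rewrite divr_gt0.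
have [h [k [B [hB hh hk]]]] := adm_corrector adm mu20.
have ha := amax_solution lL ob.
have ua t : u t <= am l (s t w) by apply: amax_ge => //; exact: inB_shift.
apply/eqP; rewrite eq_le; have := ua 0; rewrite fl.2.1 => -> /=.
rewrite -subr_le0; apply: le_addgt0 => de de0; rewrite add0r.
pose de' := (l - l0) / K; pose M := 2 * C / de' * expR (2 * B) * (2 * C).
have M0 : 0 <= M.
  apply: mulr_ge0; last exact: ltW.
  by apply: mulr_ge0; [apply: divr_ge0; exact: ltW|exact: expR_ge0].
have [t0 [t00 ht0]] := exp_below M0 mu20 de0.
have t0' : - t0 <= 0 by lra.
have l00 : 0 <= l - l0 by rewrite subr_ge0 ltW.
have hb' : sub (l - (l - l0)) w b by rewrite opprB addrCA subrr addr0.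
have ha' : sub (l - 0) w (fun t => am l (s t w)) by rewrite subr0; exact: solution_subsol.
have := @decay l (l - l0) 0 mu w b u _ (- t0) 0 h k B de' (2 * C) l00 (lexx _) t0' hB hh hk
  hb' hu ha' (fun t _ => _) (fun t _ => ua t) (fun t _ => _) k0 (gap _) (C2 _).
rewrite sub0r opprK fl.2.1 => H; apply: le_trans (H _ _) _.
- by move=> t; rewrite -subr_gt0; exact: lt_le_trans (gap t).
- move=> t; rewrite mul0r add0r mulrCA [leRHS]mulrC; apply: ler_wpM2l; first by rewrite subr_ge0.
  by rewrite /mu mulrAC ler_pdivrMr// ler_wpM2l.
apply: le_trans (ht0 t0 (lexx _)); rewrite /M [leRHS]mulrAC; apply: ler_wpM2l.
  apply: mulr_ge0; last exact: expR_ge0.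
  by apply: mulr_ge0; [apply: divr_ge0; exact: ltW|exact: expR_ge0].
have := HC lL (solution_subsol hu) bu (- t0); have := amax_bound lL (OmegaB_shift (- t0) ob).
by rewrite !ler_norml => /andP[? ?] /andP[? ?]; lra.
Qed.

Lemma bounded_fibre_near (I : set R) l1 w1 : l1 <= Lam ->
  (forall x, inB s (Gl l1) w1 x -> \forall x' \near x, I x') ->
  \forall p \near (l1, w1), p.1 <= Lam -> forall x, inB s (Gl p.1) p.2 x -> I x.
Proof.
move=> l1L HI.
have /compact_near_coveringP cK := @segment_compact R (- C) C.
have H0 := cK (R * T)%type (nbhs (l1, w1))
  (fun p x => (forall t, `|ph p.1 p.2 x t| <= C) -> I x).
have cvt t x : continuous_at (x, (l1, w1)) (fun q : R * (R * T) => ph q.2.1 q.2.2 q.1 t).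
  apply: (@continuous_comp _ _ _ (fun q : R * (R * T) => (q.2.1, q.2.2, q.1))
    (fun p : R * T * R => ph p.1.1 p.1.2 p.2 t)); last exact: phi_continuous.
  apply: (@cvg_pair _ _ _ _ (nbhs (l1, w1)) (nbhs x)); last exact: cvg_fst.
  apply: (@cvg_pair _ _ _ _ (nbhs l1) (nbhs w1)).
    by apply: (@cvg_comp _ _ _ snd fst _ (nbhs (l1, w1))); [exact: cvg_snd|exact: cvg_fst].
  by apply: (@cvg_comp _ _ _ snd snd _ (nbhs (l1, w1))); [exact: cvg_snd|exact: cvg_snd].
have step x : `[- C, C]%classic x -> \forall x' \near x & p \near nbhs (l1, w1),
    (forall t, `|ph p.1 p.2 x' t| <= C) -> I x'.
  move=> _; have [h|/existsNP[t ht]] := pselect (forall t, `|ph l1 w1 x t| <= C).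
    have hx := HI x ((inB_phi w1 x l1L).2 h).
    have : \forall q \near (x, (l1, w1)), I q.1 by exact: (@cvg_fst _ _ _ _ _ _ hx).
    by apply: filterS => -[x' p].
  have : C < `|ph l1 w1 x t| by rewrite ltNge; apply/negP.
  move=> ht'; have : \forall q \near (x, (l1, w1)), C < `|ph q.2.1 q.2.2 q.1 t|.
    exact: (cvgr_gt _ (cvg_norm (cvt t x)) _ ht').
  by apply: filterS => -[x' p] /= h1 /(_ t); rewrite leNgt h1.
have H := H0 (nbhs_filter (l1, w1)) step; apply: filterS H => p H pL x hx; apply: H.
  by rewrite /= in_itv/= -ler_norml; exact: inB_le hx.
exact: (inB_phi _ _ pL).1.
Qed.

Lemma not_OmegaB_near l1 w1 : l1 <= Lam -> ~ OB l1 w1 ->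
  \forall p \near (l1, w1), p.1 <= Lam -> ~ OB p.1 p.2.
Proof.
move=> l1L nob; have := @bounded_fibre_near set0 l1 w1 l1L _.
move=> H; have {}H := H (fun x hx => False_ind _ (nob (ex_intro _ x hx))).
by apply: filterS H => p H pL [x hx]; exact: H pL x hx.
Qed.

Lemma amax_usc l1 w1 (ep : R) : l1 <= Lam -> OB l1 w1 -> 0 < ep ->
  \forall p \near (l1, w1), p.1 <= Lam -> OB p.1 p.2 -> am p.1 p.2 < am l1 w1 + ep.
Proof.
move=> l1L ob ep0; have := @bounded_fibre_near [set x | x < am l1 w1 + ep] l1 w1 l1L _.
move=> H; have {}H := H _; apply: filterS (H _) => [p {}H pL pob|x hx].
  exact: (H pL _ (amax_in pL pob)).
by apply: lt_nbhsl; have := amax_ge l1L hx; lra.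
Qed.

Lemma amax_near (S : set T) l0 l1 w1 (ep : R) : (forall w, S w -> OB l0 w) ->
  l0 < l1 -> l1 <= Lam -> S w1 -> 0 < ep ->
  \forall p \near (l1, w1), p.1 <= Lam -> l0 < p.1 -> S p.2 ->
    `|am p.1 p.2 - am l1 w1| < ep.
Proof.
move=> Sob l01 l1L Sw1 ep0.
have l0L : l0 <= Lam by lra.
have ob1 : OB l1 w1 by exact: (OmegaB_mono (ltW l01) l1L) (Sob _ Sw1).
have cQ := compact_setX (@segment_compact R (- C) C) (@segment_compact R (- C) C).
have /compact_near_coveringP cK := cQ.
pose good (p : R * T) (q : R * R) := [/\ (forall t, `|ph p.1 p.2 q.1 t| <= C),
  (forall t, `|ph l0 p.2 q.2 t| <= C) & (forall t, ph l0 p.2 q.2 t <= ph p.1 p.2 q.1 t)].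
have H0 := cK (R * T)%type (nbhs (l1, w1)) (fun p q => good p q -> `|q.1 - am l1 w1| < ep).
have c1 t q : continuous_at (q, (l1, w1)) (fun r : (R * R) * (R * T) => ph r.2.1 r.2.2 r.1.1 t).
  apply: (@continuous_comp _ _ _ (fun r : (R * R) * (R * T) => (r.2.1, r.2.2, r.1.1))
    (fun p : R * T * R => ph p.1.1 p.1.2 p.2 t)); last exact: phi_continuous.
  apply: (@cvg_pair _ _ _ _ (nbhs (l1, w1)) (nbhs q.1)).
    apply: (@cvg_pair _ _ _ _ (nbhs l1) (nbhs w1)).
      by apply: (@cvg_comp _ _ _ snd fst _ (nbhs (l1, w1))); [exact: cvg_snd|exact: cvg_fst].
    by apply: (@cvg_comp _ _ _ snd snd _ (nbhs (l1, w1))); [exact: cvg_snd|exact: cvg_snd].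
  by apply: (@cvg_comp _ _ _ fst fst _ (nbhs q)); [exact: cvg_fst|exact: cvg_fst].
have c2 t q : continuous_at (q, (l1, w1)) (fun r : (R * R) * (R * T) => ph l0 r.2.2 r.1.2 t).
  apply: (@continuous_comp _ _ _ (fun r : (R * R) * (R * T) => (l0, r.2.2, r.1.2))
    (fun p : R * T * R => ph p.1.1 p.1.2 p.2 t)); last exact: phi_continuous.
  apply: (@cvg_pair _ _ _ _ (nbhs (l0, w1)) (nbhs q.2)).
    apply: (@cvg_pair _ _ _ _ (nbhs l0) (nbhs w1)); first exact: cvg_cst.
    by apply: (@cvg_comp _ _ _ snd snd _ (nbhs (l1, w1))); [exact: cvg_snd|exact: cvg_snd].
  by apply: (@cvg_comp _ _ _ fst snd _ (nbhs q)); [exact: cvg_fst|exact: cvg_snd].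
have step q : (`[- C, C] `*` `[- C, C])%classic q ->
    \forall q' \near q & p \near nbhs (l1, w1), good p q' -> `|q'.1 - am l1 w1| < ep.
  move=> _; have [[g1 g2 g3]|ng] := pselect (good (l1, w1) q).
    have E : q.1 = am l1 w1.
      rewrite -(@amax_unique l0 l1 w1 (ph l0 w1 q.2) (ph l1 w1 q.1)) ?phi0//.
      - exact: solution_subsol (phi_solution _ _ _ _ _ _ _ _).
      - by exists C.
      - exact: phi_solution.
      - by exists C.
    have : \forall r \near (q, (l1, w1)), `|q.1 - r.1.1| < ep.
      have cv : (fun r : (R * R) * (R * T) => r.1.1) @ (q, (l1, w1)) --> q.1.
        by apply: (@cvg_comp _ _ _ fst fst _ (nbhs q)); [exact: cvg_fst|exact: cvg_fst].
      by move/cvgrPdist_lt: cv; apply.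
    by apply: filterS => -[q' p] /=; rewrite E distrC.
  have : (exists t, C < `|ph l1 w1 q.1 t|) \/ (exists t, C < `|ph l0 w1 q.2 t|) \/
      (exists t, ph l1 w1 q.1 t < ph l0 w1 q.2 t).
    apply: contrapT => /not_orP[/forallNP n1 /not_orP[/forallNP n2 /forallNP n3]].
    by apply: ng; split => t; rewrite leNgt; apply/negP; [exact: n1|exact: n2|exact: n3].
  move=> [[t ht]|[[t ht]|[t ht]]].
  - have : \forall r \near (q, (l1, w1)), C < `|ph r.2.1 r.2.2 r.1.1 t|.
      exact: (cvgr_gt _ (cvg_norm (c1 t q)) _ ht).
    by apply: filterS => -[q' p] /= h [/(_ t)]; rewrite leNgt h.
  - have : \forall r \near (q, (l1, w1)), C < `|ph l0 r.2.2 r.1.2 t|.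
      exact: (cvgr_gt _ (cvg_norm (c2 t q)) _ ht).
    by apply: filterS => -[q' p] /= h [_ /(_ t)]; rewrite leNgt h.
  - have ht' : 0 < ph l0 w1 q.2 t - ph l1 w1 q.1 t by rewrite subr_gt0.
    have : \forall r \near (q, (l1, w1)), 0 < ph l0 r.2.2 r.1.2 t - ph r.2.1 r.2.2 r.1.1 t.
      exact: (cvgr_gt _ (cvgB (c2 t q) (c1 t q)) _ ht').
    by apply: filterS => -[q' p] /= h [_ _ /(_ t)]; rewrite leNgt -subr_gt0 h.
have H := H0 (nbhs_filter (l1, w1)) step; apply: filterS H => p H pL l0p Sp.
have ob0 : OB l0 p.2 by exact: Sob.
have obp : OB p.1 p.2 by exact: (OmegaB_mono (ltW l0p) pL) ob0.
apply: (H (am p.1 p.2, am l0 p.2)).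
  by split; rewrite /= in_itv/= -ler_norml; exact: amax_bound.
have i1 := amax_in pL obp; have i2 := amax_in l0L ob0.
split=> t /=; [exact: (inB_phi _ _ pL).1|exact: (inB_phi _ _ l0L).1|].
have h0 := amax_solution l0L ob0; have h1 := amax_solution pL obp.
have := phi_unique fl LG K1 cT cG t h0; have := phi_unique fl LG K1 cT cG t h1.
rewrite /= fl.2.1 => -> ->.
have := amax_gap l0p pL (solution_subsol h0) (amax_bounded l0L ob0) t.
have : 0 < (p.1 - l0) / K by rewrite divr_gt0// subr_gt0.
lra.
Qed.

Lemma attraction l0 l : l0 < l -> l <= Lam -> exists ga B : R, [/\ 0 < ga, 0 < B &
  forall de w u a t, OB l0 w -> sol l w u -> 0 < de -> de <= (l - l0) / K ->
    de <= u a - am l0 (s a w) -> a <= t ->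
    `|u t - am l (s t w)| <= B / de * expR (- (ga * (t - a))) * `|u a - am l (s a w)|].
Proof.
move=> ll lL; have l0L : l0 <= Lam by lra.
pose Z := Num.max 1 (2 * C).
have Z0 : 0 < Z by rewrite lt_max ltr01.
have ZC : 2 * C <= Z by rewrite le_max lexx orbT.
have kap0 : 0 < l - l0 by rewrite subr_gt0.
pose mu := (l - l0) / Z; have mu0 : 0 < mu by rewrite divr_gt0.
have mu20 : 0 < mu / 2 by rewrite divr_gt0.
have [h [k [B [hB hh hk]]]] := adm_corrector adm mu20.
exists (mu / 2), (Z * expR (2 * B)); split => //; first by rewrite mulr_gt0// expR_gt0.
move=> de w u a t ob hu de0 deK dea at'.
have ob1 : OB l w by exact: (OmegaB_mono (ltW ll) lL).
have hb := amax_solution l0L ob; have ha := amax_solution lL ob1.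
have hb' : sub (l - (l - l0)) w (fun t => am l0 (s t w)).
  by rewrite opprB addrCA subrr addr0; exact: solution_subsol.
have ab2 r : am l (s r w) - am l0 (s r w) <= Z.
  apply: le_trans ZC.
  have := amax_bound lL (OmegaB_shift r ob1); have := amax_bound l0L (OmegaB_shift r ob).
  by rewrite !ler_norml => /andP[? ?] /andP[? ?]; lra.
have gap r := amax_gap ll lL (solution_subsol hb) (amax_bounded l0L ob) r.
have gapK r : 0 < am l (s r w) - am l0 (s r w).
  by apply: lt_le_trans (gap r); rewrite divr_gt0.
have muc y z : 0 <= y -> z <= Z -> mu * (y * z) <= 0 * z + (l - l0) * y.
  move=> y0 zZ; rewrite mul0r add0r mulrCA [leRHS]mulrC; apply: ler_wpM2l => //.
  by rewrite /mu mulrAC ler_pdivrMr// ler_wpM2l// ltW.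
have E X Y : Z * expR (2 * B) / de * X * Y = Z / de * expR (2 * B) * X * Y by ring.
rewrite E; have [ua|ua] := leP (u a) (am l (s a w)).
  have ua' r : u r <= am l (s r w) by exact: (solution_le LG r hu ha ua).
  have ub r : a <= r -> de <= u r - am l0 (s r w).
    move=> ar; exact: (gap_keep LG K1 (ltW ll) ar (solution_subsol hb) (solution_supersol hu) (ltW de0)).
  rewrite distrC [X in _ * X]distrC !ger0_norm ?subr_ge0//.
  apply: (@decay l (l - l0) 0 mu w (fun t => am l0 (s t w)) u (fun t => am l
    (s t w)) a t h k B de Z (ltW kap0) (lexx _) at' hB hh hk hb' hu) => //.
  - by rewrite subr0; exact: solution_subsol.
  - by move=> r /andP[ar _]; rewrite -subr_gt0; exact: lt_le_trans (ub r ar).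
  - move=> r /andP[ar _]; apply: muc; first by rewrite subr_ge0.
    by apply: le_trans (ab2 r); rewrite lerD2r.
  - by apply: le_trans (ab2 t); rewrite lerD2r.
have ua' r : am l (s r w) <= u r by exact: (solution_le LG r ha hu (ltW ua)).
rewrite !ger0_norm ?subr_ge0//.
apply: (@decay l (l - l0) 0 mu w (fun t => am l0 (s t w)) (fun t => am l (s t w)) u a t h k B de Z
  (ltW kap0) (lexx _) at' hB hh hk hb' ha) => //.
- by rewrite subr0; exact: solution_subsol.
- by move=> r _; rewrite -subr_gt0.
- by move=> r _; apply: muc => //; rewrite subr_ge0.
- exact: le_trans (gap a).
Qed.

Lemma crossing l0 l w v u : l0 < l -> l <= Lam -> OB l0 w -> sol l w v -> bounded_orbit v ->
  sol l w u -> v 0 < u 0 -> exists t, 0 <= t /\ am l0 (s t w) <= u t.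
Proof.
move=> ll lL ob hv bv hu vu; apply: contrapT => /forallNP N.
have l0L : l0 <= Lam by lra.
have ub t : 0 <= t -> u t < am l0 (s t w).
  by move=> t0; rewrite ltNge; apply/negP => h; apply: (N t).
have hb := amax_solution l0L ob.
pose Z := Num.max 1 (2 * C).
have Z0 : 0 < Z by rewrite lt_max ltr01.
have ZC : 2 * C <= Z by rewrite le_max lexx orbT.
have kap0 : 0 < l - l0 by rewrite subr_gt0.
pose mu := (l - l0) / Z; have mu0 : 0 < mu by rewrite divr_gt0.
have mu20 : 0 < mu / 2 by rewrite divr_gt0.
have [h [k [B [hB hh hk]]]] := adm_corrector adm mu20.
have vlu t : v t < u t by exact: (solution_lt LG t hv hu vu).
have bv2 t : am l0 (s t w) - v t <= Z.
  apply: le_trans ZC.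
  have := amax_bound l0L (OmegaB_shift t ob); have := HC lL (solution_subsol hv) bv t.
  by rewrite !ler_norml => /andP[? ?] /andP[? ?]; lra.
have de0 : 0 < u 0 - v 0 by rewrite subr_gt0.
have dec t : 0 <= t -> am l0 (s t w) - u t <=
    Z / (u 0 - v 0) * expR (2 * B) * Z * expR (- (mu / 2 * t)).
  move=> t0; have := @decay l 0 (l - l0) mu w v u (fun t => am l0 (s t w)) 0 t h k B (u 0 - v 0) Z
    (lexx _) (ltW kap0) t0 hB hh hk.
  rewrite !subr0 opprB addrCA subrr addr0 => H.
  apply: le_trans (H (solution_subsol hv) hu (solution_subsol hb) _ _ _ de0 (lexx _) _) _.
  - by move=> r _.
  - by move=> r /andP[r0 _]; exact: ltW (ub r r0).
  - move=> r /andP[r0 _]; rewrite mul0r addr0 mulrA; apply: ler_wpM2r.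
      by rewrite subr_ge0 ltW.
    rewrite /mu mulrAC ler_pdivrMr// ler_wpM2l ?(ltW kap0)//.
    by apply: le_trans (bv2 r); have := vlu r; lra.
  - by apply: le_trans (bv2 t); have := ub t t0; lra.
  rewrite [leRHS]mulrAC; apply: ler_wpM2l.
    apply: mulr_ge0; last exact: expR_ge0.
    by apply: mulr_ge0; [apply: divr_ge0; exact: ltW|exact: expR_ge0].
  by rewrite fl.2.1; have := bv2 0; rewrite fl.2.1; have := vlu 0; lra.
have M0 : 0 <= Z / (u 0 - v 0) * expR (2 * B) * Z.
  apply: mulr_ge0; last exact: ltW.
  by apply: mulr_ge0; [apply: divr_ge0; exact: ltW|exact: expR_ge0].
have ep0 : 0 < (l - l0) / (2 * K) by rewrite divr_gt0// mulr_gt0.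
have [t0 [t00 ht0]] := exp_below M0 mu20 ep0.
have small t : t0 <= t -> K * (am l0 (s t w) - u t) <= (l - l0) / 2.
  move=> tt; have t0' : 0 <= t by exact: le_trans tt.
  have h1 := le_trans (dec t t0') (ht0 t tt).
  have := ler_wpM2l (ltW K0) h1.
  have -> // : K * ((l - l0) / (2 * K)) = (l - l0) / 2 by field; rewrite gt_eqF.
pose r := 2 * Z / (l - l0) + 1.
have r0 : 0 <= r by rewrite addr_ge0// divr_ge0 ?mulr_ge0// ltW.
have : (am l0 (s (t0 + r) w) - u (t0 + r)) - (am l0 (s t0 w) - u t0) <=
    - ((l - l0) / 2) * (t0 + r) - - ((l - l0) / 2) * t0.
  apply: (@derive_le_le _ (fun t => am l0 (s t w) - u t) (fun t => - ((l - l0) / 2) * t)).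
    lra.
  move=> t /andP[tt _]; have t0' : 0 <= t by exact: le_trans tt.
  exists (G (s t w) (am l0 (s t w)) + l0 - (G (s t w) (u t) + l)), (- ((l - l0) / 2)).
  split; [exact: is_derive_subf|exact: is_derive_linf|].
  have := small t tt; have := lipschitz_le LG (s t w) (ltW (ub t t0')); lra.
have h1 : 0 < am l0 (s (t0 + r) w) - u (t0 + r) by rewrite subr_gt0 ub// addr_ge0.
have h2 : am l0 (s t0 w) - u t0 <= Z by apply: le_trans (bv2 t0); have := vlu t0; lra.
have h3 : (l - l0) / 2 * r = Z + (l - l0) / 2 by rewrite /r; field; rewrite gt_eqF.
lra.
Qed.

Lemma amax_basin l0 l w v u : l0 < l -> l <= Lam -> OB l0 w -> sol l w v -> bounded_orbit v ->
  sol l w u -> v 0 < u 0 ->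
  forall ep : R, 0 < ep -> exists t0, forall t, t0 <= t -> `|u t - am l (s t w)| <= ep.
Proof.
move=> ll lL ob hv bv hu vu ep ep0.
have l0L : l0 <= Lam by lra.
have [t1 [t10 bt1]] := crossing ll lL ob hv bv hu vu.
have hb := amax_solution l0L ob.
pose t2 := t1 + 1; have t12 : t1 < t2 by rewrite /t2; lra.
have bt2 := gap_strict LG K1 ll t12 (solution_subsol hb) (solution_supersol hu) bt1.
have [ga [B [ga0 B0 H]]] := attraction ll lL.
pose de := Num.min (u t2 - am l0 (s t2 w)) ((l - l0) / K).
have de0 : 0 < de by rewrite lt_min subr_gt0 bt2 divr_gt0// subr_gt0.
have M0 : 0 <= B / de * `|u t2 - am l (s t2 w)|.
  by rewrite mulr_ge0// divr_ge0// ltW.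
have [t0 [t00 ht0]] := exp_below M0 ga0 ep0.
exists (t2 + t0) => t tt; apply: le_trans (H de w u t2 t ob hu de0 _ _ _) _.
- by rewrite ge_min lexx orbT.
- by rewrite ge_min lexx.
- lra.
- by rewrite mulrAC; apply: ht0; lra.
Qed.

Definition midgap w (x y : R) := 2 * G w ((x + y) / 2) - G w x - G w y.

Lemma concave_key w (x b y : R) : x <= b -> b <= y -> x < y ->
  (b - x) * (y - b) * (Num.max 0 (midgap w x y) / (y - x) - 2 * e w) <=
  G w b * (y - x) - (y - b) * G w x - (b - x) * G w y.
Proof.
move=> xb by' xy; pose m := (x + y) / 2; pose D := midgap w x y.
have e0 := adm_e0 adm w.
have Y0 : 0 < y - x by rewrite subr_gt0.
have p0 : 0 <= b - x by rewrite subr_ge0.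
have q0 : 0 <= y - b by rewrite subr_ge0.
have xm : x <= m by rewrite /m; lra.
have my : m <= y by rewrite /m; lra.
have Dge : - (e w * (y - x) / 2) <= D.
  have := adm_defect adm w xm my.
  have -> : y - m = (y - x) / 2 by rewrite /m; lra.
  have -> : m - x = (y - x) / 2 by rewrite /m; lra.
  rewrite /D /midgap -/m => h.
  have : 0 <= (y - x) / 2 * (2 * G w m - G w x - G w y + e w * (y - x) / 2) by lra.
  by rewrite pmulr_rge0 ?divr_gt0//; lra.
have Dp : Num.max 0 D <= D + e w * (y - x) / 2.
  rewrite ge_max; apply/andP; split; [lra|].
  have : 0 <= e w * (y - x) by rewrite mulr_ge0// ltW.
  lra.
have DpY : 0 <= Num.max 0 D by rewrite le_max lexx.
have pqY : (b - x) * (y - b) * (Num.max 0 D / (y - x)) =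
    Num.max 0 D * ((b - x) * (y - b) / (y - x)) by field; rewrite gt_eqF.
rewrite -/D mulrBr pqY.
have [bm|mb] := leP b m.
  have := adm_defect adm w xb bm; set gm := G w m; set gb := G w b; set gx := G w x => h.
  have -> : G w y = 2 * gm - gx - D by rewrite /D /midgap -/m /gm /gx; ring.
  have qY : (b - x) * (y - b) / (y - x) <= b - x.
    by rewrite ler_pdivrMr// ler_wpM2l//; lra.
  have h1 := ler_wpM2l DpY qY.
  have h2 := ler_wpM2r p0 Dp.
  have mE : m = (x + y) / 2 by [].
  have h3 : 0 <= e w * ((b - x) * (y - b - (y - x) / 2)).
    by apply: mulr_ge0 => //; apply: mulr_ge0 => //; move: bm; rewrite mE; lra.
  have h4 : 0 <= e w * ((b - x) * (b - x)) by rewrite !mulr_ge0.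
  rewrite mE in h; move: h h1 h2 h3 h4; set DD := Num.max 0 D; set qq := (_ / (y - x)); lra.
have mb' := ltW mb.
have := adm_defect adm w mb' by'; set gm := G w m; set gb := G w b; set gy := G w y => h.
have -> : G w x = 2 * gm - gy - D by rewrite /D /midgap -/m /gm /gy; ring.
have qY : (b - x) * (y - b) / (y - x) <= y - b.
  by rewrite ler_pdivrMr// mulrC ler_wpM2l//; lra.
have h1 := ler_wpM2l DpY qY.
have h2 := ler_wpM2r q0 Dp.
have mE : m = (x + y) / 2 by [].
have h3 : 0 <= e w * ((y - b) * (b - x - (y - x) / 2)).
  by apply: mulr_ge0 => //; apply: mulr_ge0 => //; move: mb; rewrite mE; lra.
have h4 : 0 <= e w * ((y - b) * (y - b)) by rewrite !mulr_ge0.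
rewrite mE in h; move: h h1 h2 h3 h4; set DD := Num.max 0 D; set qq := (_ / (y - x)); lra.
Qed.

Definition separated l w (de : R) (q : R * R) := forall t,
  [/\ `|ph l w q.1 t| <= C, `|ph l w q.2 t| <= C & de <= ph l w q.2 t - ph l w q.1 t].

Lemma uniform_midgap (S : set T) l de : closed S ->
  (forall w q, S w -> separated l w de q ->
    exists t, 0 < midgap (s t w) (ph l w q.1 t) (ph l w q.2 t)) ->
  exists ts (be : R), [/\ ts != [::], 0 < be & forall w q, S w -> separated l w de q ->
    exists2 t, t \in ts & be <= midgap (s t w) (ph l w q.1 t) (ph l w q.2 t)].
Proof.
move=> cS HN.
pose X := (T * (R * R))%type.
have cS' : compact S by apply: subclosed_compact cT _.
have cQ := compact_setX cS' (compact_setX (@segment_compact R (- C) C) (@segment_compact R (- C) C)).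
have /compact_near_coveringP cK := cQ.
pose F : set_system (seq R * R) := [set A | exists (ts0 : seq R) (b0 : R), 0 < b0 /\
  forall (ts : seq R) (b : R), {subset ts0 <= ts} -> 0 < b -> b <= b0 -> A (ts, b)].
have FF : Filter F.
  split.
  - by exists [::], 1; split => //.
  - move=> A B [ts [b [b0 HA]]] [ts' [b' [b'0 HB]]]; exists (ts ++ ts'), (Num.min b b').
    split=> [|us c sub' c0]; first by rewrite lt_min b0.
    rewrite le_min => /andP[cb cb']; split; [apply: HA|apply: HB] => // t ht;
      by apply: sub'; rewrite mem_cat ht ?orbT.
  - move=> A B AB [ts [b [b0 HA]]]; exists ts, b; split => // us c h1 h2 h3.
    by apply: AB; exact: HA.
have phc (f : X -> R) t : continuous f -> continuous (fun q : X => ph l q.1 (f q) t).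
  move=> cf q; apply: (@continuous_comp _ _ _ (fun q : X => (l, q.1, f q))
    (fun p : R * T * R => ph p.1.1 p.1.2 p.2 t)); last exact: phi_continuous.
  apply: (@cvg_pair _ _ _ _ (nbhs (l, q.1)) (nbhs (f q))); last exact: cf.
  by apply: (@cvg_pair _ _ _ _ (nbhs l) (nbhs q.1)); [exact: cvg_cst|exact: cvg_fst].
have cx : continuous (fun q : X => q.2.1).
  by move=> q; apply: (@cvg_comp _ _ _ snd fst _ (nbhs q.2)); [exact: cvg_snd|exact: cvg_fst].
have cy : continuous (fun q : X => q.2.2).
  by move=> q; apply: (@cvg_comp _ _ _ snd snd _ (nbhs q.2)); [exact: cvg_snd|exact: cvg_snd].
have px t := phc _ t cx; have py t := phc _ t cy.
pose mg t (q : X) := midgap (s t q.1) (ph l q.1 q.2.1 t) (ph l q.1 q.2.2 t).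
have cst' t : continuous (fun q : X => s t q.1).
  by move=> q; apply: (@cvg_comp _ _ _ fst (s t) _ (nbhs q.1)); [exact: cvg_fst|exact: flow_continuous].
have cmg t : continuous (mg t).
  apply: continuous_subf; [apply: continuous_subf|].
  - apply: continuous_mulf; first exact: continuous_cstf.
    apply: (@continuous_comp2 _ _ _ _ G (fun q : X => s t q.1)) => //.
    apply: continuous_mulf; last exact: continuous_cstf.
    by apply: continuous_addf; [exact: px|exact: py].
  - by apply: (@continuous_comp2 _ _ _ _ G (fun q : X => s t q.1)) => //; exact: px.
  - by apply: (@continuous_comp2 _ _ _ _ G (fun q : X => s t q.1)) => //; exact: py.
pose P (i : seq R * R) (q : X) := S q.1 -> separated l q.1 de q.2 ->
  exists2 t, t \in i.1 & i.2 <= mg t q.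
have step q : (S `*` (`[- C, C] `*` `[- C, C]))%classic q ->
    \forall q' \near q & i \near F, P i q'.
  move=> [Sq _].
  have prodn (A : set X) (B : set (seq R * R)) : nbhs q A -> F B ->
      (forall q' i, A q' -> B i -> P i q') -> \forall q' \near q & i \near F, P i q'.
    by move=> nA FB H; exists (A, B) => // -[q' i] [] /=; exact: H.
  have vac (A : set X) : nbhs q A -> (forall q', A q' -> ~ separated l q'.1 de q'.2) ->
      \forall q' \near q & i \near F, P i q'.
    move=> nA H; apply: (prodn A setT nA); first by exists [::], 1.
    by move=> q' i Aq _ _ /(H _ Aq).
  have [sep|/existsNP[t nsep]] := pselect (separated l q.1 de q.2).
    have [t ht] := HN q.1 q.2 Sq sep.
    have ht2 : mg t q / 2 < mg t q by move: ht; rewrite -/(mg t q); lra.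
    refine (prodn [set q' : X | mg t q / 2 < mg t q']
      [set i : seq R * R | (t \in i.1) /\ (i.2 <= mg t q / 2)] _ _ _).
    - exact: (cvgr_gt _ (cmg t q) _ ht2).
    - exists [:: t], (mg t q / 2); split=> [|us c h1 h2 h3]; first by move: ht; rewrite -/(mg t q); lra.
      by split => //; apply: h1; rewrite mem_head.
    - by move=> q' i /= h1 [h2 h3] _ _; exists t => //; lra.
  have : C < `|ph l q.1 q.2.1 t| \/ C < `|ph l q.1 q.2.2 t| \/
      ph l q.1 q.2.2 t - ph l q.1 q.2.1 t < de.
    apply: contrapT => /not_orP[/negP n1 /not_orP[/negP n2 /negP n3]].
    by apply: nsep; split; rewrite leNgt.
  move=> [h|[h|h]].
  - apply: (vac [set q' : X | C < `|ph l q'.1 q'.2.1 t|]).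
      exact: (cvgr_gt _ (cvg_norm (px t q)) _ h).
    by move=> q' /= h' /(_ t)[]; rewrite leNgt h'.
  - apply: (vac [set q' : X | C < `|ph l q'.1 q'.2.2 t|]).
      exact: (cvgr_gt _ (cvg_norm (py t q)) _ h).
    by move=> q' /= h' /(_ t)[_]; rewrite leNgt h'.
  - apply: (vac [set q' : X | ph l q'.1 q'.2.2 t - ph l q'.1 q'.2.1 t < de]).
      exact: (cvgr_lt _ (cvgB (py t q) (px t q)) _ h).
    by move=> q' /= h' /(_ t)[_ _]; rewrite leNgt h'.
have [ts0 [b0 [b00 H]]] := cK _ F P FF step.
exists (0 :: ts0), b0; split => // w q Sw sep.
have sub' : {subset ts0 <= 0 :: ts0} by move=> t ht; rewrite inE ht orbT.
apply: (H _ _ sub' b00 (lexx _) (w, q)) => //.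
have [] := sep 0; rewrite !phi0 => h1 h2 _.
by split => //; split; rewrite /= in_itv/= -ler_norml.
Qed.

Lemma separated_persists (S : set T) l de : closed S -> (forall t w, S w -> S (s t w)) ->
  l <= Lam -> 0 < de ->
  (forall w, S w -> exists q, separated l w de q) ->
  (forall w q, S w -> separated l w de q ->
    exists t, 0 < midgap (s t w) (ph l w q.1 t) (ph l w q.2 t)) ->
  exists2 ep : R, 0 < ep & forall w, S w -> OB (l - ep) w.
Proof.
move=> cS Sinv lL de0 Sq HN; have [ts [be [ts0 be0 Hbe]]] := uniform_midgap cS HN.
pose n : R := (size ts)%:R.
have n0 : 0 < n by rewrite lt0r size_neq0//= ler0n.
pose Z := Num.max 1 (2 * C).
have Z0 : 0 < Z by rewrite lt_max ltr01.
have ZC : 2 * C <= Z by rewrite le_max lexx orbT.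
pose ep1 := be / n / Z / 2.
have ep10 : 0 < ep1 by rewrite !divr_gt0.
have eta0 : 0 < ep1 / 2 by rewrite divr_gt0.
have [h [k [B [hB hh hk]]]] := adm_corrector adm eta0.
pose Bw := K * Z * (\sum_(r <- ts) `|r|) / Z + 2 * B.
pose ep := de * ep1 * (expR (- (2 * Bw)) / 4).
have ep0 : 0 < ep by rewrite !mulr_gt0// ?invr_gt0 ?expR_gt0//.
exists ep => // w Sw; have [q sep] := Sq w Sw.
pose u := ph l w q.1; pose v := ph l w q.2.
have hu : sol l w u by exact: phi_solution.
have hv : sol l w v by exact: phi_solution.
have cu : continuous u by move=> t; exact: is_derive_continuous (hu t).
have cv : continuous v by move=> t; exact: is_derive_continuous (hv t).
have uv t : de <= v t - u t by case: (sep t).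
have uvZ t : v t - u t <= Z.
  by apply: le_trans ZC; case: (sep t); rewrite !ler_norml => /andP[? ?] /andP[? ?] _; rewrite /u /v; lra.
pose D t := Num.max 0 (midgap (s t w) (u t) (v t)).
have cw : continuous (fun t => s t w).
  apply: (@continuous_comp2 _ _ _ _ s id (fun=> w)); first by case: fl.
    by move=> t; exact: cvg_id.
  by move=> t; exact: cvg_cst.
have cD : continuous D.
  apply: continuous_maxf; first exact: continuous_cstf.
  apply: continuous_subf; [apply: continuous_subf|].
  - apply: continuous_mulf; first exact: continuous_cstf.
    apply: (@continuous_comp2 _ _ _ _ G (fun t => s t w)) => //.
    by apply: continuous_mulf; [exact: continuous_addf|exact: continuous_cstf].
  - exact: (@continuous_comp2 _ _ _ _ G (fun t => s t w)).
  - exact: (@continuous_comp2 _ _ _ _ G (fun t => s t w)).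
have D0 t : 0 <= D t by rewrite le_max lexx.
have DZ t : `|D t| <= K * Z.
  rewrite ger0_norm// /D ge_max mulr_ge0 ?(ltW K0) ?(ltW Z0)//= /midgap.
  have um : u t <= (u t + v t) / 2 by have := uv t; lra.
  have mv : (u t + v t) / 2 <= v t by have := uv t; lra.
  have h1 := lipschitz_le LG (s t w) um; have h2 := lipschitz_ge LG (s t w) mv.
  have := ler_wpM2l (ltW K0) (uvZ t).
  move: h1 h2; set gm := G _ (_ / 2); lra.
have [P [_ hP]] := primitive_exists cD.
pose wD := shift_average P ts.
have dwD t := shift_average_derive hP ts0 t.
have bwD t := shift_average_bound hP DZ ts0 t.
pose W t := - wD t / Z + 2 * h (s t w).
have WB t : `|W t| <= Bw.
  apply: le_trans (ler_normD _ _) _; apply: lerD.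
    rewrite normrM normrN normfV (ger0_norm (ltW Z0)) ler_pM2r ?invr_gt0//.
  by rewrite normrM ger0_norm// ler_pM2l.
have avg_be t : be / n <= (\sum_(r <- ts) D (t + r)) / n.
  rewrite ler_pM2r ?invr_gt0//.
  pose q' := (u t, v t).
  have hu' : sol l (s t w) (fun r => u (r + t)) by exact: solution_shift.
  have hv' : sol l (s t w) (fun r => v (r + t)) by exact: solution_shift.
  have pu r : ph l (s t w) q'.1 r = u (r + t).
    by have := phi_unique fl LG K1 cT cG r hu'; rewrite add0r.
  have pv r : ph l (s t w) q'.2 r = v (r + t).
    by have := phi_unique fl LG K1 cT cG r hv'; rewrite add0r.
  have sep' : separated l (s t w) de q'.
    by move=> r; rewrite pu pv; exact: sep.
  have [r rts hr] := Hbe _ q' (Sinv t w Sw) sep'.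
  rewrite pu pv -fl.2.2 in hr.
  rewrite (big_rem r)//= -[leLHS]addr0; apply: lerD; last exact: sumr_ge0.
  by apply: le_trans hr _; rewrite addrC /D le_max lexx orbT.
pose th t := (1 + expR (- W t))^-1.
have th0 t : 0 < th t by rewrite invr_gt0 addr_gt0 ?expR_gt0.
have thE t : 1 - th t = th t * expR (- W t).
  have h1 : 1 + expR (- W t) != 0 by rewrite gt_eqF// addr_gt0 ?expR_gt0.
  by rewrite /th; field.
have th1 t : th t < 1.
  have := thE t; have : 0 < th t * expR (- W t) by rewrite mulr_gt0 ?expR_gt0.
  lra.
have thB t : expR (- (2 * Bw)) / 4 <= th t * (1 - th t).
  have := WB t; rewrite ler_norml => /andP[w1 w2].
  have hh1 : expR (- Bw) <= expR (- W t) by rewrite ler_expR; lra.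
  have hh2 : expR (- W t) <= expR Bw by rewrite ler_expR; lra.
  have hh3 : 1 <= expR Bw by rewrite -expR0 ler_expR; lra.
  have th2 : expR (- Bw) / 2 <= th t.
    rewrite expRN -invfM lef_pV2 ?posrE ?mulr_gt0 ?addr_gt0 ?expR_gt0//; lra.
  rewrite thE mulrA.
  have -> : expR (- (2 * Bw)) / 4 = (expR (- Bw) / 2) * (expR (- Bw) / 2).
    have -> : - (2 * Bw) = - Bw + - Bw by ring.
    by rewrite expRD; field.
  have -> : th t * th t * expR (- W t) = th t * (1 - th t) by rewrite thE mulrA.
  apply: ler_pM => //; try by rewrite divr_ge0// expR_ge0.
  have -> : 1 - th t = (1 + expR (W t))^-1.
    rewrite thE /th expRN.
    have e1 : expR (W t) != 0 by rewrite gt_eqF// expR_gt0.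
    have e2 : 1 + expR (W t) != 0 by rewrite gt_eqF// addr_gt0 ?expR_gt0.
    have e3 : expR (W t) + 1 != 0 by rewrite addrC.
    by field; rewrite e1 e2.
  have hh4 : expR (W t) <= expR Bw by rewrite ler_expR; lra.
  by rewrite expRN -invfM lef_pV2 ?posrE ?mulr_gt0 ?addr_gt0 ?expR_gt0//; lra.
pose b t := u t + th t * (v t - u t).
suff hb : sub (l - ep) w b.
  have lep : l - ep <= Lam by lra.
  apply: (subsol_le_amax lep hb _).1; exists (C + Z) => t; rewrite /b.
  apply: le_trans (ler_normD _ _) _; apply: lerD; first by case: (sep t).
  rewrite normrM (ger0_norm (ltW (th0 t))) ger0_norm; last by have := uv t; lra.
  by have := ler_pM (ltW (th0 t)) _ (ltW (th1 t)) (uvZ t); rewrite mul1r; apply; have := uv t; lra.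
move=> t; pose dW := - ((\sum_(r <- ts) D (t + r)) / n - D t) / Z + 2 * k (s t w).
have hW : is_derive t 1 W dW.
  have h1 := is_derive_mulf (is_derive_oppf (dwD t)) (is_derive_cstf Z^-1 t).
  have h2 := is_derive_scalef 2 (hh w t).
  by apply: (is_derive_eq (is_derive_addf h1 h2)); rewrite mulr0 addr0.
have hth : is_derive t 1 th (th t * (1 - th t) * dW).
  have nz : 1 + expR (- W t) != 0 by rewrite gt_eqF// addr_gt0 ?expR_gt0.
  have h1 := is_derive_addf (is_derive_cstf 1 t) (is_derive_expf (is_derive_oppf hW)).
  apply: (is_derive_eq (@is_derive_invf _ (fun t => 1 + expR (- W t)) _ _ nz h1)).
  by rewrite thE /th; field.
exists ((G (s t w) (u t) + l) + (th t * (1 - th t) * dW * (v t - u t) +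
    th t * ((G (s t w) (v t) + l) - (G (s t w) (u t) + l)))).
  exact: (is_derive_addf (hu t) (is_derive_mulf hth (is_derive_subf (hv t) (hu t)))).
have Y0 : 0 < v t - u t by exact: lt_le_trans (uv t).
have ub : u t <= b t by rewrite /b lerDl mulr_ge0// ltW.
have bv : b t <= v t.
  rewrite /b -lerBrDl -[leRHS]mul1r ler_pM2r//; exact: ltW.
have uv' : u t < v t by rewrite -subr_gt0.
have key := concave_key (s t w) ub bv uv'.
have bu : b t - u t = th t * (v t - u t) by rewrite /b; ring.
have vb : v t - b t = (1 - th t) * (v t - u t) by rewrite /b; ring.
rewrite bu vb -/(D t) in key.
have dWle : dW <= D t / (v t - u t) - 2 * e (s t w) - ep1.
  have h1 : D t / Z <= D t / (v t - u t).
    by rewrite ler_wpM2l// lef_pV2 ?posrE.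
  have h2 : be / n / Z <= (\sum_(r <- ts) D (t + r)) / n / Z.
    by rewrite ler_pM2r ?invr_gt0.
  have h3 := hk (s t w).
  have -> : dW = D t / Z - (\sum_(r <- ts) D (t + r)) / n / Z + 2 * k (s t w) by rewrite /dW; ring.
  have : be / n / Z = 2 * ep1 by rewrite /ep1; field; rewrite !gt_eqF.
  lra.
have tt0 : 0 <= th t * (1 - th t) by rewrite mulr_ge0 ?subr_ge0// ltW.
have Yn : v t - u t != 0 by rewrite gt_eqF.
have key2 : th t * (1 - th t) * (v t - u t) * (D t / (v t - u t) - 2 * e (s t w)) <=
    G (s t w) (b t) - (1 - th t) * G (s t w) (u t) - th t * G (s t w) (v t).
  rewrite -(ler_pM2r Y0); apply: le_trans (le_trans key _); rewrite le_eqVlt; apply/orP; left; apply/eqP; ring.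
have key3 : th t * (1 - th t) * (v t - u t) * dW <=
    th t * (1 - th t) * (v t - u t) * (D t / (v t - u t) - 2 * e (s t w) - ep1).
  by rewrite ler_wpM2l// mulr_ge0// ltW.
have key4 : ep <= th t * (1 - th t) * (v t - u t) * ep1.
  rewrite /ep.
  have := ler_pM (divr_ge0 (expR_ge0 (- (2 * Bw))) (ler0n R 4)) (ltW de0) (thB t) (uv t).
  by move=> /(ler_wpM2r (ltW ep10)); lra.
move: key2 key3 key4; set gb := G _ (b t); set gu := G _ (u t); set gv := G _ (v t).
set dd := D t / _; set ee := e _; set YY := v t - u t; set th' := th t; set EP := ep; lra.
Qed.
End attractor.

Lemma primitive_unique {R : realType} (P Q f : R -> R) (a : R) :
  (forall t : R, is_derive t 1 P (f t)) -> (forall t : R, is_derive t 1 Q (f t)) ->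
  forall t, P t - P a = Q t - Q a.
Proof.
move=> hP hQ t; suff : P t - Q t = P a - Q a by lra.
apply: (@is_derive_0_is_cst _ (fun t => P t - Q t)) => x.
by apply: (is_derive_eq (is_derive_subf (hP x) (hQ x))); rewrite subrr.
Qed.

(** * The concave-linear family *)

Section correctors.
Context {R : realType} {T : pseudoPMetricType R} (s : R -> T -> T).
Hypotheses (fl : is_flow s) (cT : compact [set: T]).

Lemma orbit_continuous w : continuous (fun t => s t w).
Proof.
apply: (@continuous_comp2 _ _ _ _ s id (fun=> w)); first by case: fl.
  by move=> t; exact: cvg_id.
by move=> t; exact: cvg_cst.
Qed.

Lemma corrector_exists (f : T -> R) (eta : R) ts : continuous f -> ts != [::] ->
  (forall w, avg s f ts w <= eta) ->
  exists (h k : T -> R) (B : R), [/\ forall w, `|h w| <= B,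
    forall w (t : R), is_derive t 1 (fun t => h (s t w)) (k (s t w)),
    forall w, f w + k w <= eta & forall w, `|f w + k w| <= B].
Proof.
move=> cf ts0 Hts.
have [D [D0 HD]] := continuous_bounded cT cf.
have cfw w : continuous (fun t => f (s t w)).
  by move=> t; apply: continuous_comp; [exact: orbit_continuous|exact: cf].
have /choice[P HP] : forall w, exists P : R -> R, forall t : R, is_derive t 1 P (f (s t w)).
  by move=> w; have [P [_ hP]] := primitive_exists (cfw w); exists P.
pose h w := shift_average (P w) ts 0.
have hE w t : h (s t w) = shift_average (P w) ts t.
  rewrite /h /shift_average; congr (_ / _); apply: eq_bigr => r _.
  have hQ (x : R) : is_derive x 1 (fun x => P w (x + t)) (f (s x (s t w))).
    by apply: is_derive_shiftf; rewrite -fl.2.2; exact: HP.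
  have := @primitive_unique _ _ _ _ 0 (HP (s t w)) hQ (0 + r).
  by rewrite !add0r [r + t]addrC.
pose B := D * \sum_(r <- ts) `|r| + D.
have S0 : 0 <= \sum_(r <- ts) `|r| :> R by exact: sumr_ge0.
exists h, (fun w => avg s f ts w - f w), B; split.
- move=> w; apply: le_trans (shift_average_bound (HP w) (fun t => HD (s t w)) ts0 0) _.
  by rewrite lerDl ltW.
- move=> w t; have -> : (fun t => h (s t w)) = shift_average (P w) ts by apply/funext => x; exact: hE.
  apply: (is_derive_eq (shift_average_derive (HP w) ts0 t)).
  by congr (_ / _ - _); apply: eq_bigr => r _; rewrite addrC fl.2.2.
- by move=> w; rewrite addrC subrK.
- move=> w; rewrite addrC subrK; apply: (@le_trans _ _ D); last by rewrite lerDr mulr_ge0// ltW.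
  rewrite ler_norml -(avg_cst s (- D) w ts0) -{2}(avg_cst s D w ts0).
  by apply/andP; split; apply: le_avg => t; have := HD (s t w); rewrite ler_norml => /andP[].
Qed.
End correctors.

Section compact_sup.
Context {R : realType} {X Y : topologicalType} (K : set X) (h : X -> Y -> R).
Hypotheses (cK : compact K) (K0 : K !=set0).
Hypothesis ch : continuous (fun q : X * Y => h q.1 q.2).

Definition fibre_sup y := sup [set h x y | x in K].

Let cslice y : continuous (h^~ y).
Proof.
by apply: (@continuous_comp2 _ _ _ _ h id (fun=> y)) => // x; [exact: cvg_id|exact: cvg_cst].
Qed.

Let hsup y : has_sup [set h x y | x in K].
Proof.
split; first by case: K0 => x Kx; exists (h x y), x.
have [C HC] := continuous_bounded_above cK (@cslice y).
by exists C => _ [x Kx <-]; exact: HC.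
Qed.

Lemma fibre_sup_ge x y : K x -> h x y <= fibre_sup y.
Proof. by move=> Kx; apply: ub_le_sup; [case: (hsup y)|exists x]. Qed.

Lemma fibre_sup_le y c : (forall x, K x -> h x y <= c) -> fibre_sup y <= c.
Proof. by move=> H; apply: ge_sup; [case: (hsup y)|move=> _ [x Kx <-]; exact: H]. Qed.

Lemma fibre_sup_continuous : continuous fibre_sup.
Proof.
move=> y0; apply/cvgrPdist_le => ep ep0.
apply: filterS (tube y0 cK ch ep0) => y H; rewrite ler_distl; apply/andP; split.
  rewrite lerBlDr; apply: fibre_sup_le => x Kx.
  have := H x Kx; rewrite ler_norml => /andP[h1 h2].
  by have := fibre_sup_ge y0 Kx; lra.
apply: fibre_sup_le => x Kx.
have := H x Kx; rewrite ler_norml => /andP[h1 h2].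
by have := fibre_sup_ge y Kx; lra.
Qed.

Lemma open_forall_lt0 : open [set y | forall x, K x -> h x y < 0].
Proof.
rewrite openE => y0 H0; have [c Kc Hc] := compact_EVT_max K0 cK (@continuous_subspaceT _ _ K _ (@cslice y0)).
have hc : 0 < - h c y0 / 2.
  by have := H0 c; rewrite inE in Kc; move=> /(_ Kc); lra.
apply: filterS (tube y0 cK ch hc) => y H x Kx.
have := H x Kx; rewrite ler_norml => /andP[h1 h2].
by have := Hc x (mem_set Kx); lra.
Qed.
End compact_sup.

Lemma bounded_below_barrier {R : realType} (u : R -> R) (m : R) : bounded_orbit u ->
  (forall t : R, exists2 d, is_derive t 1 u d & (m <= u t -> d <= -1)) -> forall t, u t <= m.
Proof.
move=> [M HM] hu t0; rewrite leNgt; apply/negP => mu.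
pose m' := (m + u t0) / 2; have mm' : m < m' by rewrite /m'; lra.
have um' t : t <= t0 -> m' < u t.
  move=> tt; rewrite ltNge; apply/negP => ut.
  have : u t0 - m' <= 0.
    apply: (@barrier _ (fun t => u t - m') t t0) => //; last lra.
    move=> x _; have [d hd dl] := hu x; exists (d - 0) => [|h].
      exact: (is_derive_subf hd (is_derive_cstf m' x)).
    by have := dl _; lra.
  by rewrite /m'; lra.
have M0 : 0 <= M by exact: le_trans (HM 0).
have tt : t0 - (2 * M + 1) <= t0 by lra.
have : u t0 - u (t0 - (2 * M + 1)) <= -1 * t0 - -1 * (t0 - (2 * M + 1)).
  apply: (@derive_le_le _ u (fun t => -1 * t)) => // x /andP[_ x0].
  have [d hd dl] := hu x; exists d, (-1); split => //; first exact: is_derive_linf.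
  by apply: dl; have := um' x x0; lra.
have := HM t0; have := HM (t0 - (2 * M + 1)); rewrite !ler_norml => /andP[? ?] /andP[? ?].
lra.
Qed.

Section concave_functions.
Context {R : realType} (f : R -> R).
Hypothesis df : forall x : R, derivable f x 1.

Lemma derive1_is_derive (x : R) : is_derive x 1 f (derive1 f x).
Proof. by apply: (is_derive_eq (derivableP (@df x))); rewrite derive1E. Qed.

Lemma slope_derive1 (x y : R) : x < y ->
  exists c, [/\ x < c, c < y & f y - f x = derive1 f c * (y - x)].
Proof. by move=> xy; apply: mean_value => // t _; exact: derive1_is_derive. Qed.

Lemma concave_slopes (x y z : R) : concave_fun f -> x < y -> y < z ->
  (f z - f y) * (y - x) <= (f y - f x) * (z - y).
Proof.
move=> cf xy yz; have zx : 0 < z - x by lra.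
pose t := (z - y) / (z - x).
have t0 : 0 <= t by apply: divr_ge0; lra.
have t1 : t <= 1 by rewrite ler_pdivrMr// mul1r; lra.
have := cf x z t t0 t1.
have -> : t * x + (1 - t) * z = y by rewrite /t; field; rewrite gt_eqF.
move=> /(ler_wpM2r (ltW zx)).
have -> : (t * f x + (1 - t) * f z) * (z - x) = (z - y) * f x + (y - x) * f z.
  by rewrite /t; field; rewrite gt_eqF.
lra.
Qed.

Lemma concave_derive_noninc (x y : R) : continuous (derive1 f) -> concave_fun f -> x <= y ->
  derive1 f y <= derive1 f x.
Proof.
move=> cd cf; rewrite le_eqVlt => /predU1P[->//|xy].
rewrite leNgt; apply/negP => lt; pose m := (derive1 f x + derive1 f y) / 2.
have [e1 /= e10 H1] : exists2 e1 : R, 0 < e1 & forall z, `|x - z| < e1 -> derive1 f z < m.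
  have : \forall z \near x, derive1 f z < m by apply: (cvgr_lt _ (cd x)); rewrite /m; lra.
  by move=> /nbhs_ballP[e1 /= e10 He]; exists e1 => // z hz; apply: He.
have [e2 /= e20 H2] : exists2 e2 : R, 0 < e2 & forall z, `|y - z| < e2 -> m < derive1 f z.
  have : \forall z \near y, m < derive1 f z by apply: (cvgr_gt _ (cd y)); rewrite /m; lra.
  by move=> /nbhs_ballP[e2 /= e20 He]; exists e2 => // z hz; apply: He.
pose d := Num.min (Num.min e1 e2) ((y - x) / 3).
have d0 : 0 < d by rewrite !lt_min e10 e20 divr_gt0// subr_gt0.
have de1 : d <= e1 by rewrite !ge_min lexx.
have de2 : d <= e2 by rewrite !ge_min lexx orbT.
have d3 : d <= (y - x) / 3 by rewrite ge_min lexx orbT.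
have x2 : x < x + d by lra.
have y1 : y - d < y by lra.
have xy1 : x + d < y - d by lra.
have [c1 [h1 h2 E1]] := slope_derive1 x2.
have [c2 [h3 h4 E2]] := slope_derive1 y1.
have [c3 [h5 h6 E3]] := slope_derive1 xy1.
have S1 := concave_slopes cf x2 xy1; have S2 := concave_slopes cf xy1 y1.
rewrite E1 E3 in S1; rewrite E2 E3 in S2.
have A1 : derive1 f c1 < m by apply: H1; rewrite ltr_norml; lra.
have A2 : m < derive1 f c2 by apply: H2; rewrite ltr_norml; lra.
have P1 : 0 < (x + d - x) * (y - d - (x + d)) by rewrite mulr_gt0//; clear - x2 xy1; lra.
have P2 : 0 < (y - (y - d)) * (y - d - (x + d)) by rewrite mulr_gt0//; clear - y1 xy1; lra.
have B1 : derive1 f c3 <= derive1 f c1 by rewrite -(ler_pM2r P1); clear - S1; lra.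
have B2 : derive1 f c2 <= derive1 f c3 by rewrite -(ler_pM2r P2); clear - S2; lra.
clear - A1 A2 B1 B2; lra.
Qed.
End concave_functions.

(* The globally Lipschitz field [G] replaces [F], with which it agrees below [M]; bounded
   solutions of either system stay below [C < M]. *)
Record local_model {R : realType} {T : pseudoPMetricType R} (s : R -> T -> T)
    (F G : T -> R -> R) (Lam M K : R) (e : T -> R) (C : R) : Prop := LocalModel {
  lm_adm : admissible s G K e Lam C;
  lm_C0 : 0 < C;
  lm_CM : C + 1 <= M;
  lm_top : forall w x l, l <= Lam -> C <= x -> F w x + l <= -1;
  lm_eq : forall w x, x <= M -> G w x = F w x;
  lm_persist : forall (S : set T) l (de : R), closed S -> (forall t w, S w -> S (s t w)) ->
    l <= Lam -> 0 < de ->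
    (forall w, S w -> exists u v, [/\ solution s G l w u, solution s G l w v,
      bounded_orbit u, bounded_orbit v & forall t, de <= v t - u t]) ->
    exists2 ep : R, 0 < ep & forall w, S w -> OmegaB s (fun w x => G w x + (l - ep)) w }.

Section family.
Context {R : realType} {T : pseudoPMetricType R} (s : R -> T -> T).
Context (c d : T -> R) (g : T -> R -> R).
Hypotheses (hT : hausdorff_space T) (cT : compact [set: T]) (fl : is_flow s).
Hypotheses (cc : continuous c) (cd : continuous d) (hg : C01 g).
Hypothesis l2 : forall m : probability (Borel T) R, ergodic_measure s m ->
  (0 < integral_of m d)%E.
Hypothesis l3 : forall M : R, exists X : R, forall x, X < x -> forall w, d w * x + g w x < - M.
Hypothesis gle0 : forall w x, g w x <= 0.
Hypothesis g0 : forall w x, x <= 0 -> g w x = 0.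
Hypothesis l4 : forall m : probability (Borel T) R, ergodic_measure s m ->
  m [set w | forall x, 0 < x -> g w x < 0] = 1%E.
Hypothesis l5 : forall m : probability (Borel T) R, ergodic_measure s m ->
  m [set w | concave_fun (g w)] = 1%E.
Hypothesis l6 : forall m : probability (Borel T) R, ergodic_measure s m ->
  forall a b : R, 0 <= a -> a <= b ->
  (0 < m [set w | strictly_decreasing_on [set x | (a <= x <= b)%R] (derive1 (g w))])%E.

Let cg : continuous (fun p : T * R => g p.1 p.2). Proof. by case: hg. Qed.
Let dg w (x : R) : is_derive x 1 (g w) (derive1 (g w) x).
Proof. by apply: derive1_is_derive => y; case: hg => _ [h _]; exact: h. Qed.
Let dgw w (x : R) : derivable (g w) x 1. Proof. by case: hg => _ []. Qed.
Let gx w x := derive1 (g w) x.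
Let cgx : continuous (fun p : T * R => gx p.1 p.2). Proof. by case: hg => _ []. Qed.
Let cgxw w : continuous (gx w).
Proof.
by apply: (@continuous_comp2 _ _ _ _ gx (fun=> w) id) => // x; [exact: cvg_cst|exact: cvg_id].
Qed.

Let gx0 w x : x <= 0 -> gx w x = 0.
Proof.
have neg y : y < 0 -> gx w y = 0.
  move=> y0; have h : is_derive y 1 (g w) 0.
    apply: (@near_eq_is_derive _ _ _ (fun _ : R => 0 : R)).
    by near=> z; rewrite g0//; near: z; apply: filterS (lt_nbhsl y0) => z; exact: ltW.
  by rewrite /gx derive1E; case: h.
rewrite le_eqVlt => /predU1P[->|/neg//]; apply/eqP/negPn/negP => n0.
have n0' : 0 < `|gx w 0| by rewrite normr_gt0.
have : \forall y \near (0 : R), 0 < `|gx w y|.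
  have cv : `|gx w y| @[y --> (0 : R)] --> `|gx w 0| by apply: cvg_norm; exact: cgxw.
  exact: (cvgr_gt _ cv _ n0').
move=> /nbhs_ballP[e1 /= e10 He].
have : 0 < `|gx w (- (e1 / 2))|.
  by apply: He; rewrite /ball/= sub0r opprK ger0_norm; lra.
by rewrite neg ?normr0 ?ltxx//; lra.
Unshelve. all: by end_near. Qed.

Section truncation.
Variables (M : R) (M0 : 0 <= M).

Let box := (`[0, M] `*` `[0, M])%classic : set (R * R).
Let cbox : compact box. Proof. by apply: compact_setX; exact: segment_compact. Qed.
Let box0 : box !=set0. Proof. by exists (0, 0); split; rewrite /= in_itv/= lexx. Qed.

Let jump (q : R * R) (w : T) : R := gx w (Num.max q.1 q.2) - gx w (Num.min q.1 q.2).

Definition concavity_defect (w : T) : R := fibre_sup box jump w.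

Let cdefect : continuous (fun p : (R * R) * T => jump p.1 p.2).
Proof.
have c1 : continuous (fun p : (R * R) * T => p.1.1).
  by move=> p; apply: (@cvg_comp _ _ _ fst fst _ (nbhs p.1)); [exact: cvg_fst|exact: cvg_fst].
have c2 : continuous (fun p : (R * R) * T => p.1.2).
  by move=> p; apply: (@cvg_comp _ _ _ fst snd _ (nbhs p.1)); [exact: cvg_fst|exact: cvg_snd].
by apply: continuous_subf; apply: (@continuous_comp2 _ _ _ _ gx snd) => //;
  [by move=> p; exact: cvg_snd|exact: continuous_maxf|by move=> p; exact: cvg_snd|exact: continuous_minf].
Qed.

Lemma concavity_defect_continuous : continuous concavity_defect.
Proof. exact: fibre_sup_continuous cbox box0 cdefect. Qed.

Lemma concavity_defect_ge w p q : p <= q -> q <= M -> gx w q - gx w p <= concavity_defect w.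
Proof.
move=> pq qM; have E r : gx w r = gx w (Num.max 0 r).
  have [r0|] := boolP (r <= 0); first by rewrite max_l// !gx0.
  by rewrite -ltNge => /ltW r0; rewrite max_r.
rewrite (E p) (E q); pose p' := Num.max 0 p; pose q' := Num.max 0 q.
have pq' : p' <= q' by rewrite /p' /q' ge_max !le_max lexx pq orbT.
have p0 : 0 <= p' by rewrite le_max lexx.
have qM' : q' <= M by rewrite ge_max M0.
have Kpq : box (p', q').
  by split; rewrite /= in_itv/= ?p0 ?(le_trans pq' qM')//= qM' andbT (le_trans p0 pq').
have := @fibre_sup_ge _ _ _ box jump cbox box0 cdefect (p', q') w Kpq.
by rewrite /jump /= max_r// min_l.
Qed.

Lemma concavity_defect_ge0 w : 0 <= concavity_defect w.
Proof. by have := concavity_defect_ge w (lexx 0) M0; rewrite subrr. Qed.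

Lemma concavity_defect_concave w : concave_fun (g w) -> concavity_defect w = 0.
Proof.
move=> cw; apply/eqP; rewrite eq_le concavity_defect_ge0 andbT.
apply: (fibre_sup_le cbox box0 cdefect) => -[p q] _ /=; rewrite subr_le0.
apply: (concave_derive_noninc (@dgw w) (@cgxw w) cw).
by rewrite ge_min !le_max lexx.
Qed.

Lemma concave_closed : closed [set w | concave_fun (g w)].
Proof.
have -> : [set w | concave_fun (g w)] = \bigcap_(q in [set q : R * R * R | 0 <= q.2 <= 1])
    [set w | q.2 * g w q.1.1 + (1 - q.2) * g w q.1.2 - g w (q.2 * q.1.1 + (1 - q.2) * q.1.2) <= 0].
  apply/seteqP; split=> [w cw [[x y] t] /= /andP[t0 t1]|w H x y t t0 t1].
    by rewrite subr_le0; exact: cw.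
  by have := H (x, y, t); rewrite /= t0 t1 subr_le0; apply.
apply: closed_bigI => q _.
have cgq x : continuous (fun w => g w x).
  by apply: (@continuous_comp2 _ _ _ _ g id (fun=> x)) => // w; [exact: cvg_id|exact: cvg_cst].
apply: (@closed_comp _ _ (fun w => q.2 * g w q.1.1 + (1 - q.2) * g w q.1.2 -
  g w (q.2 * q.1.1 + (1 - q.2) * q.1.2)) [set y | y <= 0]); last exact: closed_le.
move=> w _; apply: continuous_subf; last exact: cgq.
by apply: continuous_addf; apply: continuous_mulf; try exact: continuous_cstf; exact: cgq.
Qed.

Lemma concavity_defect_integral (m : probability (Borel T) R) : ergodic_measure s m ->
  (integral_of m concavity_defect <= 0)%E.
Proof.
move=> me; have ce := concavity_defect_continuous.
have [C [C0 HC]] := continuous_bounded cT ce.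
rewrite integral_ofE// lee_fin.
pose f w := C^-1 * concavity_defect w.
have cf : continuous f by apply: continuous_mulf => //; exact: continuous_cstf.
have oB : open [set w | 0 < f w].
  by apply: (@open_comp _ _ f [set y | 0 < y]) => //; exact: open_gt.
have mB : measurable ([set w | 0 < f w] : set (Borel T)) by exact: open_borel.
have mc : measurable ([set w | concave_fun (g w)] : set (Borel T)).
  by apply: closed_borel; exact: concave_closed.
have z : m [set w | 0 < f w] = 0%E.
  apply/eqP; rewrite eq_le measure_ge0 andbT.
  have h := probability_setC m mc; rewrite (l5 me) subee// in h.
  rewrite -h; apply: le_measure; rewrite ?inE//; first exact: measurableC.
  by move=> w /= fw /concavity_defect_concave h0; move: fw; rewrite /f h0 mulr0 ltxx.
have := @Rintegral_le_measure _ _ cT m setT [set w | 0 < f w] f measurableT mB cf.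
rewrite setTI z /= => H; have {}H : Rintegral m setT f <= 0.
  apply: H => // w; rewrite /f mulrC ler_pdivrMr// mul1r.
  exact: le_trans (ler_norm _) (HC w).
move: H; rewrite (RintegralZ_continuous cT m)// pmulr_rle0 ?invr_gt0//.
Qed.

Lemma slope_bound : exists K : R, 1 <= K /\ forall w x, x <= M -> `|d w + gx w x| <= K.
Proof.
have cK := compact_setX cT (@segment_compact R 0 M).
have cf0 : continuous (fun p : T * R => d p.1 + gx p.1 p.2).
  apply: continuous_addf => //.
  by move=> q; apply: (@cvg_comp _ _ _ fst d _ (nbhs q.1)); [exact: cvg_fst|exact: cd].
have cf : continuous (fun p : T * R => `|d p.1 + gx p.1 p.2|).
  by move=> p; apply: cvg_norm; exact: cf0.
have [C HC] := continuous_bounded_above cK cf.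
exists (Num.max 1 C); split=> [|w x xM]; first by rewrite le_max lexx.
rewrite le_max; apply/orP; right.
have -> : gx w x = gx w (Num.max 0 x).
  have [r0|] := boolP (x <= 0); first by rewrite max_l// !gx0.
  by rewrite -ltNge => /ltW r0; rewrite max_r.
apply: (HC (w, Num.max 0 x)); split => //=.
by rewrite in_itv/= le_max lexx/= ge_max M0.
Qed.

Definition truncated (K : R) (w : T) (x : R) : R :=
  c w + (d w * Num.min x M + g w (Num.min x M)) - K * (x - Num.min x M).

Lemma truncatedE K w x : x <= M -> truncated K w x = c w + d w * x + g w x.
Proof. by move=> xM; rewrite /truncated min_l// subrr mulr0 subr0 addrA. Qed.

Lemma truncated_continuous K : continuous (fun p : T * R => truncated K p.1 p.2).
Proof.
have cm : continuous (fun p : T * R => Num.min p.2 M).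
  by apply: continuous_minf; [move=> p; exact: cvg_snd|exact: continuous_cstf].
have c1 (f : T -> R) : continuous f -> continuous (fun p : T * R => f p.1).
  by move=> cf p; apply: (@cvg_comp _ _ _ fst f _ (nbhs p.1)); [exact: cvg_fst|exact: cf].
apply: continuous_subf.
  apply: continuous_addf; first exact: c1.
  apply: continuous_addf; first by apply: continuous_mulf => //; exact: c1.
  by apply: (@continuous_comp2 _ _ _ _ g fst) => // p; exact: cvg_fst.
apply: continuous_mulf; first exact: continuous_cstf.
by apply: continuous_subf => // p; exact: cvg_snd.
Qed.

Section slopes.
Variable K : R.
Hypotheses (K1 : 1 <= K) (HK : forall w x, x <= M -> `|d w + gx w x| <= K).

Let f w x := d w * x + g w x.

Let fslope w x y : x < y -> y <= M -> exists z,
  [/\ x < z, z < y, f w y - f w x = (d w + gx w z) * (y - x) & g w y - g w x = gx w z * (y - x)].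
Proof.
move=> xy yM; have [z [xz zy E]] := slope_derive1 (@dgw w) xy; exists z; split => //.
by rewrite /f /gx mulrDl -E; ring.
Qed.

Let flip w x y : x <= y -> y <= M -> `|f w y - f w x| <= K * (y - x).
Proof.
rewrite le_eqVlt => /predU1P[->|xy] yM; first by rewrite !subrr normr0 mulr0.
have [z [xz zy -> _]] := fslope w xy yM.
have yx : 0 < y - x by rewrite subr_gt0.
rewrite normrM (ger0_norm (ltW yx)) ler_pM2r//.
by apply: HK; exact: ltW (lt_le_trans zy yM).
Qed.

Let min_mono x y : x <= y -> Num.min x M <= Num.min y M.
Proof. by move=> xy; rewrite le_min !ge_min xy lexx orbT. Qed.

Let min_excess x y : x <= y -> x - Num.min x M <= y - Num.min y M.
Proof.
by move=> xy; have [h1|h1] := leP x M; have [h2|h2] := leP y M; lra.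
Qed.

Lemma truncated_lipschitz w x y : `|truncated K w x - truncated K w y| <= K * `|x - y|.
Proof.
suff H a b : a <= b -> `|truncated K w b - truncated K w a| <= K * (b - a).
  have [xy|/ltW yx] := leP x y.
    by rewrite distrC [`|x - y|]distrC [`|y - x|]ger0_norm ?subr_ge0//; exact: H.
  by rewrite [`|x - y|]ger0_norm ?subr_ge0//; exact: H.
move=> ab; have bM : Num.min b M <= M by rewrite ge_min lexx orbT.
have h1 := flip w (min_mono ab) bM.
rewrite /truncated -/(f w (Num.min a M)) -/(f w (Num.min b M)).
have h2 := min_excess ab; have K0 : 0 <= K by exact: le_trans ler01 K1.
have := mulr_ge0 K0 (_ : 0 <= b - Num.min b M - (a - Num.min a M)).
rewrite subr_ge0 => /(_ h2) h3.
move: h1; rewrite !ler_norml => /andP[h4 h5]; apply/andP; split; lra.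
Qed.

Lemma truncated_defect w x y z : x <= y -> y <= z ->
  (truncated K w z - truncated K w y) * (y - x) <=
  (truncated K w y - truncated K w x) * (z - y) + concavity_defect w * ((z - y) * (y - x)).
Proof.
move=> xy yz.
have mM r : Num.min r M <= M by rewrite ge_min lexx orbT.
pose x' := Num.min x M; pose y' := Num.min y M; pose z' := Num.min z M.
have xy' : x' <= y' by exact: min_mono. have yz' : y' <= z' by exact: min_mono.
have rxy := min_excess xy; have ryz := min_excess yz.
have base : (f w z' - f w y') * (y' - x') <=
    (f w y' - f w x') * (z' - y') + concavity_defect w * ((z' - y') * (y' - x')).
  move: xy'; rewrite le_eqVlt => /predU1P[->|xy'].
    by rewrite !subrr !mulr0 mul0r addr0.
  move: yz'; rewrite le_eqVlt => /predU1P[->|yz'].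
    by rewrite !subrr !mulr0 !mul0r mulr0 addr0.
  have [t1 [h1 h2 E1 _]] := fslope w xy' (mM y); have [t2 [h3 h4 E2 _]] := fslope w yz' (mM z).
  rewrite E1 E2; have := concavity_defect_ge w (ltW (lt_trans h2 h3)) (ltW (lt_le_trans h4 (mM z))).
  have P : 0 < (z' - y') * (y' - x') by rewrite mulr_gt0// subr_gt0.
  move=> /(ler_wpM2r (ltW P)); set a := gx w t1; set b := gx w t2; lra.
have FA := flip w yz' (mM z); have FB := flip w xy' (mM y).
move: FA FB; rewrite !ler_norml => /andP[A1 A2] /andP[B1 B2].
have e0 := concavity_defect_ge0 w.
rewrite /truncated -/x' -/y' -/z' -/(f w x') -/(f w y') -/(f w z').
rewrite -/x' -/y' -/z' in rxy ryz.
have K0 : 0 <= K by exact: le_trans ler01 K1.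
have [yM|yM] := leP y M.
  have yE : y' = y by rewrite /y' min_l. have xE : x' = x by rewrite /x' min_l// (le_trans xy).
  rewrite ?yE ?xE in base A1 A2 B1 B2 xy' yz' ryz *.
  have P1 : 0 <= (z - z') * (f w y - f w x + K * (y - x)) by rewrite mulr_ge0; lra.
  have P2 : 0 <= concavity_defect w * ((z - z') * (y - x)).
    by rewrite !mulr_ge0//; lra.
  by move: base P1 P2; set F1 := f w x; set F2 := f w y; set F3 := f w z'; lra.
have yE : y' = M by rewrite /y' min_r// ltW. have zE : z' = M by rewrite /z' min_r// (le_trans (ltW yM)).
rewrite ?yE ?zE in base B1 B2 xy' rxy ryz *.
have P1 : 0 <= (z - y) * (f w M - f w x' + K * (M - x')) by rewrite mulr_ge0; lra.
have P2 : 0 <= concavity_defect w * ((z - y) * (y - x)) by rewrite !mulr_ge0//; lra.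
by move: P1 P2; set F1 := f w x'; set F2 := f w M; lra.
Qed.
End slopes.
End truncation.

Definition open_negative_on (n : nat) : set T :=
  [set w | forall x, `[n.+1%:R^-1, n.+1%:R]%classic x -> g w x < 0].

Lemma negative_measurable : measurable ([set w | forall x, 0 < x -> g w x < 0] : set (Borel T)).
Proof.
have -> : [set w | forall x, 0 < x -> g w x < 0] = \bigcap_n open_negative_on n.
  apply/seteqP; split=> [w H n _ x|w H x x0].
    by rewrite /= in_itv/= => /andP[h _]; apply: H; apply: lt_le_trans h; rewrite invr_gt0.
  pose n := maxn (Num.truncn x) (Num.truncn x^-1).
  apply: (H n I); rewrite /= in_itv/=; apply/andP; split.
    rewrite -[leRHS]invrK lef_pV2 ?posrE ?invr_gt0// ltW//.
    by apply: lt_le_trans (truncnS_gt _) _; rewrite ler_nat ltnS leq_maxr.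
  by rewrite ltW//; apply: lt_le_trans (truncnS_gt _) _; rewrite ler_nat ltnS leq_maxl.
apply: (@bigcapT_measurable _ (Borel T)) => n; apply: open_borel.
apply: (@open_forall_lt0 _ _ _ _ (fun x w => g w x)).
- exact: segment_compact.
- exists 1; rewrite /= in_itv/= ler1n andbT invf_le1//.
    by rewrite ler1n.
- by apply: (@continuous_comp2 _ _ _ _ g snd fst) => // p; [exact: cvg_snd|exact: cvg_fst].
Qed.

Lemma strict_measurable (b : R) : 0 < b -> measurable ([set w |
  strictly_decreasing_on [set x | (0 <= x <= b)%R] (derive1 (g w))] : set (Borel T)).
Proof.
move=> b0; pose K n := (`[0, b] `*` `[0, b])%classic `&` [set q : R * R | q.1 + b / n.+1%:R <= q.2].
have -> : [set w | strictly_decreasing_on [set x | (0 <= x <= b)%R] (derive1 (g w))] =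
    \bigcap_n [set w | forall q, K n q -> gx w q.2 - gx w q.1 < 0].
  apply/seteqP; split=> [w H n _ [x y] [[]] /=|w H x y].
    rewrite !in_itv/= => h1 h2 h3; rewrite subr_lt0; apply: H => //.
    by apply: lt_le_trans h3; rewrite ltrDl divr_gt0.
  move=> h1 h2 xy; pose n := Num.truncn (b / (y - x)).
  have := H n I (x, y); rewrite subr_lt0; apply; split; first by split; rewrite /= in_itv.
  have yx : 0 < y - x by rewrite subr_gt0.
  rewrite /= -lerBrDl ler_pdivrMr// mulrC -ler_pdivrMr// ltW//; exact: truncnS_gt.
apply: (@bigcapT_measurable _ (Borel T)) => n; apply: open_borel.
apply: (@open_forall_lt0 _ _ _ (K n) (fun q w => gx w q.2 - gx w q.1)).
- apply: compact_closedI; first by apply: compact_setX; exact: segment_compact.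
  have -> : [set q : R * R | q.1 + b / n.+1%:R <= q.2] =
      (fun q : R * R => q.1 + b / n.+1%:R - q.2) @^-1` [set y | y <= 0].
    by apply/seteqP; split=> q /=; rewrite subr_le0.
  apply: closed_comp; last exact: closed_le.
  move=> q _; apply: continuous_subf; last by move=> p; exact: cvg_snd.
  by apply: continuous_addf; [move=> p; exact: cvg_fst|exact: continuous_cstf].
- exists (0, b); split; last first.
    by rewrite /= add0r ler_pdivrMr//; apply: ler_peMr; [exact: ltW|rewrite ler1n].
  by split; rewrite /= in_itv/= lexx ltW.
- have c1 : continuous (fun p : (R * R) * T => p.1.1).
    by move=> p; apply: (@cvg_comp _ _ _ fst fst _ (nbhs p.1)); [exact: cvg_fst|exact: cvg_fst].
  have c2 : continuous (fun p : (R * R) * T => p.1.2).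
    by move=> p; apply: (@cvg_comp _ _ _ fst snd _ (nbhs p.1)); [exact: cvg_fst|exact: cvg_snd].
  apply: continuous_subf; apply: (@continuous_comp2 _ _ _ _ gx snd) => // p; exact: cvg_snd.
Qed.

(* Concavity alone suffices across zero: [g w] vanishes on the left and is negative on the right. *)
Lemma straddle_midgap w x y : concave_fun (g w) -> (forall x, 0 < x -> g w x < 0) ->
  x < 0 -> 0 < y -> 0 < 2 * g w ((x + y) / 2) - g w x - g w y.
Proof.
move=> cw nw x0 y0; rewrite (g0 w (ltW x0)); have gy := nw y y0.
have [m0|m0] := leP ((x + y) / 2) 0; first by rewrite (g0 w m0); lra.
have gm := nw _ m0; set m := (x + y) / 2 in m0 gm *.
have my : m < y by rewrite /m; lra.
have := concave_slopes cw m0 my; rewrite (g0 w (lexx 0)) !subr0.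
have -> : y - m = m - x by rewrite /m; lra.
move=> h; have h2 : 0 < (- g w m) * (- x) by rewrite mulr_gt0//; lra.
have : 0 < m * (2 * g w m - g w y) by lra.
by rewrite pmulr_rgt0//; lra.
Qed.

Lemma strict_midgap (b : R) w x y : strictly_decreasing_on [set x | (0 <= x <= b)%R] (derive1 (g w)) ->
  0 <= x -> x < y -> y <= b -> 0 < 2 * g w ((x + y) / 2) - g w x - g w y.
Proof.
move=> sw x0 xy yb; set m := (x + y) / 2.
have xm : x < m by rewrite /m; lra. have my : m < y by rewrite /m; lra.
have [z1 [h1 h2 E1]] := slope_derive1 (@dgw w) xm.
have [z2 [h3 h4 E2]] := slope_derive1 (@dgw w) my.
have : derive1 (g w) z2 < derive1 (g w) z1 by apply: sw => /=; lra.
have E3 : y - m = (y - x) / 2 by rewrite /m; lra.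
have E4 : m - x = (y - x) / 2 by rewrite /m; lra.
rewrite E3 in E2; rewrite E4 in E1 => h.
have : 0 < (derive1 (g w) z1 - derive1 (g w) z2) * ((y - x) / 2) by rewrite mulr_gt0//; lra.
lra.
Qed.

Lemma uniform_linear_growth : exists (eta : R) ts, [/\ 0 < eta, ts != [::] &
  forall w, avg s (fun w => - d w) ts w <= - eta].
Proof.
have cNd : continuous (fun w => - d w) by move=> w; apply: cvgN; exact: cd.
have [|ts [ts0 H]] := @uniform_average _ _ s _ 0 fl cT cNd.
  move=> m me; rewrite integral_ofE// lte_fin.
  have := l2 me; rewrite integral_ofE// lte_fin.
  have -> : Rintegral m setT (fun w => - d w) = -1 * Rintegral m setT d.
    rewrite -(RintegralZ_continuous cT m)//; congr Rintegral.
    by apply/funext => w; rewrite mulN1r.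
  lra.
have T0 : [set: T] !=set0 by exists point.
have cav := avg_continuous (ts := ts) fl cNd.
have [w0 _ Hw0] := compact_EVT_max T0 cT (@continuous_subspaceT _ _ setT _ cav).
exists (- avg s (fun w => - d w) ts w0), ts; split => //; first by have := H w0; lra.
by move=> w; rewrite opprK; apply: Hw0; rewrite inE.
Qed.

Section nondegenerate.
Context (M K : R) (e : T -> R) (Lam C : R).
Hypothesis CM : C <= M.
Hypothesis M0 : 0 < M.
Hypothesis adm : admissible s (truncated M K) K e Lam C.
Local Notation G := (truncated M K).
Local Notation ph := (phi (adm_flow adm) (adm_lip adm) (adm_K1 adm) (adm_compact adm) (adm_cont adm)).

Let midgapE w x y : x <= M -> y <= M ->
  midgap G w x y = 2 * g w ((x + y) / 2) - g w x - g w y.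
Proof. by move=> xM yM; rewrite /midgap !truncatedE//; [lra|lra]. Qed.

Let phiM l w x t : `|ph l w x t| <= C -> ph l w x t <= M.
Proof. by rewrite ler_norml => /andP[_ h]; exact: le_trans h CM. Qed.

Lemma separated_midgap (S : set T) l de w q : closed S -> (forall t w, S w -> S (s t w)) ->
  l <= Lam -> 0 < de -> S w -> separated adm l w de q ->
  exists t, 0 < midgap G (s t w) (ph l w q.1 t) (ph l w q.2 t).
Proof.
move=> cS Sinv lL de0 Sw sep; apply: contrapT => /forallNP N.
pose X := (T * (R * R))%type.
pose mg t (p : X) := midgap G (s t p.1) (ph l p.1 p.2.1 t) (ph l p.1 p.2.2 t).
pose flat (p : X) := [/\ S p.1, separated adm l p.1 de p.2 & forall t, mg t p <= 0].
have phc (f : X -> R) t : continuous f -> continuous (fun p : X => ph l p.1 (f p) t).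
  move=> cf p; apply: (@continuous_comp _ _ _ (fun p : X => (l, p.1, f p))
    (fun p : R * T * R => ph p.1.1 p.1.2 p.2 t)); last exact: phi_continuous.
  apply: (@cvg_pair _ _ _ _ (nbhs (l, p.1)) (nbhs (f p))); last exact: cf.
  by apply: (@cvg_pair _ _ _ _ (nbhs l) (nbhs p.1)); [exact: cvg_cst|exact: cvg_fst].
have cx : continuous (fun p : X => p.2.1).
  by move=> p; apply: (@cvg_comp _ _ _ snd fst _ (nbhs p.2)); [exact: cvg_snd|exact: cvg_fst].
have cy : continuous (fun p : X => p.2.2).
  by move=> p; apply: (@cvg_comp _ _ _ snd snd _ (nbhs p.2)); [exact: cvg_snd|exact: cvg_snd].
have px t := phc _ t cx; have py t := phc _ t cy.
have cst' t : continuous (fun p : X => s t p.1).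
  by move=> p; apply: (@cvg_comp _ _ _ fst (s t) _ (nbhs p.1)); [exact: cvg_fst|exact: flow_continuous].
have cG := adm_cont adm.
have cmg t : continuous (mg t).
  apply: continuous_subf; [apply: continuous_subf|].
  - apply: continuous_mulf; first exact: continuous_cstf.
    apply: (@continuous_comp2 _ _ _ _ G (fun p : X => s t p.1)) => //.
    apply: continuous_mulf; last exact: continuous_cstf.
    by apply: continuous_addf; [exact: px|exact: py].
  - by apply: (@continuous_comp2 _ _ _ _ G (fun p : X => s t p.1)) => //; exact: px.
  - by apply: (@continuous_comp2 _ _ _ _ G (fun p : X => s t p.1)) => //; exact: py.
have clo t : closed [set p : X | [/\ `|ph l p.1 p.2.1 t| <= C, `|ph l p.1 p.2.2 t| <= C,
    de <= ph l p.1 p.2.2 t - ph l p.1 p.2.1 t & mg t p <= 0]].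
  have -> : [set p : X | [/\ `|ph l p.1 p.2.1 t| <= C, `|ph l p.1 p.2.2 t| <= C,
      de <= ph l p.1 p.2.2 t - ph l p.1 p.2.1 t & mg t p <= 0]] =
      ((fun p : X => `|ph l p.1 p.2.1 t|) @^-1` [set y | y <= C]) `&`
      ((fun p : X => `|ph l p.1 p.2.2 t|) @^-1` [set y | y <= C]) `&`
      ((fun p : X => ph l p.1 p.2.2 t - ph l p.1 p.2.1 t) @^-1` [set y | de <= y]) `&`
      (mg t @^-1` [set y | y <= 0]).
    by apply/seteqP; split=> p; [move=> []|move=> [[[]]]].
  apply: closedI; [apply: closedI; [apply: closedI|]|]; apply: closed_comp; 
    try exact: closed_le; try exact: closed_ge; move=> p _.
  - by apply: cvg_norm; exact: px.
  - by apply: cvg_norm; exact: py.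
  - by apply: cvgB; [exact: py|exact: px].
  - exact: cmg.
have cflat : closed [set p | flat p].
  have -> : [set p | flat p] = (fst @^-1` S) `&` \bigcap_(t in [set: R])
      [set p : X | [/\ `|ph l p.1 p.2.1 t| <= C, `|ph l p.1 p.2.2 t| <= C,
        de <= ph l p.1 p.2.2 t - ph l p.1 p.2.1 t & mg t p <= 0]].
    apply/seteqP; split=> [p [h1 h2 h3]|p [h1 h2]].
      by split => // t _; have [? ? ?] := h2 t; split.
    by split => // t; have [] := h2 t I.
  apply: closedI; last by apply: closed_bigI => t _; exact: clo.
  by apply: closed_comp => // p _; exact: cvg_fst.
have kflat : compact [set p | flat p].
  apply: (@subclosed_compact _ _ (setT `*` (`[- C, C] `*` `[- C, C])%classic)) => //.
    by apply: compact_setX => //; apply: compact_setX; exact: segment_compact.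
  move=> p [_ h _]; have [] := h 0; rewrite !phi0 => h1 h2 _.
  by split => //; split; rewrite /= in_itv/= -ler_norml.
pose S2 : set T := fst @` [set p | flat p].
have cS2 : closed S2.
  apply: compact_closed => //; apply: continuous_compact => //.
  by apply: continuous_subspaceT => p; exact: cvg_fst.
have S20 : S2 !=set0.
  exists w, (w, q) => //; split => // t; rewrite leNgt; apply/negP; exact: N.
have S2inv t w1 : S2 w1 -> S2 (s t w1).
  move=> [[w2 q2] [/= h1 h2 h3] <-].
  pose u := ph l w2 q2.1; pose v := ph l w2 q2.2.
  have hu := phi_solution (adm_flow adm) (adm_lip adm) (adm_K1 adm) (adm_compact adm) (adm_cont adm) l w2 q2.1.
  have hv := phi_solution (adm_flow adm) (adm_lip adm) (adm_K1 adm) (adm_compact adm) (adm_cont adm) l w2 q2.2.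
  have pu r : ph l (s t w2) (u t) r = u (r + t).
    have := phi_unique (adm_flow adm) (adm_lip adm) (adm_K1 adm) (adm_compact adm)
      (adm_cont adm) r (solution_shift fl t hu).
    by rewrite add0r.
  have pv r : ph l (s t w2) (v t) r = v (r + t).
    have := phi_unique (adm_flow adm) (adm_lip adm) (adm_K1 adm) (adm_compact adm)
      (adm_cont adm) r (solution_shift fl t hv).
    by rewrite add0r.
  exists (s t w2, (u t, v t)) => //; split => /=; first exact: Sinv.
    by move=> r; rewrite /= pu pv; exact: h2.
  move=> r; rewrite /mg /= pu pv -fl.2.2; exact: h3.
have [m [me mS2 _]] := ergodic_maximizing fl cT cS2 S20 S2inv cd.
pose N0 : set (Borel T) := [set w | forall x, 0 < x -> g w x < 0].
pose N1 : set (Borel T) := [set w | concave_fun (g w)].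
pose N2 : set (Borel T) := [set w | strictly_decreasing_on [set x | (0 <= x <= M)%R] (derive1 (g w))].
have mN0 : measurable N0 by exact: negative_measurable.
have mN1 : measurable N1 by apply: closed_borel; exact: concave_closed.
have mN2 : measurable N2 by exact: strict_measurable.
have compl0 (A : set (Borel T)) : measurable A -> m A = 1%E -> m (~` A) = 0%E.
  by move=> mA A1; rewrite probability_setC// A1 subee.
have ms t : measurable_fun setT (s t : Borel T -> Borel T).
  by apply: continuous_borel_measurable_map; exact: flow_continuous.
pose A0 (r : rat) : set (Borel T) := ~` (s (ratr r) @^-1` (N0 `&` N1)).
have mA0 r : measurable (A0 r).
  apply: measurableC; rewrite -[X in measurable X]setTI; apply: ms => //; exact: measurableI.
have A00 r : m (A0 r) = 0%E.
  have -> : A0 r = s (ratr r) @^-1` (~` (N0 `&` N1)) by rewrite /A0 preimage_setC.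
  rewrite me.1; last by apply: measurableC; exact: measurableI.
  rewrite setCI; apply/eqP; rewrite eq_le measure_ge0 andbT.
  apply: le_trans (measureU2 _ _ _) _; [exact: measurableC|exact: measurableC|].
  have e0 := compl0 _ mN0 (l4 me); have e1 := compl0 _ mN1 (l5 me).
  by rewrite [X in (X + _)%E](_ : _ = 0%E)// [X in (_ + X)%E](_ : _ = 0%E)// adde0.
pose F n : set (Borel T) := if (unpickle n : option rat) is Some r then A0 r else set0.
have mF n : measurable (F n) by rewrite /F; case: unpickle.
have F0 n : m (F n) = 0%E by rewrite /F; case: unpickle => [r|]; rewrite ?A00// measure0.
have mUF : measurable (\bigcup_n F n) by exact: bigcupT_measurable.
have UF0 : m (\bigcup_n F n) = 0%E.
  apply/eqP; rewrite eq_le measure_ge0 andbT.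
  have := @measure_sigma_subadditive _ _ _ m (\bigcup_n F n) F mF mUF (@subset_refl _ _).
  by rewrite (eq_eseriesr (fun i _ => F0 i)) eseries0.
have mS2' : measurable (S2 : set (Borel T)) by exact: closed_borel.
have [w' [[w'2 w'S] w'F]] : exists w', (N2 `&` S2) w' /\ ~ (\bigcup_n F n) w'.
  apply: contrapT => /forallNP H.
  have sub' : N2 `<=` (~` S2 : set (Borel T)) `|` \bigcup_n F n.
    move=> w1 h2; have [hS|hS] := pselect (S2 w1); last by left.
    right; apply: contrapT => hF; exact: (H w1).
  have : (m N2 <= 0)%E.
    apply: (@le_trans _ _ (m ((~` S2 : set (Borel T)) `|` \bigcup_n F n))).
      apply: le_measure; rewrite ?inE//; apply: measurableU => //; exact: measurableC.
    apply: le_trans (measureU2 _ _ _) _; [exact: measurableC|by []|].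
    have e0 := compl0 _ mS2' mS2.
    by rewrite [X in (X + _)%E](_ : _ = 0%E)// [X in (_ + X)%E](_ : _ = 0%E)// adde0.
  by have := l6 me (lexx 0) (ltW M0); rewrite -/N2 => /lt_le_trans h /h; rewrite ltxx.
move: w'S => [[w1 p] [/= h1 h2 h3] w1E]; rewrite {}w1E in h1 h2 h3.
pose u := ph l w' p.1; pose v := ph l w' p.2.
have hu : solution s G l w' u by exact: phi_solution.
have hv : solution s G l w' v by exact: phi_solution.
have cu : continuous u by move=> t; exact: is_derive_continuous (hu t).
have cv : continuous v by move=> t; exact: is_derive_continuous (hv t).
have uM t : u t <= M by apply: phiM; case: (h2 t).
have vM t : v t <= M by apply: phiM; case: (h2 t).
have uv t : de <= v t - u t by case: (h2 t).
have mgE t : 2 * g (s t w') ((u t + v t) / 2) - g (s t w') (u t) - g (s t w') (v t) <= 0.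
  by have := h3 t; rewrite /mg /= midgapE.
have nostraddle t : ~ (u t < 0 /\ 0 < v t).
  move=> [ut vt].
  have : \forall r \near t, u r < 0 /\ 0 < v r.
    by apply: filterI; [exact: (cvgr_lt _ (cu t) _ ut)|exact: (cvgr_gt _ (cv t) _ vt)].
  move=> /nbhs_ballP[ep /= ep0 Hep].
  have tep : t - ep < t + ep by lra.
  have [r] := rat_in_itvoo tep; rewrite in_itv/= => /andP[r1 r2].
  have [|ur vr] := Hep (ratr r); first by rewrite /ball/= ltr_norml; lra.
  have [g1 g2] : (N0 `&` N1) (s (ratr r) w').
    apply: contrapT => h; apply: w'F; exists (pickle r); first exact: I.
    by rewrite /F pickleK; exact: h.
  by have := straddle_midgap g2 g1 ur vr; have := mgE (ratr r); lra.
have v0 : v 0 <= 0.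
  rewrite leNgt; apply/negP => v0.
  have [u0|u0] := leP 0 (u 0); last by apply: (nostraddle 0).
  have lt : u 0 < v 0 by have := uv 0; lra.
  have := strict_midgap w'2 u0 lt (vM 0); have := mgE 0; rewrite fl.2.1; lra.
have vneg t : v t <= 0.
  rewrite leNgt; apply/negP => vt.
  pose ep := Num.min (de / 2) (v t / 2).
  have ep0 : 0 < ep by rewrite lt_min !divr_gt0.
  have epd : ep <= de / 2 by rewrite ge_min lexx.
  have epv : ep <= v t / 2 by rewrite ge_min lexx orbT.
  suff [r vr] : exists r, v r = ep by apply: (nostraddle r); have := uv r; lra.
  have [t0|/ltW t0] := leP 0 t.
    have [|r _ vr] := @IVT R v 0 t ep t0 (@continuous_subspaceT _ _ _ v cv); last by exists r.
    by rewrite ge_min le_max; apply/andP; split; apply/orP; [left|right]; lra.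
  have [|r _ vr] := @IVT R v t 0 ep t0 (@continuous_subspaceT _ _ _ v cv); last by exists r.
  by rewrite ge_min le_max; apply/andP; split; apply/orP; [right|left]; lra.
have [eta [ts [eta0 ts0 Hts]]] := uniform_linear_growth.
have cNd : continuous (fun w => - d w) by move=> y; apply: cvgN; exact: cd.
have [h [k [B [hB hh hk _]]]] := corrector_exists fl cT cNd ts0 Hts.
have C0 : 0 <= C by case: (h2 0) => /(le_trans (normr_ge0 _)).
pose z t := (v t - u t) * expR (- h (s t w')).
have zup t : z t <= 2 * C * expR B.
  apply: ler_pM; [by have := uv t; lra|exact: expR_ge0| |].
    by case: (h2 t); rewrite !ler_norml -/(u t) -/(v t) => /andP[? ?] /andP[? ?] _; lra.
  by rewrite ler_expR; have := hB (s t w'); rewrite ler_norml => /andP[]; lra.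
have z0 t : 0 <= z t by apply: mulr_ge0; [have := uv t; lra|exact: expR_ge0].
pose rate := eta * (de * expR (- B)).
have rate0 : 0 < rate by rewrite !mulr_gt0 ?expR_gt0.
pose r := (2 * C * expR B + 1) / rate.
have CB0 : 0 <= 2 * C * expR B by rewrite !mulr_ge0 ?expR_ge0.
have r0 : 0 <= r by apply: divr_ge0; lra.
have : rate * r - rate * 0 <= z r - z 0.
  apply: (@derive_le_le _ (fun t => rate * t) z) => // t _.
  exists rate; eexists; split; first exact: is_derive_linf.
    exact: (is_derive_mulf (is_derive_subf (hv t) (hu t)) (is_derive_expf (is_derive_oppf (hh w' t)))).
  have ut0 : u t <= 0 by have := uv t; have := vneg t; lra.
  rewrite !truncatedE// (g0 _ (vneg t)) (g0 _ ut0) /=.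
  set E := expR _; set kk := k _; set dd := d _.
  have -> : (c (s t w') + dd * v t + 0 + l - (c (s t w') + dd * u t + 0 + l)) * E +
    (v t - u t) * (E * - kk) = (dd - kk) * ((v t - u t) * E) by ring.
  have hdk : eta <= dd - kk by have := hk (s t w'); rewrite -/kk -/dd; lra.
  rewrite /rate; apply: ler_pM => //; first exact: ltW.
    by rewrite mulr_ge0 ?expR_ge0// ltW.
  apply: ler_pM; [exact: ltW|exact: expR_ge0|exact: uv|].
  by rewrite /E ler_expR; have := hB (s t w'); rewrite ler_norml => /andP[]; lra.
have -> : rate * r = 2 * C * expR B + 1 by rewrite /r mulrCA divff ?mulr1// gt_eqF.
by have := zup r; have := z0 0; lra.
Qed.
End nondegenerate.

Definition base_field (w : T) (x : R) : R := c w + d w * x + g w x.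

Lemma base_field_bounded x : exists B : R, forall w, `|base_field w x| <= B.
Proof.
have cb : continuous (fun w => base_field w x).
  apply: continuous_addf.
    by apply: continuous_addf => //; apply: continuous_mulf => //; exact: continuous_cstf.
  by apply: (@continuous_comp2 _ _ _ _ g id (fun=> x)) => // w; [exact: cvg_id|exact: cvg_cst].
by have [B [_ HB]] := continuous_bounded cT cb; exists B.
Qed.

Lemma base_field_top (Lam : R) : exists2 C0 : R, 0 < C0 &
  forall w x l, l <= Lam -> C0 <= x -> base_field w x + l <= -1.
Proof.
have [Cc [Cc0 HCc]] := continuous_bounded cT cc.
have [X HX] := l3 (Cc + `|Lam| + 1).
have m0 : 0 <= Num.max X 0 by rewrite le_max lexx orbT.
have mX : X <= Num.max X 0 by rewrite le_max lexx.
exists (Num.max X 0 + 1) => [|w x l lL Cx]; first lra.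
have Xx : X < x by lra.
have h1 := HX x Xx w; have h2 := le_trans (ler_norm _) (HCc w); have h3 := ler_norm Lam.
rewrite /base_field; lra.
Qed.

Lemma linear_corrector : exists (eta : R) (h k : T -> R) (B : R), [/\ 0 < eta,
  forall w, `|h w| <= B, forall w (t : R), is_derive t 1 (fun t => h (s t w)) (k (s t w)),
  forall w, eta <= d w - k w & forall w, `|d w - k w| <= B].
Proof.
have [eta [ts [eta0 ts0 Hts]]] := uniform_linear_growth.
have cNd : continuous (fun w => - d w) by move=> w1; apply: cvgN; exact: cd.
have [h [k [B [hB hh hk hkB]]]] := corrector_exists fl cT cNd ts0 Hts.
exists eta, h, k, B; split => // w; first by have := hk w; lra.
by have := hkB w; rewrite distrC addrC.
Qed.

Lemma no_bounded_low : exists l, forall w, ~ OmegaB s (fun w x => base_field w x + l) w.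
Proof.
have [Cc [Cc0 HCc]] := continuous_bounded cT cc.
have [C0 C00 HC0] := base_field_top 0.
have [eta [h [k [B [eta0 hB hh hk hkB]]]]] := linear_corrector.
have B0 : 0 <= B by exact: le_trans (normr_ge0 _) (hB point).
have BC : 0 <= B * C0 by apply: mulr_ge0 => //; exact: ltW.
have eB := expR_gt0 B.
exists (- (Cc + B * C0) - expR B) => w [x /inBE[u [_ hu bu]]].
set l := - (Cc + B * C0) - expR B in hu.
have l0 : l <= 0 by rewrite /l; lra.
have uC : forall t, u t <= C0.
  by apply: bounded_below_barrier => // t; exists (base_field (s t w) (u t) + l) => // h1; exact: HC0.
pose z t := u t * expR (- h (s t w)).
have bz : bounded_orbit z.
  have [Mu HMu] := bu; exists (Mu * expR B) => t; rewrite normrM (ger0_norm (expR_ge0 _)).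
  apply: ler_pM; rewrite ?normr_ge0 ?expR_ge0// ler_expR.
  by have := hB (s t w); rewrite ler_norml => /andP[]; lra.
suff H : forall t, z t <= z 0 - 1 by have := H 0; lra.
apply: bounded_below_barrier => // t; eexists.
  exact: (is_derive_mulf (hu t) (is_derive_expf (is_derive_oppf (hh w t)))).
move=> _; have [E0 E1] : 0 < expR (- h (s t w)) /\ expR (- B) <= expR (- h (s t w)).
  split; first exact: expR_gt0.
  by rewrite ler_expR; have := hB (s t w); rewrite ler_norml => /andP[]; lra.
rewrite /base_field; set E := expR (- h _) in E0 E1 *.
have -> : (c (s t w) + d (s t w) * u t + g (s t w) (u t) + l) * E + u t * (E * - k (s t w)) =
  (c (s t w) + (d (s t w) - k (s t w)) * u t + g (s t w) (u t) + l) * E by ring.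
have h1 := le_trans (ler_norm _) (HCc (s t w)).
have h2 : (d (s t w) - k (s t w)) * u t <= B * C0.
  have dk0 : 0 <= d (s t w) - k (s t w) by exact: le_trans (ltW eta0) (hk _).
  have [u0|u0] := leP 0 (u t).
    by apply: ler_pM => //; exact: le_trans (ler_norm _) (hkB _).
  by apply: le_trans BC; rewrite mulr_ge0_le0// ltW.
have h3 := gle0 (s t w) (u t).
have h4 : c (s t w) + (d (s t w) - k (s t w)) * u t + g (s t w) (u t) + l <= - expR B.
  by rewrite /l; lra.
apply: le_trans (ler_wpM2r (ltW E0) h4) _; rewrite mulNr lerN2.
have <- : expR B * expR (- B) = 1 by rewrite -expRD subrr expR0.
by rewrite ler_pM2l.
Qed.

Lemma family_model (Lam N : R) : exists G M K e C, N <= M /\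
  local_model s base_field G Lam M K e C.
Proof.
have [Cc [Cc0 HCc]] := continuous_bounded cT cc.
have [C0 C00 HC0] := base_field_top Lam.
have [eta [h [k [B [eta0 hB hh hk hkB]]]]] := linear_corrector.
have hBu w : h w <= B by exact: le_trans (ler_norm _) (hB w).
have hBl w : - B <= h w by have := hB w; rewrite ler_norml => /andP[].
pose A := Cc + `|Lam|.
have A0 : 0 <= A by rewrite /A; have := normr_ge0 Lam; lra.
have cA w l : l <= Lam -> c w + l <= A.
  by move=> lL; rewrite /A; have := le_trans (ler_norm _) (HCc w); have := ler_norm Lam; lra.
pose L := (A * expR B + 1) / eta.
have AB : 0 <= A * expR B by rewrite mulr_ge0 ?expR_ge0.
have L0 : 0 < L by apply: divr_gt0 => //; lra.
have etaL : eta * L = A * expR B + 1 by rewrite /L mulrC divfK// gt_eqF.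
pose C := Num.max C0 (L * expR B).
have CC0 : C0 <= C by rewrite le_max lexx.
have CL : L * expR B <= C by rewrite le_max lexx orbT.
have Cpos : 0 < C by exact: lt_le_trans C00 CC0.
clearbody C.
pose M := Num.max (C + 1) N.
have MC : C + 1 <= M by rewrite le_max lexx.
have MN : N <= M by rewrite le_max lexx orbT.
clearbody M.
have M0 : 0 <= M by lra. have M0' : 0 < M by lra.
have [K [K1 HK]] := slope_bound M0.
pose G := truncated M K.
have GE w x : x <= M -> G w x = base_field w x by move=> xM; rewrite /G truncatedE.
have Gneg w x : x <= 0 -> G w x = c w + d w * x.
  by move=> x0; rewrite GE ?(le_trans x0)// /base_field g0// addr0.
have Gtop w x l : l <= Lam -> C0 <= x -> G w x + l <= -1.
  move=> lL Cx; have h1 : C0 <= Num.min x M by rewrite le_min Cx; lra.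
  have := HC0 w _ l lL h1.
  have h2 : 0 <= x - Num.min x M by rewrite subr_ge0 ge_min lexx.
  have h3 : 0 <= K * (x - Num.min x M) by rewrite mulr_ge0// (le_trans ler01 K1).
  rewrite /G /truncated /base_field; lra.
have up l w u : l <= Lam -> subsol s G l w u -> bounded_orbit u -> forall t, u t <= C0.
  move=> lL hu bu; apply: bounded_below_barrier => // t; have [d' hd dle] := hu t.
  by exists d' => // h1; apply: le_trans dle _; exact: Gtop.
have low l w u : l <= Lam -> subsol s G l w u -> bounded_orbit u ->
    forall t, - (L * expR (h (s t w))) <= u t.
  move=> lL hu bu.
  pose z t := u t * expR (- h (s t w)).
  suff H : forall t, rev_fun z t <= L.
    move=> t; have := H (- t); rewrite /rev_fun opprK /z => h1.
    have E0 := expR_gt0 (h (s t w)).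
    have := ler_wpM2r (ltW E0) h1; rewrite mulNr -mulrA -expRD addNr expR0 mulr1.
    by rewrite lerNl.
  apply: bounded_below_barrier.
    apply: bounded_orbit_rev; have [Mu HMu] := bu; exists (Mu * expR B) => t.
    rewrite normrM (ger0_norm (expR_ge0 _)).
    by apply: ler_pM; rewrite ?normr_ge0 ?expR_ge0// ler_expR; have := hBl (s t w); lra.
  move=> t; have [d' hd dle] := hu (- t); eexists.
    exact: (is_derive_rev_fun
      (is_derive_mulf hd (is_derive_expf (is_derive_oppf (hh w (- t)))))).
  rewrite /rev_fun /z /=; set wt := s (- t) w in dle *; set x := u (- t) in dle *.
  set E := expR (- h wt) => LE.
  have E0 : 0 < E by exact: expR_gt0.
  have x0 : x <= 0.
    by rewrite leNgt; apply/negP => x0; have := mulr_gt0 x0 E0; lra.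
  rewrite Gneg// in dle.
  have -> : d' * E + x * (E * - k wt) = (d' - k wt * x) * E by ring.
  have h1 : (d' - k wt * x) * E <= (A + (d wt - k wt) * x) * E.
    apply: ler_wpM2r; first exact: ltW.
    have h0 (a : R) : a <= c wt + d wt * x + l -> a - k wt * x <= A + (d wt - k wt) * x.
      by have := cA wt l lL; lra.
    exact: h0.
  apply: le_trans h1 _.
  have -> : (A + (d wt - k wt) * x) * E = A * E - (d wt - k wt) * - (x * E) by ring.
  have h2 : A * E <= A * expR B by rewrite ler_wpM2l// ler_expR; have := hBl wt; lra.
  have h3 : eta * L <= (d wt - k wt) * - (x * E) by apply: ler_pM => //; exact: ltW.
  lra.
have bnd l w u : l <= Lam -> subsol s G l w u -> bounded_orbit u -> forall t, `|u t| <= C.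
  move=> lL hu bu t; rewrite ler_norml (le_trans (up _ _ _ lL hu bu t) CC0) andbT.
  apply: le_trans (low _ _ _ lL hu bu t); rewrite lerN2; apply: le_trans CL.
  by rewrite ler_pM2l// ler_expR.
have adm : admissible s G K (concavity_defect M) Lam C.
  split => //.
  - exact: truncated_continuous.
  - by move=> w x y; exact: truncated_lipschitz.
  - by move=> w; exact: concavity_defect_ge0.
  - by move=> w x y z; exact: truncated_defect.
  - move=> eps eps0; have ce := concavity_defect_continuous M0.
    have [|ts [ts0 Hts]] := @uniform_average _ _ s _ eps fl cT ce.
      move=> m me; apply: le_lt_trans (concavity_defect_integral M0 me) _.
      by rewrite lte_fin.
    have [h' [k' [B' [q1 q2 q3 _]]]] := corrector_exists fl cT ce ts0 (fun w => ltW (Hts w)).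
    by exists h', k', B'.
  - move=> l w lL; exists (fun _ : R => C0); split.
    + move=> t; exists 0; first exact: is_derive_cstf.
      by apply: le_trans (Gtop _ _ _ lL (lexx C0)) _; rewrite lerN10.
    + by exists `|C0|.
    + by move=> u hu bu t; exact: up hu bu t.
  - move=> l w lL; exists (rev_fun (fun t => - (L * expR (h (s t w))))); split.
    + move=> t; eexists.
        exact: (is_derive_rev_fun
          (is_derive_oppf (is_derive_scalef L (is_derive_expf (hh w (- t)))))).
      rewrite /rev_field /rev_flow /rev_fun opprK; set wt := s (- t) w; set E := expR (h wt).
      have E0 : 0 < E by exact: expR_gt0.
      have LE : 0 <= L * E by rewrite mulr_ge0 ?ltW.
      rewrite Gneg ?oppr_le0//.
      suff : c wt + l <= (d wt - k wt) * (L * E) by lra.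
      apply: le_trans (cA _ _ lL) _.
      apply: le_trans (ler_wpM2r LE (hk wt)).
      rewrite mulrA etaL mulrDl -mulrA.
      suff : A * 1 <= A * (expR B * E) by rewrite mulr1; lra.
      rewrite ler_wpM2l// -expRD -expR0 ler_expR; have := hBl wt; lra.
    + exists (L * expR B) => t; rewrite /rev_fun opprK ger0_norm; last first.
        by rewrite mulr_ge0 ?expR_ge0// ltW.
      by rewrite ler_pM2l// ler_expR.
    + move=> u /subsol_rev; rewrite rev_flowK rev_fieldK => hu /bounded_orbit_rev bu t.
      by have := low _ _ _ lL hu bu (- t); rewrite /rev_fun !opprK lerN2.
exists G, M, K, (concavity_defect M), C; split => //; split => //.
  by move=> w x l lL Cx; apply: HC0 => //; exact: le_trans CC0 Cx.
move=> S l de cS Sinv lL de0 HS.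
have CM : C <= M by lra.
apply: (separated_persists (adm := adm) cS Sinv lL de0).
  move=> w Sw; have [u [v [hu hv bu bv uv]]] := HS w Sw; exists (u 0, v 0) => t /=.
  rewrite !phi_unique//; split => //.
    by exact: bnd lL (solution_subsol hu) bu t.
  by exact: bnd lL (solution_subsol hv) bv t.
by move=> w q Sw sep; exact: (separated_midgap CM M0' cS Sinv lL de0 Sw sep).
Qed.
End family.

(** * Bifurcation *)

Section near_pairs.
Context {X Y : topologicalType} (x : X) (y : Y) (P : X * Y -> Prop).

Lemma near_pair_fst : (\forall p \near (x, y), P p) -> \forall x' \near x, P (x', y).
Proof.
move=> [[A B] /= [hA hB] sub]; apply: filterS hA => x' Ax'; apply: sub; split => //.
exact: nbhs_singleton.
Qed.

Lemma near_pair_snd : (\forall p \near (x, y), P p) -> \forall y' \near y, P (x, y').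
Proof.
move=> [[A B] /= [hA hB] sub]; apply: filterS hB => y' By'; apply: sub; split => //.
exact: nbhs_singleton.
Qed.

Lemma near_pair_swap : (\forall p \near (x, y), P p) ->
  \forall y' \near y & x' \near x, P (x', y').
Proof.
move=> [[A B] /= [hA hB] sub]; exists (B, A) => //= -[y' x'] [/= hb ha].
exact: (sub (x', y')).
Qed.
End near_pairs.

Lemma near_fst_le {R : realType} {Y : topologicalType} (l : R) (y : Y) :
  \forall p \near (l, y), p.1 <= l + 1.
Proof.
exists ([set z | z <= l + 1], setT) => [|[a b] []//].
split; last exact: filterT.
by apply: filterS (lt_nbhsl (_ : l < l + 1)); [move=> z; exact: ltW|rewrite ltrDl].
Qed.

Section repeller.
Context {R : realType} {T : pseudoPMetricType R} (s : R -> T -> T) (G : T -> R -> R).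
Context (K : R) (e : T -> R) (Lam C : R).
Hypothesis adm : admissible s G K e Lam C.
Implicit Types (l t x : R) (w : T) (u v : R -> R).

Let fl := adm_flow adm.
Let radm := admissible_rev adm.
Local Notation Gl l := (fun w x => G w x + l).
Local Notation am l := (amax s (Gl l)).
Local Notation rm l := (rmin s (Gl l)).
Local Notation OB l := (OmegaB s (Gl l)).

Lemma amax_gap_fibre l0 l w : l0 < l -> l <= Lam -> OB l0 w ->
  (l - l0) / K <= am l w - am l0 w.
Proof.
move=> l0l lL ob; have l0L : l0 <= Lam by lra.
have := amax_gap adm l0l lL (solution_subsol (amax_solution adm l0L ob))
  (amax_bounded adm l0L ob) 0.
by rewrite fl.2.1.
Qed.

Lemma amax_hyperbolic (S : set T) l0 l : l0 < l -> l <= Lam -> (forall w, S w -> OB l0 w) ->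
  exists rho k gam : R, [/\ 0 < rho, 1 <= k, 0 < gam, k * rho <= 1 & forall w u t, S w ->
    solution s G l w u -> `|u 0 - am l w| < rho -> 0 <= t ->
    `|u t - am l (s t w)| <= k * expR (- (gam * t)) * `|u 0 - am l w|].
Proof.
move=> l0l lL HS; have [ga [B [ga0 B0 H]]] := attraction adm l0l lL.
have K0 : 0 < K := lt_le_trans ltr01 (adm_K1 adm).
pose de := (l - l0) / K / 2; have de0 : 0 < de by rewrite !divr_gt0// subr_gt0.
have deE : (l - l0) / K = de + de by rewrite /de -splitr.
clearbody de.
pose k := Num.max 1 (B / de); have k1 : 1 <= k by rewrite le_max lexx.
have kB : B / de <= k by rewrite le_max lexx orbT.
clearbody k; have k0 : 0 < k by exact: lt_le_trans ltr01 k1.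
exists (Num.min de k^-1), k, ga; split => //.
- by rewrite lt_min de0 invr_gt0.
- have : k * Num.min de k^-1 <= k * k^-1 by rewrite ler_pM2l// ge_min lexx orbT.
  by rewrite divff ?gt_eqF.
- move=> w u t Sw hu; rewrite lt_min => /andP[ud _] t0.
  have g0 := amax_gap_fibre l0l lL (HS _ Sw).
  have h : de <= u 0 - am l0 (s 0 w).
    by rewrite fl.2.1; move: ud; rewrite ltr_norml => /andP[]; lra.
  have h' : de <= (l - l0) / K by lra.
  have := H de w u 0 t (HS _ Sw) hu de0 h' h t0; rewrite subr0 fl.2.1 => hH.
  apply: le_trans hH _; apply: ler_wpM2r => //.
  by apply: ler_wpM2r => //; exact: expR_ge0.
Qed.

Lemma amax_within (S : set T) l0 l : l0 < l -> l <= Lam -> (forall w, S w -> OB l0 w) ->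
  {within S, continuous (am l)}.
Proof.
move=> l0l lL HS; apply/subspace_continuousP => w Sw; apply/cvgrPdist_lt => ep ep0.
have := near_pair_snd (amax_near adm HS l0l lL Sw ep0); apply: filterS => w' /= h Sw'.
by rewrite distrC; exact: h.
Qed.

Let obr l w : OB l w -> OmegaB (rev_flow s) (fun w x => rev_field G w x + l) w.
Proof. by rewrite OmegaB_rev. Qed.

Lemma rmin_solution l w : l <= Lam -> OB l w -> solution s G l w (fun t => rm l (s t w)).
Proof.
move=> lL ob; have := solution_rev (amax_solution radm lL (obr ob)).
rewrite rev_flowK rev_fieldK (_ : rev_fun _ = fun t => rm l (s t w))//; apply/funext => t.
by rewrite /rev_fun amax_rev opprK /rev_flow opprK.
Qed.

Lemma rmin_bound l w : l <= Lam -> OB l w -> `|rm l w| <= C.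
Proof. by move=> lL ob; have := amax_bound radm lL (obr ob); rewrite amax_rev normrN. Qed.

Lemma rmin_bounded l w : l <= Lam -> OB l w -> bounded_orbit (fun t => rm l (s t w)).
Proof.
by move=> lL ob; exists C => t; apply: rmin_bound => //; exact: (OmegaB_shift adm).
Qed.

Lemma rmin_le_amax l w : l <= Lam -> OB l w -> rm l w <= am l w.
Proof.
move=> lL [x hx]; apply: (@le_trans _ _ x); last exact: (amax_ge adm lL hx).
by have := amax_ge radm lL (inB_rev hx); rewrite amax_rev lerN2.
Qed.

Lemma rmin_near (S : set T) l0 l1 w1 (ep : R) : (forall w, S w -> OB l0 w) ->
  l0 < l1 -> l1 <= Lam -> S w1 -> 0 < ep ->
  \forall p \near (l1, w1), p.1 <= Lam -> l0 < p.1 -> S p.2 ->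
    `|rm p.1 p.2 - rm l1 w1| < ep.
Proof.
move=> HS l01 l1L Sw1 ep0.
have HS' w : S w -> OmegaB (rev_flow s) (fun w x => rev_field G w x + l0) w.
  by move=> /HS; exact: obr.
apply: filterS (amax_near radm HS' l01 l1L Sw1 ep0) => p h h1 h2 h3.
by have := h h1 h2 h3; rewrite !amax_rev -opprD normrN.
Qed.
End repeller.

Section transfer.
Context {R : realType} {T : pseudoPMetricType R} (s : R -> T -> T) (F G : T -> R -> R).
Context (Lam M K : R) (e : T -> R) (C : R).
Hypothesis lm : local_model s F G Lam M K e C.
Implicit Types (l t x : R) (w : T) (u v : R -> R).

Let adm := lm_adm lm.
Let CM : C <= M. Proof. by have := lm_CM lm; lra. Qed.
Local Notation Fl l := (fun w x => F w x + l).
Local Notation Gl l := (fun w x => G w x + l).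

Lemma model_inB l w x : l <= Lam -> (inB s (Fl l) w x <-> inB s (Gl l) w x).
Proof.
move=> lL; split=> /inBE[u [u0 hu bu]]; apply/inBE; exists u; split => // t.
  have uC : forall t, u t <= C.
    apply: bounded_below_barrier => // r; exists (F (s r w) (u r) + l) => // h1.
    exact: (lm_top lm).
  rewrite (lm_eq lm); first exact: hu.
  exact: le_trans (uC t) CM.
rewrite -(lm_eq lm); first exact: hu.
apply: le_trans CM; apply: le_trans (ler_norm _) _.
exact: (adm_bounded adm lL (solution_subsol hu) bu).
Qed.

Let model_fibre l w : l <= Lam -> [set x | inB s (Fl l) w x] = [set x | inB s (Gl l) w x].
Proof. by move=> lL; apply/seteqP; split=> x /(model_inB w x lL). Qed.

Lemma model_amax l : l <= Lam -> amax s (Fl l) = amax s (Gl l).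
Proof. by move=> lL; apply/funext => w; rewrite /amax model_fibre. Qed.

Lemma model_rmin l : l <= Lam -> rmin s (Fl l) = rmin s (Gl l).
Proof. by move=> lL; apply/funext => w; rewrite /rmin model_fibre. Qed.

Lemma model_OmegaB l : l <= Lam -> OmegaB s (Fl l) = OmegaB s (Gl l).
Proof.
by move=> lL; apply/seteqP; split=> w [x /(model_inB w x lL) h]; exists x.
Qed.

Lemma model_solution l w u t : solution s G l w u -> u t <= M ->
  is_derive t 1 u (F (s t w) (u t) + l).
Proof. by move=> hu ut; rewrite -(lm_eq lm). Qed.

Lemma model_comparison l w u v a b : a <= b ->
  (forall t, a <= t <= b -> is_derive t 1 u (F (s t w) (u t) + l)) ->
  (forall t, a <= t <= b -> u t <= M) -> solution s G l w v ->
  [/\ u a <= v a -> u b <= v b, v a <= u a -> v b <= u b,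
      u b <= v b -> u a <= v a & v b <= u b -> v a <= u a].
Proof.
move=> ab hu uM hv; have LG := adm_lip adm.
have hu' t : a <= t <= b -> is_derive t 1 u (G (s t w) (u t) + l).
  by move=> ht; rewrite (lm_eq lm) ?uM//; exact: hu.
have s1 t : a <= t <= b -> exists2 d, is_derive t 1 u d & d <= G (s t w) (u t) + l.
  by move=> ht; exists (G (s t w) (u t) + l) => //; exact: hu'.
have s2 t : a <= t <= b -> exists2 d, is_derive t 1 u d & G (s t w) (u t) + l <= d.
  by move=> ht; exists (G (s t w) (u t) + l) => //; exact: hu'.
have v1 t : a <= t <= b -> exists2 d, is_derive t 1 v d & d <= G (s t w) (v t) + l.
  by move=> _; exact: (solution_subsol hv).
have v2 t : a <= t <= b -> exists2 d, is_derive t 1 v d & G (s t w) (v t) + l <= d.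
  by move=> _; exact: (solution_supersol hv).
split; [exact: (comparison_on LG ab s1 v2)|exact: (comparison_on LG ab v1 s2)|
  exact: (comparison_back_on LG ab v1 s2)|exact: (comparison_back_on LG ab s1 v2)].
Qed.
End transfer.

Section bifurcation.
Context {R : realType} {T : pseudoPMetricType R} (s : R -> T -> T) (F : T -> R -> R).
Hypotheses (cT : compact [set: T]) (fl : is_flow s).
Hypothesis models : forall Lam N, exists G M K e C, N <= M /\ local_model s F G Lam M K e C.
Hypothesis F_bounded : forall x, exists B : R, forall w, `|F w x| <= B.
Implicit Types (l t x : R) (w : T) (u v : R -> R) (S : set T).

Local Notation Fl l := (fun w x => F w x + l).
Local Notation am l := (amax s (Fl l)).
Local Notation rm l := (rmin s (Fl l)).
Local Notation OB l := (OmegaB s (Fl l)).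

Lemma boundable_mono l l' w : l <= l' -> OB l w -> OB l' w.
Proof.
move=> ll; have [G [M [K [e [C [_ lm]]]]]] := models l' 0.
rewrite (model_OmegaB lm ll) (model_OmegaB lm (lexx l')).
exact: (OmegaB_mono (lm_adm lm) ll (lexx l')).
Qed.

Lemma boundable_shift l w t : OB l w -> OB l (s t w).
Proof.
have [G [M [K [e [C [_ lm]]]]]] := models l 0; rewrite (model_OmegaB lm (lexx l)).
exact: (OmegaB_shift (lm_adm lm)).
Qed.

Lemma extremal_bound l : exists C : R, forall w, OB l w -> `|am l w| <= C /\ `|rm l w| <= C.
Proof.
have [G [M [K [e [C [_ lm]]]]]] := models l 0; exists C => w.
rewrite (model_OmegaB lm (lexx l)) (model_amax lm (lexx l)) (model_rmin lm (lexx l)) => ob.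
by split; [exact: (amax_bound (lm_adm lm))|exact: (rmin_bound (lm_adm lm))].
Qed.

Lemma extremal_le l w : OB l w -> rm l w <= am l w.
Proof.
have [G [M [K [e [C [_ lm]]]]]] := models l 0.
rewrite (model_OmegaB lm (lexx l)) (model_amax lm (lexx l)) (model_rmin lm (lexx l)).
exact: (rmin_le_amax (lm_adm lm)).
Qed.

Lemma extremal_gap l0 l : l0 < l -> exists2 de : R, 0 < de & forall w, OB l0 w ->
  de <= am l w - am l0 w /\ de <= rm l0 w - rm l w.
Proof.
move=> l0l; have [G [M [K [e [C [_ lm]]]]]] := models l 0; have adm := lm_adm lm.
exists ((l - l0) / K).
  by rewrite divr_gt0 ?subr_gt0// (lt_le_trans ltr01)// (adm_K1 adm).
move=> w; rewrite (model_OmegaB lm (ltW l0l)) !(model_amax lm (ltW l0l)) !(model_rmin lm (ltW l0l)).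
rewrite (model_amax lm (lexx l)) (model_rmin lm (lexx l)) => ob; split.
  exact: (amax_gap_fibre adm).
have ob' : OmegaB (rev_flow s) (fun w x => rev_field G w x + l0) w by rewrite OmegaB_rev.
have := amax_gap_fibre (admissible_rev adm) l0l (lexx l) ob'.
by rewrite !amax_rev; lra.
Qed.

Lemma extremal_separated l0 l : l0 < l -> exists2 de : R, 0 < de & forall w, OB l0 w ->
  de <= am l w - rm l w.
Proof.
move=> /extremal_gap[de de0 H]; exists de => // w ob.
by have [h1 h2] := H w ob; have := extremal_le ob; lra.
Qed.

Lemma boundable_high N : exists L : R, forall l w, L <= l ->
  [/\ OB l w, N <= am l w & rm l w <= - N].
Proof.
have [B1 H1] := F_bounded N; have [B2 H2] := F_bounded (- N).
exists (Num.max B1 B2) => l w; rewrite ge_max => /andP[l1 l2].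
have [G [M [K [e [C [NM lm]]]]]] := models l `|N|; have adm := lm_adm lm.
have N1 : N <= M by exact: le_trans (ler_norm _) NM.
have N2 : - N <= M by rewrite -normrN in NM; exact: le_trans (ler_norm _) NM.
have sb (y B : R) : y <= M -> (forall w, `|F w y| <= B) -> B <= l -> subsol s G l w (fun=> y).
  move=> yM HB Bl t; exists 0; first exact: is_derive_cstf.
  by rewrite (lm_eq lm)//; have := HB (s t w); rewrite ler_norml => /andP[]; lra.
have b1 (y : R) : bounded_orbit (fun _ : R => y) by exists `|y|.
have [ob /(_ 0)] := subsol_le_amax adm (lexx l) (sb _ _ N1 H1 l1) (b1 N).
have [_ /(_ 0)] := subsol_le_amax (admissible_rev adm) (lexx l)
  (subsol_rev (sb _ _ N2 H2 l2)) (bounded_orbit_rev (b1 (- N))).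
rewrite amax_rev /rev_fun /rev_flow oppr0 fl.2.1 opprK => h2 h1.
rewrite (model_OmegaB lm (lexx l)) (model_amax lm (lexx l)) (model_rmin lm (lexx l)).
by split => //; lra.
Qed.

Lemma attractor_repeller S l0 l : l0 < l -> (forall w, S w -> OB l0 w) ->
  attractor_repeller_on s S (Fl l) (am l) (rm l).
Proof.
move=> l0l HS; have [G [M [K [e [C [_ lm]]]]]] := models l 0; have adm := lm_adm lm.
have radm := admissible_rev adm; have CM := lm_CM lm.
rewrite (model_amax lm (lexx l)) (model_rmin lm (lexx l)).
have HG w : S w -> OmegaB s (fun w x => G w x + l0) w.
  by move=> /HS; rewrite (model_OmegaB lm (ltW l0l)).
have HR w : S w -> OmegaB (rev_flow s) (fun w x => rev_field G w x + l0) w.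
  by move=> /HG; rewrite OmegaB_rev.
have HGl w : S w -> OmegaB s (fun w x => G w x + l) w.
  by move=> /HG; exact: (OmegaB_mono adm (ltW l0l) (lexx l)).
have amC w t : S w -> amax s (fun w x => G w x + l) (s t w) <= C.
  move=> Sw; apply: le_trans (ler_norm _) _.
  exact: (amax_bound adm (lexx l) (OmegaB_shift adm t (HGl w Sw))).
have rmC w t : S w -> rmin s (fun w x => G w x + l) (s t w) <= C.
  move=> Sw; apply: le_trans (ler_norm _) _.
  exact: (rmin_bound adm (lexx l) (OmegaB_shift adm t (HGl w Sw))).
have small (k gam t rho y : R) : 1 <= k -> k * rho <= 1 -> 0 < gam -> t <= 0 -> `|y| < rho ->
    k * expR (gam * t) * `|y| <= 1.
  move=> k1 kr g0 t0 yr; apply: le_trans kr; rewrite -mulrA; apply: ler_wpM2l; first lra.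
  rewrite -[leRHS]mul1r; apply: ler_pM; [exact: expR_ge0|exact: normr_ge0| |exact: ltW].
  by rewrite -expR0 ler_expR mulr_ge0_le0// ltW.
split; [|split; [|split]].
- split; first exact: (amax_within adm l0l).
  move=> w Sw; split; first by rewrite fl.2.1.
  move=> t _; have := amC w t Sw => aC.
  by apply: (model_solution lm (amax_solution adm (lexx l) (HGl w Sw))); lra.
- have [rho [k [gam [r0 k1 g0 kr H]]]] := amax_hyperbolic adm l0l (lexx l) HG.
  exists rho, k, gam; split => //; split => //; split => // w Sw x xa.
  have [u [hu u0]] := solution_through adm l w 0 x.
  have Hu t : 0 <= t -> `|u t - amax s (fun w x => G w x + l) (s t w)| <=
      k * expR (- (gam * t)) * `|x - amax s (fun w x => G w x + l) w|.
    by move=> t0; have := H w u t Sw hu; rewrite u0; apply.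
  exists u; split => //; split => // t t0.
  apply: (model_solution lm hu).
  have tn : - t <= 0 by rewrite oppr_le0.
  have := small k gam (- t) rho _ k1 kr g0 tn xa; rewrite mulrN => h1.
  have := le_trans (ler_norm _) (le_trans (Hu t t0) h1).
  by have := amC w t Sw; lra.
- split.
    apply/subspace_continuousP => w Sw; apply/cvgrPdist_lt => ep ep0.
    have := near_pair_snd (rmin_near adm HG l0l (lexx l) Sw ep0); apply: filterS => w' /= h Sw'.
    by rewrite distrC; exact: h.
  move=> w Sw; split; first by rewrite fl.2.1.
  move=> t _; have := rmC w t Sw => aC.
  by apply: (model_solution lm (rmin_solution adm (lexx l) (HGl w Sw))); lra.
- have [rho [k [gam [r0 k1 g0 kr H]]]] := amax_hyperbolic radm l0l (lexx l) HR.
  exists rho, k, gam; split => //; split => //; split => // w Sw x xa.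
  have [u [hu u0]] := solution_through adm l w 0 x.
  have E (a b : R) : `|- a + b| = `|a - b| by rewrite -normrN opprD opprK.
  have Hu t : t <= 0 -> `|u t - rmin s (fun w x => G w x + l) (s t w)| <=
      k * expR (gam * t) * `|x - rmin s (fun w x => G w x + l) w|.
    move=> t0; have := H w _ (- t) Sw (solution_rev hu).
    rewrite !amax_rev /rev_fun /rev_flow oppr0 u0 [- - t]opprK.
    move: (rmin s (fun w x => G w x + l) w) xa (rmin s (fun w x => G w x + l) (s t w)).
    move=> b0 xa b1; rewrite !opprK !E mulrN opprK.
    by apply => //; rewrite oppr_ge0.
  exists u; split => //; split => // t t0.
  apply: (model_solution lm hu).
  have := le_trans (ler_norm _) (le_trans (Hu t t0) (small _ _ _ _ _ k1 kr g0 t0 xa)).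
  by have := rmC w t Sw; lra.
Qed.

(* A point just above the attractor is drawn to both copies if they are closer than the radius
   of attraction; following it back by repulsion contradicts its initial distance to [rm l]. *)
Lemma hyperbolic_gap S l : (forall t w, S w -> S (s t w)) -> (forall w, S w -> OB l w) ->
  attractor_repeller_on s S (Fl l) (am l) (rm l) ->
  exists2 de : R, 0 < de & forall w, S w -> de <= am l w - rm l w.
Proof.
move=> Sinv HS [_ [[rho1 [k1 [g1 [r10 [k11 [g10 H1]]]]]]
  [_ [rho2 [k2 [g2 [r20 [k21 [g20 H2]]]]]]]]].
have [C1 HC1] := extremal_bound l.
have kr1 : 0 < k1 * rho1 by rewrite mulr_gt0//; lra.
have kr2 : 0 < k2 * rho2 by rewrite mulr_gt0//; lra.
have [G [M [K [e [C [NM lm]]]]]] := models l (C1 + k1 * rho1 + k2 * rho2).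
exists rho1 => // w Sw; rewrite leNgt; apply/negP => gap.
have le1 (g t : R) : 0 < g -> t <= 0 -> expR (g * t) <= 1.
  by move=> g0 t0; rewrite -expR0 ler_expR mulr_ge0_le0// ltW.
have small (k g t rho y : R) : 1 <= k -> 0 < g -> t <= 0 -> `|y| < rho ->
    k * expR (g * t) * `|y| <= k * rho.
  move=> h1 h2 h3 h4; rewrite -mulrA; apply: ler_wpM2l; first lra.
  rewrite -[leRHS]mul1r; apply: ler_pM; [exact: expR_ge0|exact: normr_ge0| |exact: ltW].
  exact: le1.
have fwd v : solution s G l w v -> `|v 0 - am l w| < rho1 -> forall t, 0 <= t ->
    `|v t - am l (s t w)| <= k1 * expR (- (g1 * t)) * rho1.
  move=> hv xa t t0; have [u [[u0 hu] ub]] := H1 w Sw _ xa.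
  have uM r : 0 <= r <= t -> u r <= M.
    move=> /andP[rr _]; have rn : - r <= 0 by rewrite oppr_le0.
    have := small _ _ _ _ _ k11 g10 rn xa; rewrite mulrN => h1.
    have := le_trans (ler_norm _) (le_trans (ub r rr) h1).
    have [/(le_trans (ler_norm _)) h2 _] := HC1 (s r w) (boundable_shift r (HS w Sw)).
    by lra.
  have hu' r : 0 <= r <= t -> is_derive r 1 u (F (s r w) (u r) + l).
    by move=> /andP[rr _]; exact: hu.
  have [c1 c2 _ _] := model_comparison lm t0 hu' uM hv.
  have uv : u t = v t by apply: le_anti; rewrite c1 ?c2 ?u0.
  rewrite -uv; apply: le_trans (ub t t0) _; apply: ler_wpM2l; last exact: ltW.
  by rewrite mulr_ge0 ?expR_ge0//; lra.
have rsol : solution s G l w (fun t => rm l (s t w)).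
  rewrite (model_rmin lm (lexx l)); apply: (rmin_solution (lm_adm lm) (lexx l)).
  by rewrite -(model_OmegaB lm (lexx l)); exact: HS.
have ra := extremal_le (HS w Sw).
have [v [hv v0]] := solution_through (lm_adm lm) l w 0 (am l w + rho1 / 2).
pose de := Num.min (rho2 / 2) (rho1 / (4 * k2)).
have de0 : 0 < de by rewrite lt_min !divr_gt0//; lra.
have kk0 : 0 <= 2 * (k1 * rho1) by lra.
have [t [t0 Ht]] := exp_below kk0 g10 de0.
have {Ht} := Ht t (lexx t); rewrite le_min => /andP[ht1 ht2].
have h1 : `|v t - am l (s t w)| <= k1 * expR (- (g1 * t)) * rho1.
  by apply: fwd => //; rewrite v0 addrC addKr ger0_norm; lra.
have h2 : `|rm l (s t w) - am l (s t w)| <= k1 * expR (- (g1 * t)) * rho1.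
  by apply: (fwd _ rsol) => //; rewrite fl.2.1 distrC ger0_norm; lra.
have D : `|v t - rm l (s t w)| <= 2 * (k1 * rho1) * expR (- (g1 * t)).
  have -> : v t - rm l (s t w) =
    (v t - am l (s t w)) - (rm l (s t w) - am l (s t w)) by ring.
  apply: le_trans (ler_normB _ _) _; lra.
have D2 : `|v t - rm l (s t w)| < rho2 by lra.
have [u [[u0 hu] ub]] := H2 _ (Sinv t w Sw) _ D2.
have tn : - t <= 0 by rewrite oppr_le0.
have uM r : - t <= r <= 0 -> u r <= M.
  move=> /andP[_ rr].
  have := le_trans (ler_norm _) (le_trans (ub r rr) (small _ _ _ _ _ k21 g20 rr D2)).
  have [_ /(le_trans (ler_norm _)) h3] :=
    HC1 (s r (s t w)) (boundable_shift r (boundable_shift t (HS w Sw))).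
  by lra.
have hu' r : - t <= r <= 0 -> is_derive r 1 u (F (s r (s t w)) (u r) + l).
  by move=> /andP[_ rr]; exact: hu.
have [_ _ c3 c4] := model_comparison lm tn hu' uM (solution_shift fl t hv).
have uv : u (- t) = am l w + rho1 / 2.
  by rewrite -v0 -(addNr t); apply: le_anti; rewrite c3 ?c4 ?u0 ?add0r.
have := ub _ tn; rewrite -fl.2.2 addNr fl.2.1 uv.
have h3 : k2 * expR (g2 * - t) * `|v t - rm l (s t w)| <= k2 * (rho1 / (4 * k2)).
  rewrite -mulrA; apply: ler_wpM2l; first lra.
  rewrite -[leRHS]mul1r; apply: ler_pM; [exact: expR_ge0|exact: normr_ge0|exact: le1|].
  exact: le_trans D ht2.
have h4 : k2 * (rho1 / (4 * k2)) = rho1 / 4.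
  have k20 : k2 != 0 by rewrite gt_eqF//; lra.
  by field.
rewrite h4 in h3; move=> /(le_trans (ler_norm _)) h5.
have := le_trans h5 h3; lra.
Qed.

Lemma gap_persists S l (de : R) : closed S -> (forall t w, S w -> S (s t w)) ->
  (forall w, S w -> OB l w) -> 0 < de -> (forall w, S w -> de <= am l w - rm l w) ->
  exists2 l', l' < l & forall w, S w -> OB l' w.
Proof.
move=> cS Sinv HS de0 Hde.
have [G [M [K [e [C [_ lm]]]]]] := models l 0; have adm := lm_adm lm.
have [|ep ep0 H] := lm_persist lm cS Sinv (lexx l) de0.
  move=> w Sw; have ob : OmegaB s (fun w x => G w x + l) w.
    by rewrite -(model_OmegaB lm (lexx l)); exact: HS.
  exists (fun t => rm l (s t w)), (fun t => am l (s t w)); split; last first.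
    by move=> t; apply: Hde; exact: Sinv.
  - by rewrite (model_amax lm (lexx l)); exact: (amax_bounded adm (lexx l)).
  - by rewrite (model_rmin lm (lexx l)); exact: (rmin_bounded adm (lexx l)).
  - by rewrite (model_amax lm (lexx l)); exact: (amax_solution adm (lexx l)).
  - by rewrite (model_rmin lm (lexx l)); exact: (rmin_solution adm (lexx l)).
have ll : l - ep < l by lra.
by exists (l - ep) => // w Sw; rewrite (model_OmegaB lm (ltW ll)); exact: H.
Qed.

Lemma not_boundable_near l w : ~ OB l w -> \forall p \near (l, w), ~ OB p.1 p.2.
Proof.
have [G [M [K [e [C [_ lm]]]]]] := models (l + 1) 0; have adm := lm_adm lm.
have ll : l <= l + 1 by lra.
rewrite (model_OmegaB lm ll) => nob.
apply: filterS2 (not_OmegaB_near adm ll nob) (near_fst_le l w) => p h pl.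
by rewrite (model_OmegaB lm pl); exact: h.
Qed.

Lemma boundable_closed l : closed (OB l).
Proof.
rewrite -[OB l]setCK; apply: open_closedC; rewrite openE => w hw.
exact: (near_pair_snd (not_boundable_near hw)).
Qed.

Lemma orbit_closure_boundable l w : OB l w -> orbit_closure s w `<=` OB l.
Proof.
move=> ob; apply: subset_trans (@boundable_closed l); apply: closure_subset.
by move=> _ [t _ <-]; exact: boundable_shift.
Qed.

Lemma orbit_closure_self w : orbit_closure s w w.
Proof. by apply: subset_closure; exists 0 => //; rewrite fl.2.1. Qed.

Lemma orbit_closure_invariant w t w' : orbit_closure s w w' -> orbit_closure s w (s t w').
Proof.
move=> h B hB; have [_ [[r _ <-] hr]] := h _ (@flow_continuous _ _ s t fl w' _ hB).
by exists (s t (s r w)); split => //; exists (t + r) => //; rewrite fl.2.2.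
Qed.

Lemma attractor_repellerP S l : closed S -> (forall t w, S w -> S (s t w)) ->
  (exists2 l0, l0 < l & forall w, S w -> OB l0 w) <->
  S `<=` OB l /\ attractor_repeller_on s S (Fl l) (am l) (rm l).
Proof.
move=> cS Sinv; split=> [[l0 l0l HS]|[HS AR]].
  split; last exact: (attractor_repeller l0l HS).
  by move=> w /HS; exact: (boundable_mono (ltW l0l)).
have [de de0 Hde] := hyperbolic_gap Sinv HS AR.
exact: (gap_persists cS Sinv HS de0 Hde).
Qed.

Lemma basin_forward l0 l w x : l0 < l -> OB l0 w ->
  (exists u, is_sol s (Fl l) w x [set t | 0 <= t] u /\
    cvg_pinfty (fun t => u t - am l (s t w)) 0) <-> rm l w < x.
Proof.
move=> l0l ob; have obl := boundable_mono (ltW l0l) ob; split.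
  move=> [u [[u0 hu] cv]]; rewrite ltNge; apply/negP => xr.
  have [de de0 Hde] := extremal_separated l0l.
  have [t1 [_ Ht1]] := cvgr0_norm_lt _ cv _ de0.
  pose t2 := Num.max t1 0 + 1.
  have m1 : t1 <= Num.max t1 0 by rewrite le_max lexx.
  have m2 : 0 <= Num.max t1 0 by rewrite le_max lexx orbT.
  have t12 : t1 < t2 by rewrite /t2; lra.
  have t20 : 0 <= t2 by rewrite /t2; lra.
  clearbody t2.
  have cu : {within `[0, t2], continuous u}.
    apply: continuous_in_subspaceT => r; rewrite inE/= in_itv/= => /andP[rr _].
    exact: is_derive_continuous (hu r rr).
  have [z _ Hz] := EVT_max t20 cu.
  have [G [M [K [e [C [NM lm]]]]]] := models l (u z).
  have rsol : solution s G l w (fun t => rm l (s t w)).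
    rewrite (model_rmin lm (lexx l)); apply: (rmin_solution (lm_adm lm) (lexx l)).
    by rewrite -(model_OmegaB lm (lexx l)).
  have uM r : 0 <= r <= t2 -> u r <= M.
    by move=> rr; apply: le_trans NM; apply: Hz; rewrite in_itv.
  have hu' r : 0 <= r <= t2 -> is_derive r 1 u (F (s r w) (u r) + l).
    by move=> /andP[rr _]; exact: hu.
  have [c1 _ _ _] := model_comparison lm t20 hu' uM rsol.
  rewrite fl.2.1 u0 in c1; have := c1 xr.
  have := Ht1 t2 t12; rewrite /= ltr_norml => /andP[].
  have := Hde _ (boundable_shift t2 ob); lra.
move=> rx; have [G [M [K [e [C [NM lm]]]]]] := models l x; have adm := lm_adm lm.
have [u [hu u0]] := solution_through adm l w 0 x.
have obG : OmegaB s (fun w x => G w x + l) w by rewrite -(model_OmegaB lm (lexx l)).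
have ob0G : OmegaB s (fun w x => G w x + l0) w by rewrite -(model_OmegaB lm (ltW l0l)).
pose m := Num.max x C; have xm : x <= m by rewrite le_max lexx.
have Cm : C <= m by rewrite le_max lexx orbT.
have mM : m <= M by rewrite ge_max NM; have := lm_CM lm; lra.
have um t : 0 <= t -> u t <= m.
  move=> t0; have sup : supersol s G l w (fun=> m).
    move=> r; exists 0; first exact: is_derive_cstf.
    by rewrite (lm_eq lm)//; have := lm_top lm (s r w) (lexx l) Cm; lra.
  by apply: (comparison (adm_lip adm) t0 (solution_subsol hu) sup); rewrite u0.
rewrite (model_amax lm (lexx l)); rewrite (model_rmin lm (lexx l)) in rx.
exists u; split.
  split => // t t0; apply: (model_solution lm hu); exact: le_trans (um t t0) mM.
rewrite /cvg_pinfty; apply/cvgrPdist_le => ep ep0 /=.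
have [|t0 Ht] := amax_basin adm l0l (lexx l) ob0G (rmin_solution adm (lexx l) obG)
  (rmin_bounded adm (lexx l) obG) hu _ ep0; first by rewrite fl.2.1 u0.
exists t0; split; first exact: num_real.
by move=> t tt /=; rewrite sub0r normrN; apply: Ht; exact: ltW.
Qed.

Lemma basin_backward l0 l w x : l0 < l -> OB l0 w ->
  (exists u, is_sol s (Fl l) w x [set t | t <= 0] u /\
    cvg_ninfty (fun t => u t - rm l (s t w)) 0) <-> x < am l w.
Proof.
move=> l0l ob; have obl := boundable_mono (ltW l0l) ob; split.
  move=> [u [[u0 hu] cv]]; rewrite ltNge; apply/negP => xr.
  have [de de0 Hde] := extremal_separated l0l.
  have [t1 [_ Ht1]] := cvgr0_norm_lt _ cv _ de0.
  pose t2 := Num.min t1 0 - 1.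
  have m1 : Num.min t1 0 <= t1 by rewrite ge_min lexx.
  have m2 : Num.min t1 0 <= 0 by rewrite ge_min lexx orbT.
  have t12 : t2 < t1 by rewrite /t2; lra.
  have t20 : t2 <= 0 by rewrite /t2; lra.
  clearbody t2.
  have cu : {within `[t2, 0], continuous u}.
    apply: continuous_in_subspaceT => r; rewrite inE/= in_itv/= => /andP[_ rr].
    exact: is_derive_continuous (hu r rr).
  have [z _ Hz] := EVT_max t20 cu.
  have [G [M [K [e [C [NM lm]]]]]] := models l (u z).
  have rsol : solution s G l w (fun t => am l (s t w)).
    rewrite (model_amax lm (lexx l)); apply: (amax_solution (lm_adm lm) (lexx l)).
    by rewrite -(model_OmegaB lm (lexx l)).
  have uM r : t2 <= r <= 0 -> u r <= M.
    by move=> rr; apply: le_trans NM; apply: Hz; rewrite in_itv.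
  have hu' r : t2 <= r <= 0 -> is_derive r 1 u (F (s r w) (u r) + l).
    by move=> /andP[_ rr]; exact: hu.
  have [_ _ _ c1] := model_comparison lm t20 hu' uM rsol.
  rewrite fl.2.1 u0 in c1; have := c1 xr.
  have := Ht1 t2 t12; rewrite /= ltr_norml => /andP[].
  have := Hde _ (boundable_shift t2 ob); lra.
move=> xa; have [G [M [K [e [C [NM lm]]]]]] := models l x; have adm := lm_adm lm.
have [u [hu u0]] := solution_through adm l w 0 x.
have obG : OmegaB s (fun w x => G w x + l) w by rewrite -(model_OmegaB lm (lexx l)).
have ob0R : OmegaB (rev_flow s) (fun w x => rev_field G w x + l0) w.
  by rewrite OmegaB_rev -(model_OmegaB lm (ltW l0l)).
rewrite (model_rmin lm (lexx l)); rewrite (model_amax lm (lexx l)) in xa.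
have asol := amax_solution adm (lexx l) obG.
have uM t : u t <= M.
  have : u t < amax s (fun w x => G w x + l) (s t w).
    by apply: (solution_lt (adm_lip adm) (a := 0) t hu asol); rewrite fl.2.1 u0.
  have := le_trans (ler_norm _) (amax_bound adm (lexx l) (OmegaB_shift adm t obG)).
  by have := lm_CM lm; lra.
exists u; split; first by split => // t _; exact: (model_solution lm hu).
rewrite /cvg_ninfty; apply/cvgrPdist_le => ep ep0 /=.
have [|t0 Ht] := amax_basin (admissible_rev adm) l0l (lexx l) ob0R (solution_rev asol)
  (bounded_orbit_rev (amax_bounded adm (lexx l) obG)) (solution_rev hu) _ ep0.
  by rewrite /rev_fun oppr0 fl.2.1 u0 ltrN2.
exists (- t0); split; first exact: num_real.
move=> t tt /=; rewrite sub0r normrN.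
have := Ht (- t); rewrite amax_rev /rev_fun /rev_flow [- - t]opprK.
move: (rmin s (fun w x => G w x + l) (s t w)) => b.
have -> : - u t - - b = - (u t - b) by ring.
by rewrite normrN => h; apply: h; lra.
Qed.

Lemma extremal_near l0 l w (ep : R) : (forall w, OB l0 w) -> l0 < l -> 0 < ep ->
  \forall p \near (l, w), l0 < p.1 -> `|am p.1 p.2 - am l w| < ep /\ `|rm p.1 p.2 - rm l w| < ep.
Proof.
move=> HT l0l ep0; have [G [M [K [e [C [_ lm]]]]]] := models (l + 1) 0; have adm := lm_adm lm.
have ll : l <= l + 1 by lra.
have ll0 : l0 <= l + 1 by lra.
have HG w' : [set: T] w' -> OmegaB s (fun w x => G w x + l0) w'.
  by move=> _; rewrite -(model_OmegaB lm ll0).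
apply: filterS3 (amax_near adm HG l0l ll (I : [set: T] w) ep0)
  (rmin_near adm HG l0l ll (I : [set: T] w) ep0) (near_fst_le l w) => p h1 h2 pl pl0.
rewrite (model_amax lm pl) (model_amax lm ll) (model_rmin lm pl) (model_rmin lm ll).
by split; [exact: h1|exact: h2].
Qed.

Lemma extremal_continuous l0 l (ep : R) : (forall w, OB l0 w) -> l0 < l -> 0 < ep ->
  exists2 del : R, 0 < del & forall l', l0 < l' -> `|l' - l| < del -> forall w,
    `|am l' w - am l w| < ep /\ `|rm l' w - rm l w| < ep.
Proof.
move=> HT l0l ep0; have /compact_near_coveringP cK := cT.
have ep2 : 0 < ep / 2 by lra.
have [|del /= del0 H] := cK R (nbhs l) (fun l' w => l0 < l' ->
  `|am l' w - am l w| < ep /\ `|rm l' w - rm l w| < ep) _ _.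
  move=> w _; have h := extremal_near w HT l0l ep2.
  have h1 := near_pair_swap h.
  have h2 : \forall w' \near w & l' \near l,
      `|am l w' - am l w| < ep / 2 /\ `|rm l w' - rm l w| < ep / 2.
    exists ([set w' | `|am l w' - am l w| < ep / 2 /\ `|rm l w' - rm l w| < ep / 2], setT).
      split; last exact: filterT.
      by apply: filterS (near_pair_snd h) => w' /= h'; exact: h'.
    by move=> [a b] [].
  apply: filterS2 h1 h2 => -[w' l'] /= q1 [q2 q3] ll'.
  have [q4 q5] := q1 ll'; move: q2 q3 q4 q5; rewrite !ltr_norml.
  by move=> /andP[? ?] /andP[? ?] /andP[? ?] /andP[? ?]; split; apply/andP; split; lra.
exists del => // l' ll' ld w; apply: (H l') => //.
by rewrite /ball/= distrC.
Qed.

Lemma extremal_right_limits l w : OB l w ->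
  rm l' w @[l' --> l^'+] --> rm l w /\ am l' w @[l' --> l^'+] --> am l w.
Proof.
move=> ob; have [G [M [K [e [C [_ lm]]]]]] := models (l + 1) 0; have adm := lm_adm lm.
have ll : l <= l + 1 by lra.
have ob' : OmegaB s (fun w x => G w x + l) w by rewrite -(model_OmegaB lm ll).
have obr : OmegaB (rev_flow s) (fun w x => rev_field G w x + l) w by rewrite OmegaB_rev.
have n1 := near_pair_fst (near_fst_le l w).
have mono l' : l < l' -> [/\ OB l' w, am l w <= am l' w & rm l' w <= rm l w].
  move=> ll'; have [de de0 Hde] := extremal_gap ll'; have [h1 h2] := Hde w ob.
  by split; [exact: (boundable_mono (ltW ll'))|lra|lra].
split; apply/cvgrPdist_lt => ep ep0.
  suff : nbhs l [set l' | l < l' -> `|rm l w - rm l' w| < ep] by [].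
  apply: filterS2 (near_pair_fst (amax_usc (admissible_rev adm) ll obr ep0)) n1.
  move=> l' /= h l'L ll'; have [h1 _ h2] := mono l' ll'.
  have := h l'L; rewrite OmegaB_rev !amax_rev -!(model_rmin lm)// -(model_OmegaB lm)//.
  by move=> /(_ h1) h3; rewrite ltr_norml; apply/andP; split; lra.
suff : nbhs l [set l' | l < l' -> `|am l w - am l' w| < ep] by [].
apply: filterS2 (near_pair_fst (amax_usc adm ll ob' ep0)) n1.
move=> l' /= h l'L ll'; have [h1 h2 _] := mono l' ll'.
have := h l'L; rewrite -!(model_amax lm)// -(model_OmegaB lm)//.
by move=> /(_ h1) h3; rewrite ltr_norml; apply/andP; split; lra.
Qed.

Hypothesis low : exists l, forall w, ~ OB l w.

Definition fibre_threshold w : R := inf [set l | OB l w].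
Definition lower_threshold : R := inf (range fibre_threshold).
Definition upper_threshold : R := sup (range fibre_threshold).

Let boundable_low : exists lo : R, forall l w, OB l w -> lo <= l.
Proof.
have [lo H] := low; exists lo => l w ob; rewrite leNgt; apply/negP => ll.
exact: (H w (boundable_mono (ltW ll) ob)).
Qed.

Let boundable_top : exists hi : R, forall w, OB hi w.
Proof. by have [hi H] := boundable_high 0; exists hi => w; have [] := H hi w (lexx _). Qed.

Let fibre_has_inf w : has_inf [set l | OB l w].
Proof.
have [lo Hlo] := boundable_low; have [hi Hhi] := boundable_top.
by split; [exists hi; exact: Hhi|exists lo => l; exact: Hlo].
Qed.

Lemma fibre_thresholdP w l : OB l w <-> fibre_threshold w <= l.
Proof.
split=> [ob|tl]; first by apply: ge_inf => //; case: (fibre_has_inf w).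
apply: (boundable_mono tl); apply: contrapT => nob.
have := near_pair_fst (not_boundable_near nob) => -[del /= del0 H].
have [l' obl' l'l] := inf_adherent del0 (fibre_has_inf w).
apply: (H l') => //; have := ge_inf (fibre_has_inf w).2 obl'.
by rewrite -/(fibre_threshold w) in l'l * => h; rewrite /ball/= distrC ger0_norm; lra.
Qed.

Let range_has_lbound : has_lbound (range fibre_threshold).
Proof.
have [lo Hlo] := boundable_low; exists lo => _ [w _ <-]; apply: (Hlo _ w).
exact/fibre_thresholdP.
Qed.

Let range_has_ubound : has_ubound (range fibre_threshold).
Proof.
have [hi Hhi] := boundable_top; exists hi => _ [w _ <-].
by apply/fibre_thresholdP.
Qed.

Let range0 : range fibre_threshold !=set0. Proof. by exists (fibre_threshold point), point. Qed.

Lemma lower_threshold_infimum : infimums (range fibre_threshold) lower_threshold.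
Proof.
split=> [l hl|l hl]; first exact: (ge_inf range_has_lbound).
exact: lb_le_inf.
Qed.

Lemma upper_threshold_supremum : supremums (range fibre_threshold) upper_threshold.
Proof.
split=> [l hl|l hl]; first by apply: sup_upper_bound.
exact: ge_sup.
Qed.

Lemma upper_thresholdP l : (forall w, OB l w) <-> upper_threshold <= l.
Proof.
split=> [H|ul w].
  by apply: ge_sup => // _ [w _ <-]; apply/fibre_thresholdP.
apply/fibre_thresholdP; apply: le_trans ul.
by apply: (upper_threshold_supremum.1); exists w.
Qed.

Lemma lower_thresholdP l : (exists w, OB l w) <-> lower_threshold <= l.
Proof.
split=> [[w /fibre_thresholdP h]|ll].
  by apply: le_trans h; apply: (lower_threshold_infimum.1); exists w.
suff [w ob] : exists w, OB lower_threshold w by exists w; exact: (boundable_mono ll).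
apply: contrapT => /forallNP N; have /compact_near_coveringP cK := cT.
have [|del /= del0 H] := cK R (nbhs lower_threshold) (fun l w => ~ OB l w) _ _.
  by move=> w _; exact: (near_pair_swap (not_boundable_near (N w))).
have [_ [w _ <-] hl] := inf_adherent del0 (conj range0 range_has_lbound).
apply: (H (fibre_threshold w) _ w I); last by apply/fibre_thresholdP.
have : lower_threshold <= fibre_threshold w by apply: (lower_threshold_infimum.1); exists w.
by rewrite -/lower_threshold in hl; rewrite /ball/= distrC => h; rewrite ger0_norm; lra.
Qed.

Lemma threshold_le : lower_threshold <= upper_threshold.
Proof.
apply/lower_thresholdP; exists point; move: point.
by apply/upper_thresholdP.
Qed.

Lemma minimal_threshold : minimal_flow s -> lower_threshold = upper_threshold.
Proof.
move=> ms; apply: le_anti; rewrite threshold_le; apply/upper_thresholdP => w.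
have [w0 ob] : exists w, OB lower_threshold w by apply/lower_thresholdP.
by apply: (orbit_closure_boundable ob); rewrite (ms w0).
Qed.

Lemma upper_threshold_touching :
  infimums (range (fun w => am upper_threshold w - rm upper_threshold w)) 0.
Proof.
have ob : forall w, OB upper_threshold w by apply/upper_thresholdP.
split=> [_ [w _ <-]|y hy]; first by rewrite subr_ge0; exact: extremal_le.
rewrite leNgt; apply/negP => y0.
have [|l' ll' H] := gap_persists closedT (fun _ _ _ => I) (fun w _ => ob w) y0.
  by move=> w _; apply: hy; exists w.
suff : upper_threshold <= l' by lra.
by apply/upper_thresholdP => w; exact: H.
Qed.

Lemma attractor_repeller_upperP l : upper_threshold < l <->
  OB l = setT /\ attractor_repeller_on s setT (Fl l) (am l) (rm l).
Proof.
have obu : forall w, OB upper_threshold w by apply/upper_thresholdP.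
have := @attractor_repellerP setT l closedT (fun _ _ _ => I) => -[h1 h2]; split=> [ul|[ob AR]].
  have [|h3 h4] := h1; first by exists upper_threshold => // w _; exact: obu.
  by split => //; apply/seteqP; split.
have [|l0 l0l H] := h2; first by split => //; rewrite ob.
by apply: le_lt_trans l0l; apply/upper_thresholdP => w; exact: H.
Qed.

Lemma attractor_repeller_fibreP w l : fibre_threshold w < l <->
  orbit_closure s w `<=` OB l /\
  attractor_repeller_on s (orbit_closure s w) (Fl l) (am l) (rm l).
Proof.
have := @attractor_repellerP (orbit_closure s w) l (@closed_closure _ _)
  (@orbit_closure_invariant w) => -[h1 h2]; split=> [ul|h].
  apply: h1; exists (fibre_threshold w) => // w' h.
  by apply: (orbit_closure_boundable _ h); exact/fibre_thresholdP.
have [l0 l0l H] := h2 h.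
by apply: le_lt_trans l0l; apply/fibre_thresholdP; apply: H; exact: orbit_closure_self.
Qed.
End bifurcation.

Theorem mainTheorem3 (R : realType) (Omega : pseudoPMetricType R)
  (sigma : R -> Omega -> Omega) (c d : Omega -> R) (g : Omega -> R -> R) :
  (* standing assumptions: (Omega, sigma) continuous flow on a compact metric space *)
  hausdorff_space Omega -> compact [set: Omega] -> is_flow sigma ->
  (* (l1) *)
  continuous c -> continuous d -> C01 g ->
  (* (l2) *)
  (forall m : probability (Borel Omega) R, ergodic_measure sigma m ->
     (0 < integral_of m d)%E) ->
  (* (l3) *)
  (forall M : R, exists X : R, forall x, X < x -> forall w, d w * x + g w x < - M) ->
  (* (l4) *)
  (forall w x, g w x <= 0) ->
  (forall w x, x <= 0 -> g w x = 0) ->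
  (forall m : probability (Borel Omega) R, ergodic_measure sigma m ->
     m [set w | forall x, 0 < x -> g w x < 0] = 1%E) ->
  (* (l5) *)
  (forall m : probability (Borel Omega) R, ergodic_measure sigma m ->
     m [set w | concave_fun (g w)] = 1%E) ->
  (* (l6) *)
  (forall m : probability (Borel Omega) R, ergodic_measure sigma m ->
     forall a b : R, 0 <= a -> a <= b ->
     (0 < m [set w | strictly_decreasing_on [set x | (a <= x <= b)%R] (derive1 (g w))])%E) ->
  let F := fam c d g in
  exists ls lm : R, ls <= lm /\
  (* (i) *)
  ((forall l, lm < l <->
      OmegaB sigma (F l) = setT /\
      attractor_repeller_on sigma setT (F l) (amax sigma (F l)) (rmin sigma (F l))) /\
   (forall l, lm < l -> forall w x,
      ((exists u, is_sol sigma (F l) w x [set t | 0 <= t] u /\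
          cvg_pinfty (fun t => u t - amax sigma (F l) (sigma t w)) 0)
        <-> rmin sigma (F l) w < x) /\
      ((exists u, is_sol sigma (F l) w x [set t | t <= 0] u /\
          cvg_ninfty (fun t => u t - rmin sigma (F l) (sigma t w)) 0)
        <-> x < amax sigma (F l) w)) /\
   (forall l0, lm < l0 -> forall e : R, 0 < e -> exists del : R, 0 < del /\
      forall l, lm < l -> `|l - l0| < del -> forall w,
        `|(- rmin sigma (F l) w) - (- rmin sigma (F l0) w)| < e /\
        `|amax sigma (F l) w - amax sigma (F l0) w| < e) /\
   (forall l1 l2, lm < l1 -> l1 < l2 -> forall w,
      - rmin sigma (F l1) w < - rmin sigma (F l2) w /\
      amax sigma (F l1) w < amax sigma (F l2) w) /\
   (forall M : R, exists L : R, forall l, L < l -> forall w,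
      rmin sigma (F l) w < - M /\ M < amax sigma (F l) w)) /\
  (* (ii) *)
  (OmegaB sigma (F lm) = setT /\
   (forall w, rmin sigma (F l) w @[l --> lm^'+] --> rmin sigma (F lm) w /\
              amax sigma (F l) w @[l --> lm^'+] --> amax sigma (F lm) w) /\
   infimums (range (fun w => amax sigma (F lm) w - rmin sigma (F lm) w)) 0) /\
  (* (iii) *)
  (forall l1 l2, lm < l1 -> lm < l2 -> forall w,
     amax sigma (F lm) w < amax sigma (F l1) w /\
     rmin sigma (F lm) w <= amax sigma (F lm) w /\
     rmin sigma (F l2) w < rmin sigma (F lm) w) /\
  (* (iv) *)
  (forall l, l < ls <-> OmegaB sigma (F l) = set0) /\
  (* (v) *)
  (ls < lm -> forall l, ls <= l -> l < lm -> OmegaB sigma (F l) `<` setT) /\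
  (* (vi) *)
  (minimal_flow sigma -> ls = lm) /\
  (* (vii) *)
  (exists lw : Omega -> R,
     (forall w l, lw w < l <->
        orbit_closure sigma w `<=` OmegaB sigma (F l) /\
        attractor_repeller_on sigma (orbit_closure sigma w) (F l)
          (amax sigma (F l)) (rmin sigma (F l))) /\
     infimums (range lw) ls /\ supremums (range lw) lm).
Proof.
move=> hT cT fl cc cd hg l2 l3 gle0 g0 l4 l5 l6 F.
pose F0 := base_field c d g.
have models (Lam N : R) : exists G M K e C, N <= M /\ local_model sigma F0 G Lam M K e C.
  by apply: family_model.
have bnd (x : R) : exists B : R, forall w, `|F0 w x| <= B by apply: base_field_bounded.
have low : exists l, forall w, ~ OmegaB sigma (fun w x => F0 w x + l) w.
  by apply: no_bounded_low.
pose ls := lower_threshold sigma F0; pose lm := upper_threshold sigma F0.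
have lowP l : (exists w, OmegaB sigma (F l) w) <-> ls <= l by apply: lower_thresholdP.
have upP l : (forall w, OmegaB sigma (F l) w) <-> lm <= l by apply: upper_thresholdP.
have ub : forall w, OmegaB sigma (F lm) w by apply/upP.
have gap l l' : l < l' -> exists2 de : R, 0 < de & forall w, OmegaB sigma (F l) w ->
    de <= amax sigma (F l') w - amax sigma (F l) w /\
    de <= rmin sigma (F l) w - rmin sigma (F l') w.
  by apply: extremal_gap.
exists ls, lm; split; first by apply: threshold_le.
split; [split; [|split; [|split; [|split]]]|].
- by move=> l; apply: attractor_repeller_upperP.
- move=> l ul w x; split.
    by apply: (basin_forward fl models x ul); exact: ub.
  by apply: (basin_backward fl models x ul); exact: ub.
- move=> l0 ul0 e e0.
  have [del del0 H] : exists2 del : R, 0 < del & forall l', lm < l' -> `|l' - l0| < del ->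
      forall w, `|amax sigma (F l') w - amax sigma (F l0) w| < e /\
        `|rmin sigma (F l') w - rmin sigma (F l0) w| < e.
    by apply: extremal_continuous.
  exists del; split => // l ul ld w; have [h1 h2] := H l ul ld w.
  by rewrite -opprD normrN.
- move=> l1 l2' ul1 l12 w; have [de de0 H] := gap _ _ l12.
  have [|h1 h2] := H w; first by move: w; apply/upP; exact: ltW.
  by rewrite ltrN2 -subr_gt0 -(subr_gt0 (amax _ _ _)); split; lra.
- move=> M.
  have [L H] : exists L : R, forall l w, L <= l -> [/\ OmegaB sigma (F l) w,
      M + 1 <= amax sigma (F l) w & rmin sigma (F l) w <= - (M + 1)].
    by apply: boundable_high.
  exists L => l Ll w; have [_ h1 h2] := H l w (ltW Ll).
  split; first by apply: le_lt_trans h2 _; rewrite ltrN2 ltrDl.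
  by apply: lt_le_trans h1; rewrite ltrDl.
split; [split; [|split]|].
- by apply/seteqP; split.
- by move=> w; apply: extremal_right_limits => //; exact: ub.
- by apply: upper_threshold_touching.
split.
  move=> l1 l2' ul1 ul2 w.
  have [d1 d10 /(_ w (ub w))[h1 _]] := gap _ _ ul1.
  have [d2 d20 /(_ w (ub w))[_ h2]] := gap _ _ ul2.
  rewrite -subr_gt0 -(subr_gt0 (rmin _ _ _)); split; first lra.
  by split; [apply: extremal_le => //; exact: ub|lra].
split.
  move=> l; split=> [ll|e0].
    apply/seteqP; split => // w ob; have : ls <= l by apply/lowP; exists w.
    by rewrite leNgt ll.
  by rewrite ltNge; apply/negP => /lowP[w]; rewrite e0.
split.
  move=> _ l _ ll; split => // h; have : lm <= l by apply/upP => w; exact: h.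
  by rewrite leNgt ll.
split; first by apply: minimal_threshold.
exists (fibre_threshold sigma F0); split.
  by move=> w l; apply: attractor_repeller_fibreP.
split; first by apply: lower_threshold_infimum.
by apply: upper_threshold_supremum.
Qed.
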